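(* Suppose that $\Omega=B_1(0)\subset\mathbb{R}^2$ and $u_0\equiv C$ for a constant $C>0$. Then there exists a minimizer $v\in\mathcal{A}(C)$ of $\mathcal{E}$ that is radial.
   Context: $B_1(0)$ is the open unit disc in $\mathbb{R}^2$. For a constant $C>0$, $\mathcal{A}(C):=\{u\in W^{2,2}(\Omega): u-C\in W^{1,2}_0(\Omega)\}$ and, for $u\in\mathcal{A}(C)$, $\mathcal{E}(u):=\int_\Omega(\Delta u)^2\,dx+|\{x\in\Omega:u(x)>0\}|$, where $|\cdot|$ is Lebesgue measure. A minimizer is a $u\in\mathcal{A}(C)$ with $\mathcal{E}(u)=\inf_{w\in\mathcal{A}(C)}\mathcal{E}(w)$. Radial means that $v(x)$ depends only on $|x|$. *)

(* Defs.v *)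
From HB Require Import structures.
From mathcomp Require Import all_boot all_order all_algebra.
From mathcomp Require Import all_classical all_reals all_analysis.
Set Implicit Arguments.
Unset Strict Implicit.
Unset Printing Implicit Defensive.
Import Order.TTheory GRing.Theory Num.Theory.
Import numFieldNormedType.Exports.
Local Open Scope classical_set_scope.
Local Open Scope ring_scope.

Notation lebesgue2 R :=
  (@lebesgue_measure R \x @lebesgue_measure R)%E (only parsing).

(* The plane is R * R; the norm that the library puts on R * R is the sup
   norm, so the Euclidean norm is defined separately (the topology is the
   same). *)
Section Plane.
Variable R : realType.

Definition eucl_norm (x : R * R) : R := Num.sqrt (x.1 ^+ 2 + x.2 ^+ 2).

Definition unit_disc : set (R * R) := [set x | eucl_norm x < 1].

Definition basis2 (i : 'I_2) : R * R := if i == ord0 then (1, 0) else (0, 1).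

(* [partials [:: i1; ...; ik] phi] is d_i1 ... d_ik phi. *)
Definition partials (s : seq 'I_2) (phi : R * R -> R) : R * R -> R :=
  foldr (fun i f x => 'D_(basis2 i) f x) phi s.

Definition smooth (phi : R * R -> R) : Prop :=
  forall s : seq 'I_2, continuous (partials s phi) /\
    forall x i, derivable (partials s phi) x (basis2 i).

Definition support2 (phi : R * R -> R) : set (R * R) :=
  closure [set x | phi x != 0].

(* C_c^oo(Omega), its elements being extended by 0 to the plane *)
Definition test_function (Omega : set (R * R)) (phi : R * R -> R) : Prop :=
  [/\ smooth phi, compact (support2 phi) & support2 phi `<=` Omega].

End Plane.

(* Elements of Lebesgue and Sobolev spaces on Omega are represented by Borel
   functions on the plane of which only the values on Omega matter; every
   a.e.-class of Lebesgue measurable functions has such a representative. *)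
Section Sobolev.
Variables (R : realType) (Omega : set (R * R)).
Local Notation mu := (lebesgue2 R).

Definition L2 (u : R * R -> R) : Prop :=
  measurable_fun Omega u /\
  (\int[mu]_(x in Omega) ((u x) ^+ 2)%:E < +oo)%E.

(* g is the weak derivative d_s u, s being the word of the differentiations;
   only square-integrable weak derivatives are needed. *)
Definition is_weak_deriv (s : seq 'I_2) (u g : R * R -> R) : Prop :=
  L2 g /\ forall phi, test_function Omega phi ->
    \int[mu]_(x in Omega) (u x * partials s phi x) =
    (-1) ^+ size s * \int[mu]_(x in Omega) (g x * phi x).

(* W^{k,2}(Omega) *)
Definition Wk2 (k : nat) (u : R * R -> R) : Prop :=
  L2 u /\
  forall s : seq 'I_2, (size s <= k)%N -> exists g, is_weak_deriv s u g.

(* A chosen representative of the weak derivative (unique a.e. in Omega when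
   it exists); the default value 0 is irrelevant on the relevant Sobolev
   spaces. *)
Definition weak_deriv (s : seq 'I_2) (u : R * R -> R) : R * R -> R :=
  xget (fun=> 0) [set g | is_weak_deriv s u g].

Definition weak_laplacian (u : R * R -> R) (x : R * R) : R :=
  \sum_(i < 2) weak_deriv [:: i; i] u x.

Definition W12_normsq (u : R * R -> R) : \bar R :=
  (\int[mu]_(x in Omega)
    ((u x) ^+ 2 + \sum_(i < 2) (weak_deriv [:: i] u x) ^+ 2)%:E)%E.

(* W^{1,2}_0(Omega): the closure of C_c^oo(Omega) in W^{1,2}(Omega) *)
Definition W12_0 (u : R * R -> R) : Prop :=
  Wk2 1 u /\ forall e : R, 0 < e ->
    exists phi, test_function Omega phi /\
      (W12_normsq (fun x => u x - phi x)%R < e%:E)%E.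

Definition admissible (C : R) : set (R * R -> R) :=
  [set u | Wk2 2 u /\ W12_0 (fun x => u x - C)].

Definition energy (u : R * R -> R) : \bar R :=
  (\int[mu]_(x in Omega) ((weak_laplacian u x) ^+ 2)%:E
   + mu (Omega `&` [set x | (0 < u x)%R]))%E.

Definition minimizer (C : R) (v : R * R -> R) : Prop :=
  admissible C v /\ energy v = ereal_inf (energy @` admissible C).

Definition radial (v : R * R -> R) : Prop :=
  exists f : R -> R, forall x, Omega x -> v x = f (eucl_norm x).

End Sobolev.

(* Main.v *)
(* Let u be admissible, psi a test function close to C - u in W^{1,2}, f the
   Laplacian of u and m(t) = |{psi > t}|. Testing f against theta(psi) gives,
   up to a small error, int f theta(psi) = int theta'(psi) |grad psi|^2. On a
   band {t < psi < t + h} the Cauchy-Schwarz inequality and the sharp Sobolev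
   inequality 4 pi int phi^2 <= (int |grad phi|)^2 bound the Dirichlet integral
   from below by 4 pi h^2 m(t + h) / (m(t) - m(t + h)). With theta' equal to the
   relative decrease of m, so that theta(psi) is essentially ln (pi / m(psi)),
   a further Cauchy-Schwarz inequality yields
     16 pi^2 C^2 <= (int f^2) * 2 (pi - a - a ln (pi / a)),  a = |{u <= 0}|.
   Equality holds for the radial functions whose Laplacian is proportional to
   ln max(|x|^2, r), with a = pi r. Hence the infimum of the energy is the
   smaller one of pi, the energy of u = C, and of the infimum over 0 < r < 1 of
     pi (8 C^2 / (1 - r + r ln r) + 1 - r);
   if the latter is less than pi, it is attained because the values of r near 0
   and near 1 do not compete. *)
Require Import Defs.
From mathcomp Require Import all_boot all_order all_algebra.
From mathcomp Require Import all_classical all_reals all_analysis.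
From mathcomp Require Import measurable_realfun.
From mathcomp Require Import ring lra.
Set Implicit Arguments.
Unset Strict Implicit.
Unset Printing Implicit Defensive.
Import Order.TTheory GRing.Theory Num.Theory.
Import numFieldNormedType.Exports.
Local Open Scope ring_scope.
Local Open Scope classical_set_scope.

(** Instead of extracting a weakly convergent minimizing sequence, the proof computes the infimum,
    so that compactness is needed only for one real parameter. No coarea formula enters: level sets
    are handled for one smooth [psi], at the finitely many levels [k h], and truncations are
    replaced by smooth ramps. The order of the limits shapes the estimates. With [N] levels, the
    weak gradient of [u - C + psi] costs at most [N de sqrt (e G)], and the Dirichlet integral [G]
    of [psi] stays bounded because the equation is also tested with [psi] itself. So [e] tends to 0
    first and [N] to infinity next; last comes one parameter [t] that measures at once the loss of
    the ramps, of the top level and of the area, and the threshold for large relative drops of [m].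
    Those drops are left out of theta, and their number is bounded independently of [N]. On the
    other side, weak derivatives are chosen representatives, so the energy of a competitor is known
    only after their uniqueness, and W^{1,2}_0 asks for test functions near the competitor.
    Primitives of smoothed step functions of |x|^2 provide them without mollification. *)

Section DirectionalDerivative.
Variables (R : realType) (V : normedModType R).
Implicit Types (f : V -> R) (h : R -> R).

Lemma derive_lineE f x v : 'D_v f x = (fun t => f (t *: v + x))^`() 0.
Proof.
rewrite derive1E /derive; set g1 := fun r => r^-1 *: _; set g2 := fun r => r^-1 *: _.
suff -> : g1 = g2 by [].
by rewrite funeqE /g1 /g2 => r /=; rewrite addr0 scale0r add0r [_%:A]mulr1.
Qed.

Lemma is_derive_lineP f x v d :
  is_derive x v f d <-> is_derive (0 : R) 1 (fun t : R => f (t *: v + x)) d.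
Proof.
split=> -[fd fE]; split.
- exact: (derivable1P f x v).1 fd.
- by rewrite -derive1E -derive_lineE.
- exact: (derivable1P f x v).2 fd.
- by rewrite derive_lineE derive1E.
Qed.

(** Restriction to the line through [x] reduces this to the chain rule in one variable, so that [f]
    may have a derivative in the direction [v] alone. *)
Lemma is_derive_comp1 f h x v df dh : is_derive x v f df ->
  is_derive (f x) (1 : R) h dh -> is_derive x v (h \o f) (dh * df).
Proof.
move=> /is_derive_lineP fd hd; apply/is_derive_lineP.
have hd' : is_derive (f (0 *: v + x)) (1 : R) h dh by rewrite scale0r add0r.
case: fd => fd1 fd2; case: hd' => hd1 hd2.
split.
  apply/derivable1_diffP.
  apply: (@differentiable_comp _ _ _ _ (fun t : R => f (t *: v + x)) h).
    exact: (derivable1_diffP _ _).1 fd1.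
  exact: (derivable1_diffP _ _).1 hd1.
by rewrite -derive1E (derive1_comp fd1 hd1) !derive1E fd2 hd2.
Qed.

End DirectionalDerivative.

(** * Smooth functions of one and of two variables *)

Section Smooth.
Variable R : realType.
Implicit Types (f g phi psi : R * R -> R) (h k : R -> R) (t : R).

Lemma is_derive_fst (x y d : R) f :
  is_derive (x, y) (1, 0) f d <-> is_derive x 1 (fun t => f (t, y)) d.
Proof.
have E : (fun t : R => f (t *: (1, 0) + (x, y))) =
    (fun t : R => f (t *: (1 : R) + x, y)).
  apply/funext => t; congr f; congr pair => /=.
  by rewrite scaler0 add0r.
split=> /is_derive_lineP D; apply/is_derive_lineP; first by rewrite -E.
by rewrite E.
Qed.

Lemma is_derive_snd (x y d : R) f :
  is_derive (x, y) (0, 1) f d <-> is_derive y 1 (fun t => f (x, t)) d.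
Proof.
have E : (fun t : R => f (t *: (0, 1) + (x, y))) =
    (fun t : R => f (x, t *: (1 : R) + y)).
  apply/funext => t; congr f; congr pair => /=.
  by rewrite scaler0 add0r.
split=> /is_derive_lineP D; apply/is_derive_lineP; first by rewrite -E.
by rewrite E.
Qed.

Lemma basis20 : basis2 R ord0 = (1, 0). Proof. by []. Qed.
Lemma basis21 : basis2 R (lift ord0 ord0) = (0, 1). Proof. by []. Qed.

(** Smoothness is proved by membership in such a class: an induction on the word of derivatives then
    replaces formulas for iterated derivatives. *)
Definition derivation_closed (F : (R * R -> R) -> Prop) := forall f, F f ->
  [/\ continuous f, forall x i, derivable f x (basis2 R i) &
    forall i, F (fun x => 'D_(basis2 R i) f x)].

Lemma derivation_closed_smooth F f : derivation_closed F -> F f -> smooth f.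
Proof.
move=> HF Ff s.
have Fs : F (partials s f) by elim: s => [//|i s IH] /=; case: (HF _ IH).
by case: (HF _ Fs).
Qed.

Lemma smooth_derivation_closed : derivation_closed (@smooth R).
Proof.
move=> f sf; split; [exact: (sf [::]).1|exact: (sf [::]).2|].
move=> i s; have -> : partials s (fun x => 'D_(basis2 R i) f x) =
  partials (rcons s i) f by rewrite /partials foldr_rcons.
exact: sf.
Qed.

Lemma smooth_derivable f x i : smooth f -> derivable f x (basis2 R i).
Proof. by move=> /smooth_derivation_closed[]. Qed.

Lemma smooth_continuous f : smooth f -> continuous f.
Proof. by move=> /smooth_derivation_closed[]. Qed.

Lemma smooth_derive f i : smooth f -> smooth (fun x => 'D_(basis2 R i) f x).
Proof. by move=> /smooth_derivation_closed[]. Qed.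

Lemma smooth_is_derive f x i : smooth f ->
  is_derive x (basis2 R i) f ('D_(basis2 R i) f x).
Proof. by move=> sf; apply/derivableP/smooth_derivable. Qed.

Definition smooth1 h := forall n t, derivable (h^`(n)) t 1.

Definition derivation_closed1 (F : (R -> R) -> Prop) := forall h, F h ->
  (forall t, derivable h t 1) /\ F h^`().

Lemma derivation_closed1_smooth F h :
  derivation_closed1 F -> F h -> smooth1 h.
Proof.
move=> HF Fh n.
have Fn : F h^`(n).
  elim: n => [|n IH]; first by rewrite derive1n0.
  by rewrite derive1nS; case: (HF _ IH).
by case: (HF _ Fn).
Qed.

Lemma smooth1_derivation_closed : derivation_closed1 smooth1.
Proof.
move=> h sh; split=> [t|n t]; first by have := sh 0%N t; rewrite derive1n0.
by rewrite -derive1Sn; exact: sh.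
Qed.

Lemma smooth1_derivable h t : smooth1 h -> derivable h t 1.
Proof. by move=> /smooth1_derivation_closed[]. Qed.

Lemma smooth1_derive h : smooth1 h -> smooth1 h^`().
Proof. by move=> /smooth1_derivation_closed[]. Qed.

Lemma smooth1_is_derive h t : smooth1 h -> is_derive t 1 h (h^`()%classic t).
Proof. by move=> sh; rewrite derive1E; apply/derivableP/smooth1_derivable. Qed.

Lemma derivable_continuous h : (forall t, derivable h t 1) -> continuous h.
Proof. by move=> dh t; exact/differentiable_continuous/derivable1_diffP. Qed.

Lemma smooth1_continuous h : smooth1 h -> continuous h.
Proof. by move=> sh; apply: derivable_continuous => t; exact: smooth1_derivable. Qed.

Lemma smooth1_primitive h k : (forall t, is_derive t 1 h (k t)) -> smooth1 k ->
  smooth1 h.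
Proof.
move=> hk sk [|n] t; first by rewrite derive1n0; case: (hk t).
rewrite derive1Sn; have -> : h^`() = k by apply/funext => u; rewrite derive1E; case: (hk u).
exact: sk.
Qed.

(** Differentiating [h \o psi] produces products of smooth functions with composites of [psi] and
    higher derivatives of [h]. The algebra generated by both is closed under differentiation and
    yields sums, products and compositions at once. *)
Inductive smooth_alg h psi : (R * R -> R) -> Prop :=
| smooth_alg_base f : smooth f -> smooth_alg h psi f
| smooth_alg_add f g : smooth_alg h psi f -> smooth_alg h psi g ->
    smooth_alg h psi (fun x => f x + g x)
| smooth_alg_mul f g : smooth_alg h psi f -> smooth_alg h psi g ->
    smooth_alg h psi (fun x => f x * g x)
| smooth_alg_comp n : smooth_alg h psi (h^`(n) \o psi).

Lemma smooth_alg_closed h psi : smooth1 h -> smooth psi ->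
  derivation_closed (smooth_alg h psi).
Proof.
move=> sh sp f; elim=> {f} [f sf|f g sf [cf df Df] sg [cg dg Dg]
  |f g sf [cf df Df] sg [cg dg Dg]|n].
- have [cf df Df] := smooth_derivation_closed sf; split=> // i.
  exact: smooth_alg_base (Df i).
- split=> [x|x i|i]; first exact: cvgD (cf x) (cg x).
    exact: derivableD (df x i) (dg x i).
  rewrite (_ : (fun _ => _) = (fun x => 'D_(basis2 R i) f x + 'D_(basis2 R i) g x)).
    exact: smooth_alg_add.
  by apply/funext => x; rewrite deriveD.
- split=> [x|x i|i]; first exact: cvgM (cf x) (cg x).
    exact: derivableM (df x i) (dg x i).
  rewrite (_ : (fun _ => _) = (fun x => f x * 'D_(basis2 R i) g x + g x * 'D_(basis2 R i) f x)).
    by apply: smooth_alg_add; exact: smooth_alg_mul.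
  by apply/funext => x; rewrite deriveM.
- have hd x i : is_derive x (basis2 R i) (h^`(n) \o psi)
    (h^`(n.+1)%classic (psi x) * 'D_(basis2 R i) psi x).
    apply: is_derive_comp1; first exact: smooth_is_derive.
    rewrite derive1nS derive1E; exact/derivableP/sh.
  split=> [x|x i|i].
  + apply: continuous_comp; first exact: smooth_continuous.
    by apply: derivable_continuous => t; exact: sh.
  + by case: (hd x i).
  + rewrite (_ : (fun _ => _) = (fun x => (h^`(n.+1) \o psi) x * 'D_(basis2 R i) psi x)).
      apply: smooth_alg_mul; first exact: smooth_alg_comp.
      exact/smooth_alg_base/smooth_derive.
    by apply/funext => x; case: (hd x i).
Qed.

Lemma smooth_comp h psi : smooth1 h -> smooth psi -> smooth (h \o psi).
Proof.
move=> sh sp; apply: (derivation_closed_smooth (smooth_alg_closed sh sp)).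
by rewrite -[h]derive1n0; exact: smooth_alg_comp.
Qed.

Lemma smooth_cst (c : R) : smooth (fun=> c : R).
Proof.
pose F := fun f : R * R -> R => exists c, f = (fun=> c).
apply: (@derivation_closed_smooth F); last by exists c.
move=> _ [d ->]; split=> [x|x i|i].
- exact: cvg_cst.
- exact: derivable_cst.
- by exists 0; apply/funext => x; exact: derive_cst.
Qed.

Lemma smooth1_cst (c : R) : smooth1 (fun=> c).
Proof.
pose F := fun f : R -> R => exists c, f = (fun=> c).
apply: (@derivation_closed1_smooth F); last by exists c.
move=> _ [d ->]; split=> [x|]; first exact: derivable_cst.
by exists 0; apply/funext => x; rewrite derive1E; exact: derive_cst.
Qed.

Lemma smooth1_id : smooth1 id.
Proof.
apply: (@smooth1_primitive _ (fun=> 1)); last exact: smooth1_cst.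

Qed.

Lemma smoothD f g : smooth f -> smooth g -> smooth (fun x => f x + g x).
Proof.
move=> sf sg; apply: (derivation_closed_smooth (smooth_alg_closed smooth1_id sf)).
by apply: smooth_alg_add; exact: smooth_alg_base.
Qed.

Lemma smoothM f g : smooth f -> smooth g -> smooth (fun x => f x * g x).
Proof.
move=> sf sg; apply: (derivation_closed_smooth (smooth_alg_closed smooth1_id sf)).
by apply: smooth_alg_mul; exact: smooth_alg_base.
Qed.

Lemma smooth_sum (n : nat) (F : nat -> R * R -> R) :
  (forall j, smooth (F j)) -> smooth (fun x => \sum_(j < n) F j x).
Proof.
move=> sF; elim: n => [|n IH].
  by under eq_fun do rewrite big_ord0; exact: smooth_cst.
by under eq_fun do rewrite big_ord_recr; exact: smoothD IH (sF n).
Qed.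

Inductive smooth1_alg h k : (R -> R) -> Prop :=
| smooth1_alg_l n : smooth1_alg h k h^`(n)
| smooth1_alg_r n : smooth1_alg h k k^`(n)
| smooth1_alg_add (f g : R -> R) : smooth1_alg h k f -> smooth1_alg h k g ->
    smooth1_alg h k (fun x => f x + g x)
| smooth1_alg_mul (f g : R -> R) : smooth1_alg h k f -> smooth1_alg h k g ->
    smooth1_alg h k (fun x => f x * g x).

Lemma smooth1_alg_closed h k : smooth1 h -> smooth1 k ->
  derivation_closed1 (smooth1_alg h k).
Proof.
move=> sh sk f; elim=> {f} [n|n|f g sf [df Df] sg [dg Dg]
  |f g sf [df Df] sg [dg Dg]].
- split=> [t|]; first exact: sh.
  by rewrite -derive1nS; exact: smooth1_alg_l.
- split=> [t|]; first exact: sk.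
  by rewrite -derive1nS; exact: smooth1_alg_r.
- split=> [x|]; first exact: derivableD.
  rewrite (_ : _^`() = (fun x => f^`()%classic x + g^`()%classic x)); first exact: smooth1_alg_add.
  by apply/funext => x; rewrite !derive1E deriveD.
- split=> [x|]; first exact: derivableM.
  rewrite (_ : _^`() = (fun x => f x * g^`()%classic x + g x * f^`()%classic x)).
    by apply: smooth1_alg_add; exact: smooth1_alg_mul.
  by apply/funext => x; rewrite !derive1E deriveM.
Qed.

Lemma smooth1D h k : smooth1 h -> smooth1 k -> smooth1 (fun x => h x + k x).
Proof.
move=> sh sk; apply: (derivation_closed1_smooth (smooth1_alg_closed sh sk)).
apply: smooth1_alg_add; first by rewrite -[h]derive1n0; exact: smooth1_alg_l.
by rewrite -[k](derive1n0 k); exact: smooth1_alg_r.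
Qed.

Lemma smooth1M h k : smooth1 h -> smooth1 k -> smooth1 (fun x => h x * k x).
Proof.
move=> sh sk; apply: (derivation_closed1_smooth (smooth1_alg_closed sh sk)).
apply: smooth1_alg_mul; first by rewrite -[h]derive1n0; exact: smooth1_alg_l.
by rewrite -[k](derive1n0 k); exact: smooth1_alg_r.
Qed.

Lemma smooth1_sum (n : nat) (F : nat -> R -> R) :
  (forall j, smooth1 (F j)) -> smooth1 (fun x => \sum_(j < n) F j x).
Proof.
move=> sF; elim: n => [|n IH].
  by under eq_fun do rewrite big_ord0; exact: smooth1_cst.
by under eq_fun do rewrite big_ord_recr; exact: smooth1D IH (sF n).
Qed.

(** Each differentiation brings out a factor [a], which [c] absorbs. *)
Inductive affine_alg h (a b : R) : (R -> R) -> Prop :=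
| affine_alg_intro n c : affine_alg h a b (fun t => c * h^`(n)%classic (a * t + b)).

Lemma smooth1_affine h (a b : R) : smooth1 h -> smooth1 (fun t => h (a * t + b)).
Proof.
move=> sh; apply: (@derivation_closed1_smooth (affine_alg h a b)); last first.
  have := affine_alg_intro h a b 0 1; rewrite derive1n0.
  by under eq_fun do rewrite mul1r.
move=> _ [n c].
have H t : is_derive t 1 (fun t => c * h^`(n)%classic (a * t + b))
  ((c * a) * h^`(n.+1)%classic (a * t + b)).
  have ad : is_derive t 1 (fun t => a * t + b) a.
    apply: is_derive_eq; last by rewrite addr0 [_%:A]mulr1.
  have hd : is_derive (a * t + b) 1 h^`(n) (h^`(n.+1)%classic (a * t + b)).
    by rewrite derive1nS derive1E; exact/derivableP/sh.
  have := is_derive_comp1 ad hd => cd.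
  by apply: is_derive_eq; rewrite /GRing.scale/= mulrCA mulrC.
split=> [t|]; first by case: (H t).
rewrite (_ : _^`() = fun t => (c * a) * h^`(n.+1)%classic (a * t + b)); first exact: affine_alg_intro.
by apply/funext => t; rewrite derive1E; case: (H t).
Qed.

Lemma smooth_fst : smooth (fun x : R * R => x.1).
Proof.
pose F := fun f : R * R -> R => smooth f \/ f = fst.
apply: (@derivation_closed_smooth F); last by right.
move=> f [sf|->]; first by have [? ? H] := smooth_derivation_closed sf; split=> // i; left; exact: H.
have D (x : R * R) i : is_derive x (basis2 R i) fst (if i == ord0 then 1 else 0).
  case: x => x y; rewrite /basis2; case: ifP => _.
    by apply/is_derive_fst; exact: is_derive_id.
  by apply/is_derive_snd; exact: is_derive_cst.
split=> [x|x i|i]; first exact: cvg_fst.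
  by case: (D x i).
left; rewrite (_ : (fun _ => _) = fun=> if i == ord0 then 1 else 0); first exact: smooth_cst.
by apply/funext => x; case: (D x i).
Qed.

Lemma smooth_snd : smooth (fun x : R * R => x.2).
Proof.
pose F := fun f : R * R -> R => smooth f \/ f = snd.
apply: (@derivation_closed_smooth F); last by right.
move=> f [sf|->]; first by have [? ? H] := smooth_derivation_closed sf; split=> // i; left; exact: H.
have D (x : R * R) i : is_derive x (basis2 R i) snd (if i == ord0 then 0 else 1).
  case: x => x y; rewrite /basis2; case: ifP => _.
    by apply/is_derive_fst; exact: is_derive_cst.
  by apply/is_derive_snd; exact: is_derive_id.
split=> [x|x i|i]; first exact: cvg_snd.
  by case: (D x i).
left; rewrite (_ : (fun _ => _) = fun=> if i == ord0 then 0 else 1); first exact: smooth_cst.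
by apply/funext => x; case: (D x i).
Qed.

End Smooth.

(** * Flat functions *)

Section FlatFunction.
Variable R : realType.
Implicit Types (e t : R) (k : nat).

(* [flat e 0] converges to the indicator of the positive numbers as [e] tends
   to 0; the factor [t^-1 ^+ k] occurs in its derivatives. *)
Definition flat e k t : R := if 0 < t then t^-1 ^+ k * expR (- (e / t)) else 0.

Lemma flat_le0 e k t : t <= 0 -> flat e k t = 0.
Proof. by rewrite /flat ltNge => ->. Qed.

Lemma flat_gt0E e k t : 0 < t -> flat e k t = t^-1 ^+ k * expR (- (e / t)).
Proof. by rewrite /flat => ->. Qed.

Lemma flat_ge0 e k t : 0 <= flat e k t.
Proof.
rewrite /flat; case: ifPn => // t0.
by rewrite mulr_ge0 ?expR_ge0 ?exprn_ge0 ?invr_ge0 ?ltW.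
Qed.

Lemma flat0_le1 e t : 0 <= e -> flat e 0 t <= 1.
Proof.
move=> e0; rewrite /flat; case: ifPn => // t0.
by rewrite expr0 mul1r expR_le1 oppr_le0 divr_ge0// ltW.
Qed.

(** The term of degree [k + 1] of the exponential series at [e / t] already beats the pole of order
    [k] and leaves a factor [t]. This is what makes the difference quotients at 0 tend to 0. *)
Lemma flat_le_linear e k t : 0 < e ->
  flat e k t <= k.+1`!%:R / e ^+ k.+1 * `|t|.
Proof.
move=> e0; have [t0|t0] := leP t 0.
  by rewrite flat_le0// mulr_ge0// divr_ge0 ?ler0n ?exprn_ge0 ?ltW.
rewrite flat_gt0E// gtr0_norm// expRN.
have x0 : 0 < e / t by rewrite divr_gt0.
have : (e / t) ^+ k.+1 / k.+1`!%:R <= expR (e / t).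
  by apply: le_trans (expR_ge1Dxn k (ltW x0)); rewrite lerDr.
have f0 : (0 : R) < k.+1`!%:R by rewrite ltr0n fact_gt0.
have q0 : 0 < (e / t) ^+ k.+1 / k.+1`!%:R by rewrite divr_gt0// exprn_gt0.
rewrite -(lef_pV2 _ _); [|by rewrite posrE expR_gt0|by rewrite posrE].
move=> H; have tk : 0 <= t^-1 ^+ k by rewrite exprn_ge0// invr_ge0 ltW.
apply: (le_trans (ler_wpM2l tk H)).
rewrite le_eqVlt; apply/orP; left; apply/eqP.
rewrite invf_div expr_div_n exprVn exprS [t ^+ k.+1]exprS.
have ek : e ^+ k != 0 by rewrite expf_neq0 // gt_eqF.
have tk' : t ^+ k != 0 by rewrite expf_neq0 // gt_eqF.
have e1 : e != 0 by rewrite gt_eqF.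
have t1 : t != 0 by rewrite gt_eqF.
by field; rewrite ?ek ?tk' ?e1 ?t1.
Qed.

Lemma is_derive_flat e k t : 0 < e ->
  is_derive t (1 : R) (flat e k) (- k%:R * flat e k.+1 t + e * flat e k.+2 t).
Proof.
move=> e0; have [t0|t0|->] := ltgtP t 0.
- rewrite !flat_le0 ?(ltW t0)// !mulr0 addr0.
  apply: (@near_eq_is_derive _ _ _ (cst (0 : R))).
  near=> x; rewrite flat_le0// ltW//.
  by near: x; exact: lt_nbhsl.
- apply: (@near_eq_is_derive _ _ _ (fun t => t^-1 ^+ k * expR (- (e / t)))).
    near=> x; rewrite flat_gt0E//.
    by near: x; exact: lt_nbhsr.
  have t1 : t != 0 by rewrite gt_eqF.
  have dV : is_derive t (1 : R) (fun t : R => t^-1) (- t ^- 2).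
    split; first exact: derivableV.
    by rewrite (@deriveV _ _ id)// derive_id /GRing.scale/= mulr1.
  have dE : is_derive t 1 (fun t => - (e / t)) (e / t ^+ 2).
    apply: is_derive_eq; rewrite /GRing.scale/=; field.
    by rewrite t1.
  have dX := is_derive_comp1 dE (is_derive_expR _).
  have dk : is_derive t 1 (fun t => t^-1 ^+ k) (- k%:R * t^-1 ^+ k.+1).
    case: k => [|k].
      under eq_fun do rewrite expr0.
      by apply: is_derive_eq; rewrite oppr0 mul0r.
    rewrite (_ : (fun _ => _) = (fun t : R => t^-1) ^+ k.+1); last first.
      by apply/funext => x; rewrite exprfctE.
    apply: is_derive_eq; rewrite /GRing.scale/= !exprS exprVn; field.
    by rewrite t1 expf_neq0.
  apply: is_derive_eq.
  rewrite !flat_gt0E// /GRing.scale/= !exprS; field.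
  by rewrite t1.
rewrite !flat_le0// !mulr0 addr0.
set K : R := k.+2`!%:R / e ^+ k.+2.
have H : (fun r : R => r^-1 *: (flat e k (r *: (1 : R) + 0) - flat e k 0)) @ (0 : R)^' --> (0 : R).
  apply/cvgr0Pnorm_le => d d0.
  have K0 : 0 < K by rewrite divr_gt0 ?ltr0n ?fact_gt0 ?exprn_gt0.
  near=> r.
  have r0 : r != 0 by near: r; exact: nbhs_dnbhs_neq.
  rewrite [_ *: (1 : R)]mulr1 addr0 (@flat_le0 _ _ 0)// subr0 /GRing.scale/=.
  (* The difference quotient at 0 is the next function of the family, to which the linear bound
     applies. *)
  have E : r^-1 * flat e k r = flat e k.+1 r.
    have [rn|rp] := leP r 0; first by rewrite !flat_le0// mulr0.
    by rewrite !flat_gt0E// exprS mulrA.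
  rewrite E ger0_norm ?flat_ge0//.
  apply: (le_trans (flat_le_linear _ _ e0)).
  rewrite -/K mulrC -ler_pdivlMr//; near: r.
  by apply: dnbhs0_le; rewrite divr_gt0.
split; first by apply/cvg_ex; exists 0.
exact/cvg_lim.
Unshelve. all: by end_near. Qed.

Inductive flat_span e : (R -> R) -> Prop :=
| flat_span_intro k : flat_span e (flat e k)
| flat_span_comb (a b : R) f g : flat_span e f -> flat_span e g ->
    flat_span e (fun t => a * f t + b * g t).

Lemma smooth1_flat e : 0 < e -> smooth1 (flat e 0).
Proof.
move=> e0; apply: (@derivation_closed1_smooth _ (flat_span e)); last exact: flat_span_intro.
move=> f; elim=> {f} [k|a b f g sf [df Df] sg [dg Dg]].
- split=> [t|]; first by case: (is_derive_flat k t e0).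
  rewrite (_ : _^`() = fun t => (- k%:R * flat e k.+1 t + e * flat e k.+2 t)).
    by apply: flat_span_comb; exact: flat_span_intro.
  by apply/funext => t; rewrite derive1E; case: (is_derive_flat k t e0).
- have H t : is_derive t 1 (fun t => a * f t + b * g t) (a * f^`()%classic t + b * g^`()%classic t).
    have := derivableP (df t); rewrite -derive1E => dft.
    have := derivableP (dg t); rewrite -derive1E => dgt.
    exact: is_derive_eq.
  split=> [t|]; first by case: (H t).
  rewrite (_ : _^`() = fun t => a * f^`()%classic t + b * g^`()%classic t).
    exact: flat_span_comb.
  by apply/funext => t; rewrite derive1E; case: (H t).
Qed.

Lemma flat_cvg t :
  (fun n => flat (n.+1%:R^-1) 0 t) @ \oo --> (if 0 < t then 1 else 0 : R).
Proof.
have [t0|t0] := ltP; last first.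
  by under eq_fun do rewrite flat_le0//; exact: cvg_cst.
under eq_fun do rewrite flat_gt0E// expr0 mul1r.
suff : (fun n => expR (- (n.+1%:R^-1 / t))) @ \oo --> expR 0 by rewrite expR0.
apply: (@continuous_cvg _ _ _ _ _ _ expR); first exact: continuous_expR.
suff : (fun n => - (n.+1%:R^-1 / t)) @ \oo --> - (0 * t^-1) by rewrite mul0r oppr0.
by apply: cvgN; apply: cvgMl; exact: cvg_harmonic.
Qed.

End FlatFunction.

(** * Primitives and the fundamental theorem of calculus *)

Section Primitive.
Variable R : realType.
Local Notation mu1 := (@lebesgue_measure R).
Implicit Types (f F : R -> R) (a b t : R).

Lemma continuous_integrable_itv f a b : continuous f ->
  mu1.-integrable `[a, b] (EFin \o f).
Proof.
move=> cf; apply: continuous_compact_integrable; first exact: segment_compact.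
exact: continuous_subspaceT.
Qed.

Lemma integrable_support f a b : continuous f ->
  (forall t, t \notin `[a, b] -> f t = 0) -> mu1.-integrable setT (EFin \o f).
Proof.
move=> cf f0.
have -> : EFin \o f = (EFin \o f) \_ `[a, b].
  apply/funext => t; rewrite patchE; case: ifPn => // tab.
  by rewrite /= f0//; apply: contra tab => ?; rewrite inE.
have := continuous_integrable_itv a b cf.
by rewrite integrable_mkcond//.
Qed.

Definition primitive f (t : R) : R := \int[mu1]_(s in `]-oo, t]) f s.

Lemma is_derive_primitive f a b t : continuous f ->
  (forall t, t \notin `[a, b] -> f t = 0) -> is_derive t 1 (primitive f) (f t).
Proof.
move=> cf f0.
have If : mu1.-integrable `]-oo, (t + 1)] (EFin \o f).
  by apply: integrableS (integrable_support cf f0).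
have [D DE] : derivable (primitive f) t 1 /\ (primitive f)^`() t = f t.
  apply: (@continuous_FTC1 _ f -oo%O t (t + 1)) => //; rewrite ?ltrDl//.
    by rewrite ltNyr.
  exact: cf.
by split; [exact: D|rewrite -derive1E DE].
Qed.

Lemma Rintegral_FTC2 f F a b : a <= b -> continuous f ->
  (forall t, is_derive t 1 F (f t)) -> \int[mu1]_(t in `[a, b]) f t = F b - F a.
Proof.
rewrite le_eqVlt => /predU1P[-> _ _|ab cf dF].
  by rewrite set_itv1 Rintegral_set1 subrr.
rewrite /Rintegral (@continuous_FTC2 _ f F)//; first exact: continuous_subspaceT.
  have cF : continuous F by apply: derivable_continuous => t; case: (dF t).
  split=> [t _|/=|]; first by case: (dF t).
    exact/cvg_at_right_filter/cF.
  exact/cvg_at_left_filter/cF.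
by move=> t _; rewrite derive1E; case: (dF t).
Qed.

End Primitive.

(** * Measurability and Fubini's theorem in the plane *)

Section Plane.
Variable R : realType.
Local Notation mu1 := (@lebesgue_measure R).
Local Notation mu := (lebesgue2 R).
Local Notation B := (@unit_disc R).
Local Notation I := (`[-1, 1]%classic : set R).
Local Notation Q := (I `*` I).
Implicit Types (F G : R * R -> R).

(** Measurability refers to the product sigma-algebra, so an open set has to be a countable union of
    rectangles: here the squares inside it with rational centre and radius [1 / (n + 1)]. *)
Lemma open_measurable_plane (U : set (R * R)) : open U -> measurable U.
Proof.
move=> oU; pose D (p : rat * rat * nat) : set (R * R) :=
  ball (ratr p.1.1 : R) (p.2.+1%:R^-1 : R) `*` ball (ratr p.1.2 : R) (p.2.+1%:R^-1 : R).
have -> : U = \bigcup_p (if `[< D p `<=` U >] then D p else set0).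
  apply/seteqP; split=> [[x y] Uxy|z [p _]]; last first.
    by case: asboolP => // pU; exact: pU.
  have /nbhs_ballP[e /= e0 eU] := open_nbhs_nbhs (conj oU Uxy).
  (* A square of radius [d] whose centre is within [d] of [(x, y)] stays within [2 d < e] of that
     point. *)
  have [n] := @ltr_add_invr R 0 (e / 2) ltac:(by rewrite divr_gt0).
  rewrite add0r => ne.
  have n0 : 0 < n.+1%:R^-1 :> R by rewrite invr_gt0.
  set d := n.+1%:R^-1 in ne n0.
  have near_rat (u : R) : exists p : rat, u - d < ratr p < u + d.
    have [|p] := @rat_in_itvoo R (u - d) (u + d); first by lra.
    by rewrite in_itv/=; exists p.
  have [p /andP[p1 p2]] := near_rat x; have [q /andP[q1 q2]] := near_rat y.
  exists (p, q, n) => //=; case: asboolP => [_|[]].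
    by split; rewrite /= -ball_normE /ball_/= ltr_norml; apply/andP; split; rewrite -/d; lra.
  move=> [u v] [/=]; rewrite -!ball_normE /ball_/= !ltr_norml -/d => /andP[u1 u2] /andP[v1 v2].
  by apply: eU; split; rewrite -ball_normE /ball_/= ltr_norml; apply/andP; split; lra.
apply: countable_bigcupT_measurable => [|p]; first exact: countableP.
by case: ifP => // _; apply: measurableX; rewrite ball_itv; exact: measurable_itv.
Qed.

Lemma continuous_measurable_plane F : continuous F -> measurable_fun setT F.
Proof.
move=> cF; apply: (measurability _ (measurable_realfun.RGenOInfty.measurableE R)) => //.
move=> _ [_ [x ->] <-]; rewrite setTI; apply: open_measurable_plane.
by apply: open_comp => // z _; exact: cF.
Qed.

Lemma unit_discE : B = [set x | x.1 ^+ 2 + x.2 ^+ 2 < 1].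
Proof.
apply/seteqP; split=> x; rewrite /unit_disc/= /eucl_norm => H.
  by rewrite -(@ltr_sqrt _ _ 1)// sqrtr1.
by rewrite -sqrtr1 ltr_sqrt.
Qed.

Lemma measurable_unit_disc : measurable B.
Proof.
rewrite unit_discE; apply: open_measurable_plane.
have -> : [set x : R * R | x.1 ^+ 2 + x.2 ^+ 2 < 1] =
    (fun x : R * R => x.1 ^+ 2 + x.2 ^+ 2) @^-1` [set t | t < 1] by [].
apply: open_comp; last exact: open_lt.
move=> x _; apply: cvgD; apply: (@cvgM _ _ _ _ _ _ _ _ _).
- exact: cvg_fst.
- exact: cvg_fst.
- exact: cvg_snd.
- exact: cvg_snd.
Qed.

Lemma unit_disc_sub_square : B `<=` Q.
Proof.
rewrite unit_discE => -[x y] /= H; split; rewrite /= in_itv/=; nra.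
Qed.

Lemma measurable_square : measurable Q.
Proof. by apply: measurableX; exact: measurable_itv. Qed.

Lemma square_lty : (mu Q < +oo)%E.
Proof.
rewrite product_measure1E; [|exact: measurable_itv..].
have fin_itv : mu1 I = 2%:E.
  rewrite lebesgue_measure_itv/= lte_fin ifT; last by lra.
  by rewrite -EFinD; congr EFin; lra.
by rewrite [X in (X < _)%E](_ : _ = mu1 I * mu1 I)%E// fin_itv -EFinM ltry.
Qed.

Lemma unit_disc_lty : (mu B < +oo)%E.
Proof.
apply: le_lt_trans square_lty; apply: le_measure; rewrite ?inE.
- exact: measurable_unit_disc.
- exact: measurable_square.
- exact: unit_disc_sub_square.
Qed.

Lemma continuous_bounded_box F (a b c d : R) : continuous F ->
  exists M, forall x y, a <= x <= b -> c <= y <= d -> `|F (x, y)| <= M.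
Proof.
move=> cF.
have K : compact (`[a, b] `*` `[c, d]) by apply: compact_setX; exact: segment_compact.
have /compact_bounded[M [_ HM]] : compact (F @` (`[a, b] `*` `[c, d])).
  by apply: continuous_compact => //; exact: continuous_subspaceT.
exists (M + 1) => x y xab ycd; apply: (HM (M + 1)); first by rewrite ltrDl.
by exists (x, y) => //; split; rewrite /= in_itv.
Qed.

Lemma continuous_bounded_disc F : continuous F ->
  exists2 M, 0 <= M & forall z, B z -> `|F z| <= M.
Proof.
move=> cF; have [M HM] := continuous_bounded_box (-1) 1 (-1) 1 cF.
have B0 : B (0, 0) by rewrite unit_discE /= expr0n addr0 ltr01.
have HB z : B z -> `|F z| <= M.
  move=> /unit_disc_sub_square; case: z => x y [] /=; rewrite !in_itv/= => *.
  exact: HM.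
by exists M => //; exact: le_trans (HB _ B0).
Qed.

Lemma continuous_integrable_square F : continuous F ->
  mu.-integrable Q (EFin \o F).
Proof.
move=> cF; apply: measurable_bounded_integrable.
- exact: measurable_square.
- exact: square_lty.
- exact: measurable_funS (continuous_measurable_plane cF).
- have [M HM] := continuous_bounded_box (-1) 1 (-1) 1 cF.
  exists M; split; first exact: num_real.
  move=> N MN [x y] [/=]; rewrite !in_itv/= => xI yI.
  exact: le_trans (HM _ _ xI yI) (ltW MN).
Qed.

Lemma continuous_integrable_disc F : continuous F ->
  mu.-integrable B (EFin \o F).
Proof.
move=> cF; apply: integrableS (continuous_integrable_square cF).
- exact: measurable_square.
- exact: measurable_unit_disc.
- exact: unit_disc_sub_square.
Qed.

Lemma continuous_section1 F (x : R) : continuous F -> continuous (fun y => F (x, y)).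
Proof.
move=> cF y; apply: continuous_comp; last exact: cF.
exact: (@cvg_pair _ _ _ (nbhs y) (nbhs x) (nbhs y) _ _ _ (fun=> x) id (cvg_cst x) cvg_id).
Qed.

Lemma continuous_section2 F (y : R) : continuous F -> continuous (fun x => F (x, y)).
Proof.
move=> cF x; apply: (@continuous_comp _ _ _ (fun x => (x, y))); last exact: cF.
exact: (@cvg_pair _ _ _ (nbhs x) (nbhs x) (nbhs y) _ _ _ id (fun=> y) cvg_id (cvg_cst y)).
Qed.

Lemma restrict_square F (x y : R) :
  ((EFin \o F) \_ Q) (x, y) = (if x \in I then ((EFin \o (fun t => F (x, t))) \_ I) y else 0)%E.
Proof.
rewrite !patchE; case: ifPn => [/set_mem[/= xI yI]|H].
  by rewrite !mem_set.
case: ifPn => // /set_mem xI; case: ifPn => // /set_mem yI.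
by move: H; rewrite notin_setE => -[].
Qed.

Lemma Rintegral_square12 F : continuous F ->
  \int[mu]_(z in Q) F z =
  \int[mu1]_(x in I) \int[mu1]_(y in I) F (x, y).
Proof.
move=> cF; rewrite /Rintegral; congr fine.
rewrite integral_mkcond -(@integral12_prod_meas1 _ _ _ _ _ mu1 mu1); last first.
  rewrite -integrable_mkcond; first exact: continuous_integrable_square.
  exact: measurable_square.
rewrite [RHS]integral_mkcond; apply: eq_integral => x _.
rewrite patchE /fubini_F; under eq_integral do rewrite restrict_square.
case: ifPn => xI; last by rewrite integral0.
rewrite -integral_mkcond fineK//; apply: integrable_fin_num => //.
exact/continuous_integrable_itv/continuous_section1.
Qed.

Lemma Rintegral_square21 F : continuous F ->
  \int[mu]_(z in Q) F z =
  \int[mu1]_(y in I) \int[mu1]_(x in I) F (x, y).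
Proof.
move=> cF; rewrite /Rintegral; congr fine.
rewrite integral_mkcond -(@integral21_prod_meas1 _ _ _ _ _ mu1 mu1); last first.
  rewrite -integrable_mkcond; first exact: continuous_integrable_square.
  exact: measurable_square.
rewrite [RHS]integral_mkcond; apply: eq_integral => y _.
rewrite patchE /fubini_G; case: ifPn => yI.
  have E x : ((EFin \o F) \_ Q) (x, y) = ((EFin \o (fun t => F (t, y))) \_ I) x.
    by rewrite restrict_square !patchE yI.
  under eq_integral do rewrite E.
  rewrite -integral_mkcond fineK//; apply: integrable_fin_num => //.
  exact/continuous_integrable_itv/continuous_section2.
have E x : ((EFin \o F) \_ Q) (x, y) = 0%E.
  by rewrite restrict_square !patchE (negbTE yI) if_same.
by under eq_integral do rewrite E; rewrite integral0.
Qed.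

(** Functions that vanish off the disc are integrated over the square, where Fubini's theorem has
    constant limits. *)
Lemma Rintegral_disc_square F : (forall z, ~ B z -> F z = 0) ->
  \int[mu]_(z in B) F z = \int[mu]_(z in Q) F z.
Proof.
move=> F0; rewrite Rintegral_mkcond [RHS]Rintegral_mkcond; congr Rintegral.
apply/funext => z; rewrite !patchE; case: ifPn => [/set_mem Bz|].
  by rewrite mem_set//; exact: unit_disc_sub_square.
rewrite notin_setE => nBz; case: ifPn => // _.
by rewrite F0.
Qed.

Lemma continuous_Rintegral_section F : continuous F ->
  continuous (fun x => \int[mu1]_(y in I) F (x, y)).
Proof.
move=> cF x0.
have [M HM] := continuous_bounded_box (x0 - 1) (x0 + 1) (-1) 1 cF.
have := @continuity_under_integral R _ _ mu1 (fun x y => F (x, y)) I (measurable_itv _)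
  (x0 - 1) (x0 + 1) _ _ (cst M) _ _ x0.
apply.
- by move=> x _; exact/continuous_integrable_itv/continuous_section1.
- by apply/aeW => y _ x _; exact/continuous_section2.
- exact/continuous_integrable_itv/cst_continuous.
- move=> x /=; rewrite in_itv/= => /andP[x1 x2]; apply/aeW => y; rewrite /= in_itv/= => yI.
  by apply: HM => //; rewrite !ltW.
- by rewrite inE/= in_itv/=; apply/andP; split; lra.
Qed.

End Plane.

(** * Test functions and integration by parts *)

Section TestFunctions.
Variable R : realType.
Local Notation mu1 := (@lebesgue_measure R).
Local Notation mu := (lebesgue2 R).
Local Notation B := (@unit_disc R).
Local Notation I := (`[-1, 1]%classic : set R).
Local Notation Q := (I `*` I).
Local Notation "''d_' i f" := (fun x => 'D_(basis2 R i) f x) (at level 10, i at level 2, f at level 9).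
Implicit Types (F G f phi psi : R * R -> R) (i : 'I_2).

Lemma Rintegral_eq0 d (T : measurableType d) (nu : {measure set T -> \bar R})
  (D : set T) (f : T -> R) : (forall x, D x -> f x = 0) ->
  \int[nu]_(x in D) f x = 0.
Proof.
move=> f0; rewrite /Rintegral.
by under eq_integral => x /set_mem Dx do rewrite f0//; rewrite integral0.
Qed.

Lemma test_intro (K : set (R * R)) f : smooth f -> compact K -> K `<=` B ->
  (forall z, ~ K z -> f z = 0) -> test_function B f.
Proof.
move=> sf cK KB f0; have clK : closed K by apply: compact_closed => //; exact: norm_hausdorff.
have sK : support2 f `<=` K.
  rewrite /support2 ((closure_id K).1 clK); apply: closure_subset => z /= fz.
  by apply: contrapT => /f0 /eqP; apply/negP.
split=> //; last exact: subset_trans KB.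
by apply: (subclosed_compact _ cK) => //; exact: closed_closure.
Qed.

Lemma test_eq0 phi z : test_function B phi -> ~ support2 phi z -> phi z = 0.
Proof.
move=> _ H; apply/eqP/negPn/negP => pz; apply: H.
exact: subset_closure.
Qed.

Lemma test_out phi z : test_function B phi -> ~ B z -> phi z = 0.
Proof. by move=> tp nB; apply: test_eq0 => // /(let: And3 _ _ H := tp in H). Qed.

Lemma test_smooth phi : test_function B phi -> smooth phi. Proof. by case. Qed.

Lemma test_continuous phi : test_function B phi -> continuous phi.
Proof. by move=> /test_smooth; exact: smooth_continuous. Qed.

Lemma test_derive phi i : test_function B phi -> test_function B ('d_i phi).
Proof.
move=> tp; have [sp cp pB] := tp.
apply: (test_intro _ cp pB); first exact: smooth_derive.
move=> z nz; rewrite (@near_eq_derive _ _ _ _ (cst (0 : R))) ?derive_cst//.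
have oC : open (~` support2 phi) by apply: closed_openC; exact: closed_closure.
have := open_nbhs_nbhs (conj oC nz); apply: filterS => w nw.
exact: test_eq0.
Qed.

Lemma test_partials phi s : test_function B phi -> test_function B (partials s phi).
Proof. by move=> tp; elim: s => [//|i s IH]; exact: test_derive. Qed.

Lemma test_mull f phi : smooth f -> test_function B phi ->
  test_function B (fun x => f x * phi x).
Proof.
move=> sf tp; have [sp cp pB] := tp; apply: (test_intro _ cp pB); first exact: smoothM.
by move=> z /(test_eq0 tp) ->; rewrite mulr0.
Qed.

Lemma test_comp (h : R -> R) phi : smooth1 h -> h 0 = 0 -> test_function B phi ->
  test_function B (h \o phi).
Proof.
move=> sh h0 tp; have [sp cp pB] := tp; apply: (test_intro _ cp pB).
  exact: smooth_comp.
by move=> z /(test_eq0 tp) /= ->.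
Qed.

Lemma test_opp phi : test_function B phi -> test_function B (fun x => - phi x).
Proof.
move=> tp; under eq_fun do rewrite -mulN1r; apply: test_mull => //.
exact: smooth_cst.
Qed.

Lemma eq_Rintegral_disc F G : (forall z, B z -> F z = G z) ->
  \int[mu]_(z in B) F z = \int[mu]_(z in B) G z.
Proof. by move=> FG; apply: eq_Rintegral => z /set_mem /FG. Qed.

(** On each line parallel to the [i]-th axis this is the fundamental theorem of calculus, since the
    sides of the square lie outside the open disc. [G] is not assumed smooth because the lemma also
    serves for a test function multiplied by a transport map that is only continuously
    differentiable. *)
Lemma Rintegral_derive_eq0 G i : (forall z, ~ B z -> G z = 0) ->
  (forall z, derivable G z (basis2 R i)) -> continuous ('d_i G) ->
  (forall z, ~ B z -> 'D_(basis2 R i) G z = 0) ->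
  \int[mu]_(z in B) 'D_(basis2 R i) G z = 0.
Proof.
move=> G0 dG cD D0; rewrite Rintegral_disc_square//.
have nB (x y : R) : `|x| = 1 \/ `|y| = 1 -> ~ B (x, y).
  rewrite unit_discE /= => H xy; case: H => /(congr1 (fun u => u ^+ 2));
    rewrite real_normK ?num_real// => H; nra.
have N1 : (-1 : R) <= 1 by lra.
have J0 (h k : R -> R) : continuous k -> (forall t, is_derive t (1 : R) h (k t)) ->
  h 1 = 0 -> h (-1) = 0 -> \int[mu1]_(t in I) k t = 0.
  by move=> ck hk h1 hN1; rewrite (Rintegral_FTC2 N1 ck hk) h1 hN1 subrr.
have [i0|i1] := eqVneq i ord0.
- rewrite Rintegral_square21//.
  apply: Rintegral_eq0.
  move=> y _; apply: (J0 (fun x => G (x, y))).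
  + by apply: (@continuous_section2 _ ('d_i G)).
  + move=> x; apply/is_derive_fst.
    have <- : basis2 R i = (1, 0) by rewrite i0.
    exact: derivableP (dG (x, y)).
  + by apply/G0/nB; left; rewrite normr1.
  + by apply/G0/nB; left; rewrite normrN normr1.
- rewrite Rintegral_square12//.
  apply: Rintegral_eq0.
  move=> x _; apply: (J0 (fun y => G (x, y))).
  + by apply: (@continuous_section1 _ ('d_i G)).
  + move=> y; apply/is_derive_snd.
    have <- : basis2 R i = (0, 1) by rewrite /basis2 (negbTE i1).
    exact: derivableP (dG (x, y)).
  + by apply/G0/nB; right; rewrite normr1.
  + by apply/G0/nB; right; rewrite normrN normr1.
Qed.

Lemma Rintegral_by_parts f phi i : continuous f ->
  (forall z, derivable f z (basis2 R i)) -> continuous ('d_i f) ->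
  test_function B phi ->
  \int[mu]_(z in B) (f z * 'D_(basis2 R i) phi z) =
  - \int[mu]_(z in B) ('D_(basis2 R i) f z * phi z).
Proof.
move=> cf df cdf tp; have tdp := test_derive i tp.
have sp := test_smooth tp.
have E z : 'D_(basis2 R i) (fun x => f x * phi x) z =
    f z * 'D_(basis2 R i) phi z + 'D_(basis2 R i) f z * phi z.
  rewrite deriveM//; last exact: smooth_derivable.
  by rewrite /GRing.scale/= (mulrC (phi z)).
have c1 : continuous (fun z => f z * 'D_(basis2 R i) phi z).
  by move=> z; apply: cvgM; [exact: cf|exact: test_continuous tdp z].
have c2 : continuous (fun z => 'D_(basis2 R i) f z * phi z).
  by move=> z; apply: cvgM; [exact: cdf|exact: test_continuous tp z].
apply/eqP; rewrite -subr_eq0 opprK -RintegralD; [|exact: measurable_unit_disc|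
  exact: continuous_integrable_disc..].
rewrite -(@eq_Rintegral_disc ('d_i (fun x => f x * phi x))); last by move=> z _; exact: E.
apply/eqP/Rintegral_derive_eq0.
- by move=> z nB; rewrite (test_out tp)// mulr0.
- by move=> z; apply: derivableM => //; exact: smooth_derivable.
- rewrite (_ : (fun _ => _) = (fun z => f z * 'D_(basis2 R i) phi z + 'D_(basis2 R i) f z * phi z)).
    by move=> z; apply: cvgD; [exact: c1|exact: c2].
  by apply/funext => z; exact: E.
- by move=> z nB; rewrite E (test_out tp)// (test_out tdp)// !mulr0 addr0.
Qed.

End TestFunctions.

(** * The sharp Sobolev inequality *)

Section Sobolev.
Variable R : realType.

Lemma continuous_add (T : topologicalType) (f g : T -> R) :
  continuous f -> continuous g -> continuous (fun x => f x + g x).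
Proof. by move=> cf cg x; exact: cvgD (cf x) (cg x). Qed.

Lemma continuous_mul (T : topologicalType) (f g : T -> R) :
  continuous f -> continuous g -> continuous (fun x => f x * g x).
Proof. by move=> cf cg x; exact: cvgM (cf x) (cg x). Qed.

Local Notation mu1 := (@lebesgue_measure R).
Local Notation mu := (lebesgue2 R).
Local Notation B := (@unit_disc R).
Local Notation I := (`[-1, 1]%classic : set R).
Local Notation Q := (I `*` I).
Local Notation pi := (@pi R).

(* The fraction of the unit disc to the left of the abscissa [sin a]. *)
Definition disc_fraction (a : R) : R := 2^-1 + (a + sin a * cos a) / pi.

Lemma is_derive_disc_fraction (a : R) :
  is_derive a (1 : R) disc_fraction (2 * cos a ^+ 2 / pi).
Proof.
have : pi != 0 by rewrite gt_eqF// pi_gt0.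
rewrite /disc_fraction; move: pi => p p0; apply: is_derive_eq.
rewrite /GRing.scale/= mulrN -!expr2 sin2cos2; field.
exact: p0.
Qed.

(** The inverse of [disc_fraction] on the open interval; at its ends the derivative [2 cos ^ 2 / pi]
    vanishes. The default 0 concerns only arguments outside []0, 1[]. *)
Definition disc_angle (u : R) : R :=
  xget 0 [set a | - (pi / 2) < a < pi / 2 /\ disc_fraction a = u].

Lemma continuous_disc_fraction : continuous disc_fraction.
Proof. by apply: derivable_continuous => a; case: (is_derive_disc_fraction a). Qed.

Lemma disc_fraction_pihalf :
  disc_fraction (- (pi / 2)) = 0 /\ disc_fraction (pi / 2) = 1.
Proof.
have : pi != 0 by rewrite gt_eqF// pi_gt0.
rewrite /disc_fraction cosN cos_pihalf !mulr0 !addr0; move: pi => p p0.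
by split; field; exact: p0.
Qed.

Lemma disc_fraction_inj (a b : R) : - (pi / 2) < a < pi / 2 ->
  - (pi / 2) < b < pi / 2 -> disc_fraction a = disc_fraction b -> a = b.
Proof.
have incr : {in `[- (pi / 2), pi / 2]%R &, {homo disc_fraction : x y / x < y}}.
  apply: (@gtr0_derive1_lt_cc R disc_fraction).
  - by move=> x _; case: (is_derive_disc_fraction x).
  - move=> x; rewrite in_itv/= => xI; rewrite derive1E.
    have [_ ->] := is_derive_disc_fraction x.
    by rewrite divr_gt0 ?pi_gt0// mulr_gt0// exprn_gt0// cos_gt0_pihalf.
  - exact/continuous_subspaceT/continuous_disc_fraction.
move=> /andP[a1 a2] /andP[b1 b2] E.
have aI : a \in `[- (pi / 2), pi / 2]%R by rewrite in_itv/= !ltW.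
have bI : b \in `[- (pi / 2), pi / 2]%R by rewrite in_itv/= !ltW.
have [ab|ba|//] := ltgtP a b.
  by have := incr _ _ aI bI ab; rewrite E ltxx.
by have := incr _ _ bI aI ba; rewrite E ltxx.
Qed.

Lemma disc_angleP (u : R) : 0 < u < 1 ->
  - (pi / 2) < disc_angle u < pi / 2 /\ disc_fraction (disc_angle u) = u.
Proof.
move=> /andP[u0 u1]; rewrite /disc_angle; case: xgetP => [a _ //|H].
have [E0 E1] := disc_fraction_pihalf; have p0 := pi_gt0 R.
have [|a] := @IVT R disc_fraction (- (pi / 2)) (pi / 2) u ltac:(lra)
  (continuous_subspaceT continuous_disc_fraction).
  by rewrite E0 E1 minEle ler01 maxEle ler01 !ltW.
rewrite in_itv/= => /andP[a1 a2] Ea; exfalso; apply: (H a); split=> //.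
rewrite !lt_neqAle a1 a2 !andbT; apply/andP; split; apply/eqP => Eq; move: Ea.
  by rewrite -Eq E0 => E; rewrite -E ltxx in u0.
by rewrite Eq E1 => E; rewrite -E ltxx in u1.
Qed.

Lemma is_derive_disc_angle (u : R) : 0 < u < 1 ->
  is_derive u (1 : R) disc_angle (pi / (2 * cos (disc_angle u) ^+ 2)).
Proof.
move=> u01; have [aI Ea] := disc_angleP u01.
rewrite -{1}Ea; have c0 := cos_gt0_pihalf aI.
have p0 := pi_gt0 R.
have -> : pi / (2 * cos (disc_angle u) ^+ 2) = (2 * cos (disc_angle u) ^+ 2 / pi)^-1.
  by rewrite invf_div.
apply: is_derive_inverse; last 2 first.
- exact: is_derive_disc_fraction.
- by rewrite gt_eqF// divr_gt0// mulr_gt0// exprn_gt0.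
- have : \forall a \near disc_angle u, a \in `](- (pi / 2)), (pi / 2)[%R.
    by apply: near_in_itvoo; rewrite in_itv.
  have cA := continuous_disc_fraction.
  have : \forall a \near disc_angle u, disc_fraction a \in `]0, 1[%R.
    have H : \forall z \near disc_fraction (disc_angle u), z \in `]0, 1[%R.
      by rewrite Ea; apply: near_in_itvoo; rewrite in_itv/=.
    exact: (cA _ _ H).
  apply: filterS2 => a; rewrite !in_itv/= => fa aI'.
  have [bI Eb] := disc_angleP fa.
  exact: disc_fraction_inj.
- by near=> a; exact: continuous_disc_fraction.
Unshelve. all: by end_near. Qed.

Lemma primitive_bounds (f : R -> R) (a b t : R) : continuous f ->
  (forall t, 0 <= f t) -> (forall t, t \notin `[a, b] -> f t = 0) ->
  0 <= primitive f t <= \int[mu1]_(s in `[a, b]) f s.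
Proof.
move=> cf f0 fab; apply/andP; split.
  by rewrite /primitive; apply: Rintegral_ge0 => s _; exact: f0.
have If := integrable_support cf fab.
have -> : \int[mu1]_(s in `[a, b]) f s = \int[mu1]_s f s.
  rewrite Rintegral_mkcond; congr Rintegral; apply/funext => s.
  by rewrite patchE; case: ifPn => // sab; rewrite fab//; apply: contra sab => ?; rewrite inE.
rewrite /primitive /Rintegral; apply: fine_le.
- by apply: integrable_fin_num => //; exact: integrableS If.
- by apply: integrable_fin_num.
- apply: ge0_subset_integral => //.
  + by apply/measurable_EFinP; exact: continuous_measurable_fun.
  + by move=> s _; rewrite lee_fin.
Qed.

Definition grad_norm (phi : R * R -> R) (z : R * R) : R :=
  Num.sqrt (('D_(basis2 R ord0) phi z) ^+ 2 + ('D_(basis2 R (lift ord0 ord0)) phi z) ^+ 2).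

Lemma continuous_grad_norm phi : smooth phi -> continuous (grad_norm phi).
Proof.
move=> sp z; apply: (@continuous_comp _ _ _ (fun z => ('D_(basis2 R ord0) phi z) ^+ 2 +
  ('D_(basis2 R (lift ord0 ord0)) phi z) ^+ 2)); last exact: sqrt_continuous.
have sd i := smooth_continuous (smooth_derive i sp).
by apply: cvgD; apply: cvgM; exact: sd.
Qed.

Lemma grad_norm_CS phi (z : R * R) (a b : R) : a ^+ 2 + b ^+ 2 <= 1 ->
  a * 'D_(basis2 R ord0) phi z + b * 'D_(basis2 R (lift ord0 ord0)) phi z <= grad_norm phi z.
Proof.
rewrite /grad_norm; set p := 'D_(basis2 R ord0) phi z; set q := 'D_(_) phi z => ab.
have [neg|pos] := leP (a * p + b * q) 0; first exact: le_trans neg (sqrtr_ge0 _).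
rewrite -(ger0_norm (ltW pos)) -sqrtr_sqr ler_wsqrtr//.
have := sqr_ge0 (a * q - b * p); have := sqr_ge0 p; have := sqr_ge0 q.
nra.
Qed.

(* Knothe transport of [phi ^ 2 / m] to the normalized Lebesgue measure of the
   disc; the terms in [de] keep it away from the boundary, where the inverse of
   [disc_fraction] is singular. *)
Section Knothe.
Variables (phi : R * R -> R) (de : R).
Hypotheses (tphi : test_function B phi) (phi0 : forall z, 0 <= phi z).
Hypotheses (de0 : 0 < de) (de1 : de < 1).

Let m : R := \int[mu]_(z in B) phi z ^+ 2.
Hypothesis m0 : 0 < m.

Let l (x : R) : R := \int[mu1]_(y in I) phi (x, y) ^+ 2.
Let dx := 'D_(basis2 R ord0) phi.
Let dy := 'D_(basis2 R (lift ord0 ord0)) phi.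

Let cphi : continuous phi. Proof. exact: test_continuous. Qed.

Let cphi2 : continuous (fun z => phi z ^+ 2).
Proof. by move=> z; apply: cvgM; exact: cphi. Qed.

Let cdx : continuous dx. Proof. exact/test_continuous/test_derive. Qed.
Let cdy : continuous dy. Proof. exact/test_continuous/test_derive. Qed.

Let cl : continuous l. Proof. exact: (continuous_Rintegral_section cphi2). Qed.

Let l_ge0 x : 0 <= l x.
Proof. by apply: Rintegral_ge0 => y _; exact: sqr_ge0. Qed.

Let phi_out x y : (1 <= `|x|) || (1 <= `|y|) -> phi (x, y) = 0.
Proof.
move=> H; apply: test_out => //; rewrite unit_discE /= => xy.
have x2 := sqr_ge0 x; have y2 := sqr_ge0 y.
by case/orP: H => H; move: (H); rewrite -(@ler_pXn2r _ 2) ?nnegrE// expr1n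
  real_normK ?num_real//; lra.
Qed.

Let notI (t : R) : t \notin `[-1, 1] -> 1 <= `|t|.
Proof.
by rewrite notin_setE /= in_itv/= -ler_norml => /negP; rewrite -ltNge => /ltW.
Qed.

Let l_out x : x \notin `[-1, 1] -> l x = 0.
Proof.
move=> /notI xI; apply: Rintegral_eq0 => y _.
by rewrite phi_out ?xI// expr0n.
Qed.

Let mE : m = \int[mu1]_(x in I) l x.
Proof.
rewrite /m Rintegral_disc_square ?Rintegral_square12// => z nB.
by rewrite (test_out tphi)// expr0n.
Qed.

(** The share of the mass of [phi ^ 2] to the left of [x], contracted into
    [[de / 2, 1 - de / 2]]. *)
Let u (x : R) : R := (1 - de) / m * primitive l x + de / 2.

Let u01 x : 0 < u x < 1.
Proof.
have /andP[] := primitive_bounds x cl l_ge0 l_out; rewrite -mE => p0 pm.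
have : 0 <= (1 - de) / m * primitive l x by rewrite mulr_ge0// divr_ge0 ?subr_ge0 ?ltW.
have : (1 - de) / m * primitive l x <= 1 - de.
  by rewrite mulrAC ler_pdivrMr// ler_wpM2l// subr_ge0 ltW.
rewrite /u; move: (_ * primitive l x) => r r1 r0; move: de0 de1; lra.
Qed.

Let al (x : R) : R := disc_angle (u x).

Let cos_al x : 0 < cos (al x).
Proof. by have [/cos_gt0_pihalf] := disc_angleP (u01 x). Qed.

Let is_derive_al x : is_derive x (1 : R) al
  ((1 - de) / m * l x * pi / (2 * cos (al x) ^+ 2)).
Proof.
have du : is_derive x (1 : R) u ((1 - de) / m * l x).
  have dp := is_derive_primitive x cl l_out.
  by apply: is_derive_eq; rewrite addr0.
have := is_derive_comp1 du (is_derive_disc_angle (u01 x)).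
by move=> H; apply: is_derive_eq; rewrite -/(al x) mulrC mulrA.
Qed.

(** First component of the transport: the abscissa that cuts off the share [u x] of the disc. The
    chord there has half-length [cos (al x)]. *)
Let T (x : R) : R := sin (al x).
(** The Jacobian of the transport is [s2 * phi ^ 2]; its factor [1 - de] is the price of the
    contraction. *)
Let s2 : R := (1 - de) * pi / m.
Let T' (x : R) : R := s2 * l x / (2 * cos (al x)).

Let is_derive_T x : is_derive x (1 : R) T (T' x).
Proof.
have := is_derive_comp1 (is_derive_al x) (is_derive_sin _) => H.
apply: is_derive_eq; rewrite /T' /s2; field.
by rewrite !gt_eqF.
Qed.

Let c_al : continuous al.
Proof. by apply: derivable_continuous => x; case: (is_derive_al x). Qed.

Let c_cos : continuous (fun x => cos (al x)).
Proof. by move=> x; apply: continuous_comp; [exact: c_al|exact: continuous_cos]. Qed.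

Let cT : continuous T.
Proof. by apply: derivable_continuous => x; case: (is_derive_T x). Qed.

Let cT' : continuous T'.
Proof.
move=> x; apply: cvgM; first by apply: cvgM; [exact: cvg_cst|exact: cl].
apply: cvgV; first by rewrite mulf_neq0// gt_eqF.
by apply: cvgM; [exact: cvg_cst|exact: c_cos].
Qed.

Let s : R := Num.sqrt s2.

Let c1 : continuous (fun z : R * R => T z.1 * dx z).
Proof.
move=> z; apply: cvgM; last exact: cdx.
by apply: (@continuous_comp _ _ _ fst); [exact: cvg_fst|exact: cT].
Qed.

Let c2 : continuous (fun z : R * R => T' z.1 * phi z).
Proof.
move=> z; apply: cvgM; last exact: cphi.
by apply: (@continuous_comp _ _ _ fst); [exact: cvg_fst|exact: cT'].
Qed.

Let c12 : continuous (fun z : R * R => T z.1 * dx z + T' z.1 * phi z).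
Proof. by move=> z; apply: cvgD; [exact: c1|exact: c2]. Qed.

Let c3 : continuous (fun z : R * R => 2 * s * phi z ^+ 2 -
  (T z.1 * dx z + T' z.1 * phi z)).
Proof.
move=> z; apply: cvgB; last exact: c12.
by apply: cvgM; [exact: cvg_cst|exact: cphi2].
Qed.

(** The second component [T2] of the transport spreads the mass of this vertical line over the chord
    at [T x], so that [T' x] times the derivative of [T2] is [s2 * phi ^ 2]. The inequality of the
    arithmetic and geometric means bounds the divergence of the transport below by [2 s phi], and
    the transport has norm at most 1. The vertical part of the divergence of [phi] times the
    transport integrates to 0 on the line; the horizontal part does so only over the plane and
    therefore stays on the left. *)
Let section_bound x :
  \int[mu1]_(y in I) (2 * s * phi (x, y) ^+ 2 -
    (T x * dx (x, y) + T' x * phi (x, y))) <=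
  \int[mu1]_(y in I) grad_norm phi (x, y).
Proof.
have cg : continuous (grad_norm phi) by apply/continuous_grad_norm/test_smooth.
have cgx : continuous (fun y => grad_norm phi (x, y)) := continuous_section1 cg.
have cfx : continuous (fun y => phi (x, y) ^+ 2) := continuous_section1 cphi2.
(* On a line without mass [T2] would divide by 0; there [T' x] and the integral of [phi ^ 2] vanish,
   and the horizontal component suffices. *)
have [lx|lx] := leP (l x) 0.
  have l0 : l x = 0 by apply/eqP; rewrite eq_le lx l_ge0.
  have E : \int[mu1]_(y in I) (2 * s * phi (x, y) ^+ 2 + grad_norm phi (x, y)) =
      \int[mu1]_(y in I) grad_norm phi (x, y).
    rewrite RintegralD//; [|apply: continuous_integrable_itv..]; last 2 first.
    - by apply: continuous_mul => //; exact: cst_continuous.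
    - exact: cgx.
    by rewrite RintegralZl//; [rewrite -/(l x) l0 mulr0 add0r|exact: continuous_integrable_itv].
  rewrite -E; apply: le_Rintegral => //.
  - apply: continuous_integrable_itv; exact: (continuous_section1 c3).
  - apply: continuous_integrable_itv; apply: continuous_add; last exact: cgx.
    by apply: continuous_mul => //; exact: cst_continuous.
  move=> y _; rewrite /T' l0 mulr0 !mul0r addr0 lerD2l.
  have : (- T x) ^+ 2 + 0 ^+ 2 <= 1.
    by rewrite sqrrN expr0n addr0 -(cos2Dsin2 (al x)) lerDr sqr_ge0.
  by move=> /(grad_norm_CS phi (x, y)); rewrite mul0r addr0 mulNr.
have cx := cos_al x.
pose g y := phi (x, y) ^+ 2.
have cgy : continuous g by exact: (@continuous_section1 _ (fun z => phi z ^+ 2)).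
have g0 y : 0 <= g y by exact: sqr_ge0.
have g_out y : y \notin `[-1, 1] -> g y = 0.
  by move=> /notI yI; rewrite /g phi_out ?yI ?orbT// expr0n.
pose P := primitive g.
have dP y : is_derive y (1 : R) P (g y) := is_derive_primitive y cgy g_out.
have PB y : 0 <= P y <= l x := primitive_bounds y cgy g0 g_out.
pose T2 y := cos (al x) * (2 / l x * P y - 1).
have dT2 y : is_derive y (1 : R) T2 (2 * cos (al x) / l x * g y).
  by apply: is_derive_eq; rewrite /GRing.scale/= oppr0 addr0; field; rewrite gt_eqF.
have dphi y : is_derive y (1 : R) (fun y => phi (x, y)) (dy (x, y)).
  exact/is_derive_snd/(smooth_is_derive _ (lift ord0 ord0))/test_smooth.
pose k y := T2 y * dy (x, y) + phi (x, y) * (2 * cos (al x) / l x * g y).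
have dk y : is_derive y (1 : R) (fun y => T2 y * phi (x, y)) (k y).
  exact: is_derive_eq.
have cT2 : continuous T2 by apply: derivable_continuous => y; case: (dT2 y).
have ck : continuous k.
  apply: continuous_add; apply: continuous_mul => //.
  - exact: (continuous_section1 cdy).
  - exact: (continuous_section1 cphi).
  - by apply: continuous_mul => //; exact: cst_continuous.
have k0 : \int[mu1]_(y in I) k y = 0.
  rewrite (Rintegral_FTC2 _ ck dk); last by lra.
  rewrite (@phi_out x 1) ?normr1 ?lexx ?orbT//.
  by rewrite (@phi_out x (-1)) ?normrN ?normr1 ?lexx ?orbT// !mulr0 subrr.
rewrite -[leRHS]addr0 -k0 -RintegralD//; last 2 first.
- by apply/continuous_integrable_itv/continuous_section1.
- exact: continuous_integrable_itv.
apply: le_Rintegral => //.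
- apply: continuous_integrable_itv; exact: (continuous_section1 c3).
- apply: continuous_integrable_itv => y; apply: cvgD; last exact: ck.
  exact: (continuous_section1 cg).
move=> y _; rewrite /k.
have ab : (- T x) ^+ 2 + (- T2 y) ^+ 2 <= 1.
  rewrite !sqrrN -(cos2Dsin2 (al x)) addrC lerD2r /T2 exprMn.
  rewrite -[leRHS]mulr1 ler_wpM2l ?sqr_ge0//.
  have /andP[P0 Pl] := PB y.
  have q0 : 0 <= 2 / l x * P y by rewrite mulr_ge0// divr_ge0// ltW.
  have q1 : 2 / l x * P y <= 2 by rewrite mulrAC ler_pdivrMr// ler_wpM2l.
  nra.
have G : - T x * dx (x, y) + - T2 y * dy (x, y) <= grad_norm phi (x, y).
  exact: grad_norm_CS.
suff : 2 * s * phi (x, y) ^+ 2 <= T' x * phi (x, y) +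
    phi (x, y) * (2 * cos (al x) / l x * g y) by move: G; rewrite !mulNr; lra.
rewrite (mulrC (T' x)) -mulrDr expr2 mulrA mulrC ler_wpM2l//.
rewrite /T' /g; set f := phi (x, y).
have s2E : s2 = s ^+ 2 by rewrite sqr_sqrtr// divr_ge0 ?mulr_ge0 ?subr_ge0 ?pi_ge0 ?ltW.
rewrite s2E; set c := cos (al x) in cx *; set L := l x in lx *.
(* The inequality of the means, as a complete square. *)
rewrite -subr_ge0 (_ : _ - _ = 2 * c / L * (s * L / (2 * c) - f) ^+ 2).
  by rewrite mulr_ge0 ?sqr_ge0// divr_ge0 ?mulr_ge0// ltW.
by field; rewrite !gt_eqF.
Qed.

Let is_derive_Tphi z : is_derive z (basis2 R ord0) (fun z => T z.1 * phi z)
  (T z.1 * dx z + T' z.1 * phi z).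
Proof.
have d1 : is_derive z (basis2 R ord0) (fun z : R * R => z.1) 1.
  case: z => x y; rewrite basis20; apply/is_derive_fst; exact: is_derive_id.
have dT := is_derive_comp1 d1 (is_derive_T z.1).
have dphi := smooth_is_derive z ord0 (test_smooth tphi).
apply: is_derive_eq.
by rewrite /GRing.scale/= mulr1 (mulrC (phi z)).
Qed.

(** Integrating [section_bound] over [x] gives [2 s m <= int |grad phi|], and
    [s ^ 2 = (1 - de) pi / m]. *)
Lemma knothe_bound : 4 * pi * (1 - de) * m <= (\int[mu]_(z in B) grad_norm phi z) ^+ 2.
Proof.
have cg : continuous (grad_norm phi) by apply/continuous_grad_norm/test_smooth.
set D := \int[mu]_(z in B) _.
have s20 : 0 <= s2 by rewrite divr_ge0 ?mulr_ge0 ?subr_ge0 ?pi_ge0 ?ltW.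
have DE : 'D_(basis2 R ord0) (fun z => T z.1 * phi z) =
    (fun z : R * R => T z.1 * dx z + T' z.1 * phi z).
  by apply/funext => z; case: (is_derive_Tphi z).
have D_out z : ~ B z -> T z.1 * dx z + T' z.1 * phi z = 0.
  move=> nB; rewrite (test_out tphi nB) /dx.
  by rewrite (test_out (test_derive ord0 tphi) nB) !mulr0 addr0.
have D0 : \int[mu]_(z in B) (T z.1 * dx z + T' z.1 * phi z) = 0.
  rewrite -DE; apply: Rintegral_derive_eq0.
  - by move=> z nB; rewrite (test_out tphi nB) mulr0.
  - by move=> z; case: (is_derive_Tphi z).
  - by rewrite DE.
  - by move=> z nB; have [_ ->] := is_derive_Tphi z; exact: D_out.
have DQ : D = \int[mu]_(z in Q) grad_norm phi z.
  apply: Rintegral_disc_square => z nB; rewrite /grad_norm.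
  by rewrite !(test_out (test_derive _ tphi) nB) expr0n addr0 sqrtr0.
have : 2 * s * m <= D.
  have -> : 2 * s * m = \int[mu]_(z in B) (2 * s * phi z ^+ 2 -
      (T z.1 * dx z + T' z.1 * phi z)).
    rewrite RintegralB; [|exact: measurable_unit_disc|apply: continuous_integrable_disc..].
    - rewrite D0 subr0 RintegralZl//; first exact: measurable_unit_disc.
      exact: continuous_integrable_disc.
    - by apply: continuous_mul => //; exact: cst_continuous.
    - exact: c12.
  rewrite Rintegral_disc_square; last first.
    by move=> z nB; rewrite D_out// (test_out tphi nB) expr0n mulr0 subr0.
  rewrite DQ !Rintegral_square12//.
  apply: le_Rintegral => [|||x _]; first exact: measurable_itv.
  - apply: continuous_integrable_itv; exact: (continuous_Rintegral_section c3).
  - apply: continuous_integrable_itv; exact: (continuous_Rintegral_section cg).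
  exact: section_bound.
move=> H; have H0 : 0 <= 2 * s * m by rewrite !mulr_ge0 ?sqrtr_ge0 ?ltW.
have -> : 4 * pi * (1 - de) * m = (2 * s * m) ^+ 2.
  rewrite !exprMn sqr_sqrtr// /s2; field.
  by rewrite gt_eqF.
by rewrite ler_sqr ?nnegrE// (le_trans H0).
Qed.

End Knothe.

Lemma sharp_sobolev phi : test_function B phi -> (forall z, 0 <= phi z) ->
  4 * pi * \int[mu]_(z in B) phi z ^+ 2 <= (\int[mu]_(z in B) grad_norm phi z) ^+ 2.
Proof.
move=> tphi phi0; set m := \int[mu]_(z in B) _; set D := _ ^+ 2.
have [m0|m0] := leP m 0.
  by apply: (@le_trans _ _ 0); rewrite ?sqr_ge0// mulr_ge0_le0// mulr_ge0// pi_ge0.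
have p0 := pi_gt0 R.
have K de : 0 < de -> de < 1 -> 4 * pi * (1 - de) * m <= D by move=> *; exact: knothe_bound.
apply/ler_addgt0Pr => e e0.
pose M := 4 * pi * m; have M0 : 0 < M by rewrite !mulr_gt0.
(* The first bound limits the loss [de * M] to [e]; the second keeps [de] below 1. *)
pose de := Num.min (e / M) 2^-1.
have de0 : 0 < de by rewrite lt_min divr_gt0//= invr_gt0.
have de1 : de < 1 by rewrite gt_min; apply/orP; right; lra.
have := K de de0 de1.
have : de * M <= e by rewrite -ler_pdivlMr// ge_min lexx.
rewrite /M; lra.
Qed.

End Sobolev.

(** * The lower bound *)

Section Integration.
Context d (T : measurableType d) (R : realType).
Variables (nu : {measure set T -> \bar R}) (D : set T).
Hypothesis mD : measurable D.
Implicit Types (f g : T -> R).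
Local Notation integ f := (nu.-integrable D (EFin \o f)).

Lemma R_integrableD f g : integ f -> integ g -> integ (fun x => f x + g x).
Proof. by move=> If Ig; have := integrableD mD If Ig. Qed.

Lemma R_integrableZ (k : R) f : integ f -> integ (fun x => k * f x).
Proof. by move=> If; have := integrableZl mD k If. Qed.

Lemma R_integrableB f g : integ f -> integ g -> integ (fun x => f x - g x).
Proof. by move=> If Ig; have := integrableB mD If Ig. Qed.

Lemma R_integrable_sum (n : nat) (F : nat -> T -> R) :
  (forall k, integ (F k)) -> integ (fun x => \sum_(k < n) F k x).
Proof.
move=> IF; elim: n => [|n IH].
  under [X in EFin \o X]eq_fun do rewrite big_ord0.
  exact: integrable0.
under [X in EFin \o X]eq_fun do rewrite big_ord_recr.
exact: R_integrableD.
Qed.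

Lemma Rintegral_sum (n : nat) (F : nat -> T -> R) : (forall k, integ (F k)) ->
  \int[nu]_(x in D) (\sum_(k < n) F k x) = \sum_(k < n) \int[nu]_(x in D) F k x.
Proof.
move=> IF; elim: n => [|n IH].
  by rewrite big_ord0; apply: Rintegral_eq0 => x _; rewrite big_ord0.
under eq_Rintegral do rewrite big_ord_recr.
by rewrite RintegralD//; [rewrite IH big_ord_recr|exact: R_integrable_sum].
Qed.

Lemma integrable_EFinE f : measurable_fun D f -> (forall x, D x -> 0 <= f x) ->
  (\int[nu]_(x in D) (f x)%:E < +oo)%E -> integ f.
Proof.
move=> mf f0 foo; apply/integrableP; split; first exact/measurable_EFinP.
by under eq_integral => x /set_mem Dx do rewrite /= ger0_norm ?f0//.
Qed.

Lemma integral_EFin f : integ f ->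
  (\int[nu]_(x in D) (f x)%:E)%E = (\int[nu]_(x in D) f x)%:E.
Proof. by move=> If; rewrite /Rintegral fineK//; exact: integrable_fin_num. Qed.

Lemma le_Rintegral_subset (A : set T) f : measurable A -> A `<=` D -> integ f ->
  (forall x, D x -> 0 <= f x) -> \int[nu]_(x in A) f x <= \int[nu]_(x in D) f x.
Proof.
move=> mA AD If f0; rewrite /Rintegral; apply: fine_le.
- by apply: integrable_fin_num => //; exact: integrableS If.
- exact: integrable_fin_num.
- by apply: ge0_subset_integral => //; case/integrableP: If.
Qed.

Lemma R_dominated (f_ : nat -> T -> R) f g :
  (forall n, measurable_fun D (f_ n)) ->
  (forall x, D x -> f_ ^~ x @ \oo --> f x) -> integ g ->
  (forall n x, D x -> `|f_ n x| <= g x) ->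
  integ f /\ (fun n => \int[nu]_(x in D) f_ n x) @ \oo --> \int[nu]_(x in D) f x.
Proof.
move=> mf cf Ig fg.
have mlim : measurable_fun D f by exact: measurable_fun_cvg cf.
have [If _ H] := @dominated_convergence d T R nu D mD (fun n => EFin \o f_ n) (EFin \o f)
  (EFin \o g) (fun n => (measurable_EFinP D (f_ n)).2 (mf n))
  ((measurable_EFinP D f).2 mlim)
  ltac:(by apply/aeW => x Dx; apply/cvg_EFin; [exact: nearW|exact: cf]) Ig
  ltac:(by apply/aeW => x n Dx; rewrite lee_fin; exact: fg).
split=> //.
have Ifn n : integ (f_ n).
  apply: (le_integrable mD _ _ Ig); first exact/measurable_EFinP.
  move=> x Dx; rewrite lee_fin (le_trans (fg n x Dx))// ler_norm//.
have := @fine_cvg _ _ _ _ (fun n => \int[nu]_(x in D) (f_ n x)%:E)%E (\int[nu]_(x in D) f x).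
by apply; rewrite -integral_EFin.
Qed.

End Integration.

(** * Square-integrable functions on the disc *)

Section L2theory.
Variable R : realType.
Local Notation mu := (lebesgue2 R).
Local Notation B := (@unit_disc R).
Local Notation iB f := (mu.-integrable B (EFin \o f)).
Local Notation L2 := (@L2 R B).
Implicit Types (f g u v : R * R -> R).

Local Notation leb_type := (g_sigma_algebraType R.-ocitv.-measurable).

Let mB : measurable (B : set (leb_type * leb_type)).
Proof. exact: measurable_unit_disc. Qed.

Lemma L2_integrable_sqr f : L2 f -> iB (fun z => f z ^+ 2).
Proof.
move=> [mf foo]; apply: integrable_EFinE => //; last by move=> z _; exact: sqr_ge0.
exact: measurable_funX.
Qed.

Lemma L2I f : measurable_fun B f -> iB (fun z => f z ^+ 2) -> L2 f.
Proof.
move=> mf If; split=> //; by rewrite integral_EFin ?ltry//; exact: measurable_unit_disc.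
Qed.

Lemma L2_mul f g : L2 f -> L2 g -> iB (fun z => f z * g z).
Proof.
move=> Lf Lg; have If := L2_integrable_sqr Lf; have Ig := L2_integrable_sqr Lg.
apply: (le_integrable mB _ _ (R_integrableD mB If Ig)).
  by apply/measurable_EFinP; apply: measurable_funM; [exact: Lf.1|exact: Lg.1].
move=> z _; rewrite lee_fin normrM.
rewrite (@ger0_norm _ (_ + _)) ?addr_ge0 ?sqr_ge0//.
rewrite -(real_normK (num_real (f z))) -(real_normK (num_real (g z))).
have := sqr_ge0 (`|f z| - `|g z|); have := normr_ge0 (f z); have := normr_ge0 (g z); nra.
Qed.

Lemma L2D f g : L2 f -> L2 g -> L2 (fun z => f z + g z).
Proof.
move=> Lf Lg; apply: L2I; first by apply: measurable_funD; [exact: Lf.1|exact: Lg.1].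
have := R_integrableD mB (R_integrableD mB (L2_integrable_sqr Lf) (L2_integrable_sqr Lg))
  (R_integrableZ mB 2 (L2_mul Lf Lg)).
by apply: eq_integrable => // z _ /=; congr EFin; ring.
Qed.

Lemma L2Z (k : R) f : L2 f -> L2 (fun z => k * f z).
Proof.
move=> Lf; apply: L2I; first by apply: measurable_funM; [exact: measurable_cst|exact: Lf.1].
have := R_integrableZ mB (k ^+ 2) (L2_integrable_sqr Lf).
by apply: eq_integrable => // z _ /=; congr EFin; ring.
Qed.

Lemma L2B f g : L2 f -> L2 g -> L2 (fun z => f z - g z).
Proof.
move=> Lf Lg; have := L2D Lf (L2Z (-1) Lg).
by under eq_fun do rewrite mulN1r.
Qed.

Lemma L2_bounded f (M : R) : measurable_fun B f -> (forall z, B z -> `|f z| <= M) -> L2 f.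
Proof.
move=> mf fM; apply: L2I => //; apply: measurable_bounded_integrable => //.
- exact: unit_disc_lty.
- exact: measurable_funX.
- exists (M ^+ 2); split; first exact: num_real.
  move=> x Mx z Bz /=; rewrite normrX (le_trans _ (ltW Mx))//.
  by rewrite lerXn2r ?nnegrE// ?(le_trans _ (fM z Bz))// fM.
Qed.

Lemma L2_continuous f : continuous f -> L2 f.
Proof.
move=> cf; have [M _ HM] := continuous_bounded_disc cf.
apply: L2_bounded HM; apply: measurable_funS (continuous_measurable_plane cf) => //.
Qed.

Lemma L2_integrable f : L2 f -> iB f.
Proof.
move=> Lf; have := L2_mul Lf (L2_continuous (@cst_continuous _ _ (1 : R))).
by apply: eq_integrable => // z _ /=; rewrite mulr1.
Qed.

Lemma discriminant_le (a b c : R) : 0 <= c ->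
  (forall t, 0 <= a + 2 * t * b + t ^+ 2 * c) -> b ^+ 2 <= a * c.
Proof.
move=> c0 H; have [c1|c1] := eqVneq c 0.
  have [->|b0] := eqVneq b 0; first by rewrite c1 mulr0 expr0n.
  (* At this [t] the expression, affine for [c = 0], equals -1. *)
  have := H (- (a + 1) / (2 * b)); rewrite c1 !mulr0 addr0.
  rewrite (_ : 2 * _ * b = - (a + 1)); last by field.
  lra.
have cp : 0 < c by rewrite lt_neqAle eq_sym c1.
have := H (- b / c); rewrite (_ : _ + _ = (a * c - b ^+ 2) / c); last by field.
by rewrite pmulr_lge0 ?invr_gt0// subr_ge0.
Qed.

(** The version for vector fields, needed for gradients: the usual quadratic polynomial in [t],
    summed over both components. *)
Lemma cauchy_schwarz2 f0 f1 g0 g1 : L2 f0 -> L2 f1 -> L2 g0 -> L2 g1 ->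
  (\int[mu]_(z in B) (f0 z * g0 z) + \int[mu]_(z in B) (f1 z * g1 z)) ^+ 2 <=
  (\int[mu]_(z in B) (f0 z ^+ 2) + \int[mu]_(z in B) (f1 z ^+ 2)) *
  (\int[mu]_(z in B) (g0 z ^+ 2) + \int[mu]_(z in B) (g1 z ^+ 2)).
Proof.
move=> Lf0 Lf1 Lg0 Lg1.
have sq0 h : 0 <= \int[mu]_(z in B) (h z ^+ 2) by apply: Rintegral_ge0 => z _; exact: sqr_ge0.
apply: discriminant_le => [|t]; first by rewrite addr_ge0.
have E f g : L2 f -> L2 g -> \int[mu]_(z in B) ((f z + t * g z) ^+ 2) =
   \int[mu]_(z in B) (f z ^+ 2) + 2 * t * \int[mu]_(z in B) (f z * g z) +
   t ^+ 2 * \int[mu]_(z in B) (g z ^+ 2).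
  move=> Lf Lg; have I1 := L2_integrable_sqr Lf; have I2 := L2_mul Lf Lg.
  have I3 := L2_integrable_sqr Lg.
  rewrite -!RintegralZl// -!RintegralD//.
  - by apply: eq_Rintegral => z _; ring.
  - exact/R_integrableD/R_integrableZ.
  - exact: R_integrableZ.
  - exact: R_integrableZ.
have := addr_ge0 (sq0 (fun z => f0 z + t * g0 z)) (sq0 (fun z => f1 z + t * g1 z)).
rewrite !E//; lra.
Qed.

Lemma cauchy_schwarz f g : L2 f -> L2 g ->
  (\int[mu]_(z in B) (f z * g z)) ^+ 2 <=
  \int[mu]_(z in B) (f z ^+ 2) * \int[mu]_(z in B) (g z ^+ 2).
Proof.
move=> Lf Lg; have L0 : L2 (fun=> 0) by apply: L2_continuous; exact: cst_continuous.
have := cauchy_schwarz2 Lf L0 Lg L0.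
rewrite !(@Rintegral_eq0 _ _ _ _ _ (fun z => 0 * 0)) ?mulr0//.
by rewrite !addr0.
Qed.

End L2theory.

(** * A smooth ramp *)

Section SmoothStep.
Variable R : realType.
Local Notation mu1 := (@lebesgue_measure R).

(** The primitive of a smooth function below the indicator of []0, 1[] whose integral is close to 1.
    A smooth ramp of slope at most 1 that is constant off an interval of length 1 cannot reach the
    height 1, hence [kappa < 1]. *)
Lemma smooth_step (kappa : R) : kappa < 1 -> exists S : R -> R,
  [/\ smooth1 S, forall t, t <= 0 -> S t = 0, forall t, 1 <= t -> kappa <= S t,
    forall t, 0 <= S^`() t <= 1 /\ (~~ (0 < t < 1) -> S^`() t = 0) &
    forall t, 0 <= S t <= 1].
Proof.
move=> k1.
pose s n (t : R) := flat n.+1%:R^-1 0 (1 * t + 0) * flat n.+1%:R^-1 0 (-1 * t + 1).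
have e0 n : 0 < n.+1%:R^-1 :> R by rewrite invr_gt0.
have ss n : smooth1 (s n) by apply: smooth1M; apply: smooth1_affine; exact: smooth1_flat.
have cs n : continuous (s n) by exact: smooth1_continuous.
have s01 n t : 0 <= s n t <= 1.
  by rewrite mulr_ge0 ?flat_ge0//= mulr_ile1 ?flat_ge0 ?flat0_le1// ltW.
have s_out n t : ~~ (0 < t < 1) -> s n t = 0.
  rewrite negb_and -!leNgt /s => /orP[t0|t1].
    by rewrite flat_le0 ?mul0r// mul1r addr0.
  by rewrite [X in _ * X]flat_le0 ?mulr0// mulN1r addrC subr_le0.
have s_out' n t : t \notin `[0, 1] -> s n t = 0.
  rewrite notin_setE /= in_itv/= => H; apply: s_out.
  by apply/negP => /andP[t0 t1]; apply: H; rewrite !ltW.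
have s_cvg t : s ^~ t @ \oo --> (if 0 < t < 1 then 1 else 0 : R).
  rewrite (_ : (if _ then _ else _) = (if 0 < 1 * t + 0 then 1 else 0) *
      (if 0 < -1 * t + 1 then 1 else 0)); first by apply: cvgM; exact: flat_cvg.
  rewrite mul1r addr0 mulN1r addrC subr_gt0.
  by case: (0 < t); case: (t < 1); rewrite /= ?mulr1 ?mulr0.
have [I1 cvg_s] : mu1.-integrable `[0, 1] (EFin \o (fun t : R => if 0 < t < 1 then 1 else 0)) /\
    (fun n => \int[mu1]_(t in `[0, 1]) s n t) @ \oo --> \int[mu1]_(t in `[0, 1]) (if 0 < t < 1 then 1 else 0).
  apply: (@R_dominated _ _ _ mu1 _ (measurable_itv _) _ _ (fun=> 1)).
  - by move=> n; apply: measurable_funS (continuous_measurable_fun (cs n)).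
  - by move=> t _; exact: s_cvg.
  - by apply: continuous_integrable_itv; exact: cst_continuous.
  - by move=> n t _; have /andP[? ?] := s01 n t; rewrite ger0_norm.
have lim1 : \int[mu1]_(t in `[0, 1]) (if 0 < t < 1 then 1 else 0 : R) = 1.
  rewrite -Rintegral_itv_bndo_bndc; last first.
    by apply: integrableS I1 => //; exact: subset_itv_co_cc.
  rewrite -Rintegral_itv_obnd_cbnd; last first.
    by apply: integrableS I1 => //; exact: subset_itv_oo_cc.
  rewrite (@eq_Rintegral _ _ _ _ _ (fun=> 1)); last first.
    by move=> t; rewrite inE /= in_itv/= => ->.
  rewrite Rintegral_cst; last exact: measurable_itv.
  have := lebesgue_measure_itv (Interval (BRight (0 : R)) (BLeft 1)); rewrite /= lte_fin ltr01 oppr0 adde0 => E.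
  by rewrite [X in fine X]E mul1r.
rewrite lim1 in cvg_s.
have [n Hn] : exists n, kappa <= \int[mu1]_(t in `[0, 1]) s n t.
  have /cvgrPdist_le/(_ (1 - kappa)) := cvg_s.
  rewrite subr_gt0 => /(_ k1)[n _ /(_ n (leqnn n))] H; exists n.
  by move: H; rewrite ler_norml => /andP[_]; lra.
have Sd t : is_derive t (1 : R) (primitive (s n)) (s n t).
  exact: is_derive_primitive (cs n) (s_out' n).
have Sb t := primitive_bounds t (cs n) (fun t => proj1 (andP (s01 n t))) (s_out' n).
have le1 : \int[mu1]_(t in `[0, 1]) s n t <= 1.
  apply: (@le_trans _ _ (\int[mu1]_(t in `[0, 1]) (1 : R))).
    apply: le_Rintegral => //.
    - exact: continuous_integrable_itv.
    - by apply: continuous_integrable_itv; exact: cst_continuous.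
    - by move=> t _; case/andP: (s01 n t).
  have := @Rintegral_FTC2 R (fun=> 1) id 0 1 ler01 (@cst_continuous _ _ (1 : R)).
  by rewrite subr0 => ->.
exists (primitive (s n)); split.
- exact: smooth1_primitive Sd (ss n).
- move=> t t0; apply: Rintegral_eq0 => r /=; rewrite in_itv/= => rt.
  by apply: s_out; rewrite negb_and -leNgt (le_trans rt t0).
- move=> t t1; apply: (le_trans Hn); apply: le_Rintegral_subset => //.
  + by move=> r /=; rewrite !in_itv/= => /andP[_ r1]; exact: le_trans t1.
  + exact: integrableS (integrable_support (cs n) (s_out' n)).
  + by move=> r _; case/andP: (s01 n r).
- move=> t; rewrite derive1E; have [_ ->] := Sd t; split; first exact: s01.
  exact: s_out.
- move=> t; have /andP[-> /=] := Sb t; move=> /le_trans; exact.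
Qed.

End SmoothStep.

(** * Testing the Laplacian of an admissible function *)

Section WeakDerivatives.
Variable R : realType.
Local Notation mu := (lebesgue2 R).
Local Notation B := (@unit_disc R).
Local Notation iB f := (mu.-integrable B (EFin \o f)).
Local Notation i0 := (ord0 : 'I_2).
Local Notation i1 := (lift ord0 ord0 : 'I_2).
Local Notation leb_type := (g_sigma_algebraType R.-ocitv.-measurable).
Implicit Types (f g u v w : R * R -> R) (phi psi chi : R * R -> R).

Let mB : measurable (B : set (leb_type * leb_type)).
Proof. exact: measurable_unit_disc. Qed.

Lemma weak_derivP s u g : is_weak_deriv B s u g ->
  is_weak_deriv B s u (weak_deriv B s u).
Proof. by move=> ug; apply: (@xgetPex _ (fun=> 0) [set g | is_weak_deriv B s u g]); exists g. Qed.

Lemma test_L2 phi : test_function B phi -> L2 B phi.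
Proof. by move=> /test_continuous; exact: L2_continuous. Qed.

Lemma weak_derivB s u v g h : L2 B u -> L2 B v -> is_weak_deriv B s u g ->
  is_weak_deriv B s v h -> is_weak_deriv B s (fun z => u z - v z) (fun z => g z - h z).
Proof.
move=> Lu Lv [Lg ug] [Lh vh]; split; first exact: L2B.
move=> phi tp; have Lp := test_L2 tp; have Ls := test_L2 (test_partials s tp).
transitivity (\int[mu]_(z in B) (u z * partials s phi z) -
    \int[mu]_(z in B) (v z * partials s phi z)).
  rewrite -RintegralB//; [|exact: L2_mul..].
  by apply: eq_Rintegral => z _; rewrite mulrBl.
rewrite ug// vh// -mulrBr; congr (_ * _); rewrite -RintegralB//; [|exact: L2_mul..].
by apply: eq_Rintegral => z _; rewrite mulrBl.
Qed.

Lemma weak_deriv_C1 f i : continuous f -> (forall z, derivable f z (basis2 R i)) ->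
  continuous (fun z => 'D_(basis2 R i) f z) ->
  is_weak_deriv B [:: i] f (fun z => 'D_(basis2 R i) f z).
Proof.
move=> cf df cdf; split; first exact: L2_continuous.
by move=> phi tp; rewrite /= expr1 mulN1r Rintegral_by_parts.
Qed.

Lemma weak_laplacianE u : weak_laplacian B u =
  (fun z => weak_deriv B [:: i0; i0] u z + weak_deriv B [:: i1; i1] u z).
Proof. by apply/funext => z; rewrite /weak_laplacian big_ord_recl big_ord1. Qed.

Lemma Wk2_weak_deriv k s u : Wk2 B k u -> (size s <= k)%N ->
  is_weak_deriv B s u (weak_deriv B s u).
Proof. by move=> [_ H] sk; have [g] := H s sk; exact: weak_derivP. Qed.

Lemma L2_weak_laplacian u : Wk2 B 2 u -> L2 B (weak_laplacian B u).
Proof.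
by move=> Wu; rewrite weak_laplacianE; apply: L2D; apply: (Wk2_weak_deriv Wu _).1.
Qed.

(** Write [u = C + phi + w] and test with the second derivative of [chi]: the constant contributes
    0, [phi] is integrated by parts classically, and [w] through its weak derivative [d]. *)
Lemma weak_laplacian_test (C : R) u phi chi i d :
  L2 B u -> is_weak_deriv B [:: i; i] u (weak_deriv B [:: i; i] u) ->
  test_function B phi ->
  is_weak_deriv B [:: i] (fun z => (u z - C) - phi z) d -> test_function B chi ->
  \int[mu]_(z in B) (weak_deriv B [:: i; i] u z * chi z) =
  (- (\int[mu]_(z in B) ('D_(basis2 R i) phi z * 'D_(basis2 R i) chi z)))
  - \int[mu]_(z in B) (d z * 'D_(basis2 R i) chi z).
Proof.
move=> Lu [_ wu] tp [Ld wd] tc; have tdc := test_derive i tc.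
have tddc := test_derive i tdc.
have Lddc := test_L2 tddc.
have cC : continuous (fun _ : R * R => C) := @cst_continuous _ _ C.
have H := wd _ tdc; have K := wu _ tc.
rewrite /= expr1 mulN1r in H; rewrite /= sqrrN expr1n mul1r in K.
rewrite -K -H.
have P := Rintegral_by_parts (test_continuous tp)
  (fun z => smooth_derivable (test_smooth tp)) (test_continuous (test_derive i tp)) tdc.
have PC : \int[mu]_(z in B) (C * 'D_(basis2 R i) (fun x => 'D_(basis2 R i) chi x) z) = 0.
  rewrite RintegralZl//; last exact: L2_integrable.
  rewrite Rintegral_derive_eq0 ?mulr0//.
  - by move=> z nB; exact: test_out tdc nB.
  - by move=> z; exact: smooth_derivable (test_smooth tdc).
  - exact: test_continuous tddc.
  - by move=> z nB; exact: test_out tddc nB.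
rewrite -P.
transitivity (\int[mu]_(z in B) (u z * 'D_(basis2 R i) (fun x => 'D_(basis2 R i) chi x) z)
  - \int[mu]_(z in B) (C * 'D_(basis2 R i) (fun x => 'D_(basis2 R i) chi x) z)
  - \int[mu]_(z in B) (phi z * 'D_(basis2 R i) (fun x => 'D_(basis2 R i) chi x) z)
  + \int[mu]_(z in B) (phi z * 'D_(basis2 R i) (fun x => 'D_(basis2 R i) chi x) z)).
  by rewrite PC subr0 subrK.
rewrite addrC; congr (_ + _).
have Lp := test_L2 tp; have LC := L2_continuous cC.
have J1 := L2_mul Lu Lddc; have J2 := L2_mul LC Lddc; have J3 := L2_mul Lp Lddc.
rewrite -(RintegralB mB J1 J2) -(RintegralB mB (R_integrableB mB J1 J2) J3).
by apply: eq_Rintegral => z _; ring.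
Qed.

(** [psi] is minus the test function that approximates [u - C], and [(d0, d1)] is the weak gradient
    of [u - C + psi]. The last clause says that minus the Laplacian of [psi] is that of [u], up to
    the divergence of a field that is small in L2. *)
Lemma admissible_approx (C : R) u (e : R) : admissible B C u -> 0 < e ->
  exists psi d0 d1, [/\ test_function B psi, L2 B d0 /\ L2 B d1,
    \int[mu]_(z in B) (d0 z ^+ 2) + \int[mu]_(z in B) (d1 z ^+ 2) <= e,
    \int[mu]_(z in B) ((u z - C + psi z) ^+ 2) <= e &
    forall chi, test_function B chi ->
    \int[mu]_(z in B) (weak_laplacian B u z * chi z) =
    \int[mu]_(z in B) ('D_(basis2 R i0) psi z * 'D_(basis2 R i0) chi z) +
    \int[mu]_(z in B) ('D_(basis2 R i1) psi z * 'D_(basis2 R i1) chi z) -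
    (\int[mu]_(z in B) (d0 z * 'D_(basis2 R i0) chi z) +
     \int[mu]_(z in B) (d1 z * 'D_(basis2 R i1) chi z))].
Proof.
move=> [Wu [W1 W0]] e0; have [phi [tp Hphi]] := W0 e e0.
pose w z := u z - C - phi z.
have Lu := Wu.1.
have Lw : L2 B w.
  apply: L2B; last exact: test_L2.
  by apply: L2B => //; apply: L2_continuous; exact: cst_continuous.
have dw i : is_weak_deriv B [:: i] w (weak_deriv B [:: i] w).
  apply: weak_derivP; apply: weak_derivB.
  - exact: W1.1.
  - exact: test_L2.
  - exact: (Wk2_weak_deriv W1).
  - apply: weak_deriv_C1; first exact: test_continuous.
      by move=> z; apply/smooth_derivable/test_smooth.
    exact/test_continuous/test_derive.
have Ld i := (dw i).1.
exists (fun z => - phi z), (weak_deriv B [:: i0] w), (weak_deriv B [:: i1] w).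
have sq0 f : 0 <= \int[mu]_(z in B) (f z ^+ 2) by apply: Rintegral_ge0 => z _; exact: sqr_ge0.
have normE : W12_normsq B w = (\int[mu]_(z in B) (w z ^+ 2) +
    (\int[mu]_(z in B) (weak_deriv B [:: i0] w z ^+ 2) +
     \int[mu]_(z in B) (weak_deriv B [:: i1] w z ^+ 2)))%:E.
  have I1 := L2_integrable_sqr Lw; have I2 := L2_integrable_sqr (Ld i0).
  have I3 := L2_integrable_sqr (Ld i1).
  have I23 := R_integrableD mB I2 I3; have I123 := R_integrableD mB I1 I23.
  rewrite -(RintegralD mB I2 I3) -(RintegralD mB I1 I23) -(integral_EFin mB I123).
  by apply: eq_integral => z _; rewrite big_ord_recl big_ord1.
have := Hphi; rewrite -/w normE lte_fin => He.
have Nderiv i z : 'D_(basis2 R i) (fun z => - phi z) z = - 'D_(basis2 R i) phi z.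
  by rewrite deriveN//; exact/smooth_derivable/test_smooth.
split.
- exact: test_opp.
- by split.
- by apply: le_trans (ltW He); rewrite lerDr sq0.
- apply: le_trans (ltW He); rewrite lerDl addr_ge0 ?sq0//.
- move=> chi tc.
  have Lc := test_L2 tc.
  have L1 i := (Wk2_weak_deriv Wu (isT : size [:: i; i] <= 2)%N).
  transitivity (\int[mu]_(z in B) (weak_deriv B [:: i0; i0] u z * chi z) +
      \int[mu]_(z in B) (weak_deriv B [:: i1; i1] u z * chi z)).
    rewrite -RintegralD//; [|exact/L2_mul/Lc/(L1 _).1..].
    by apply: eq_Rintegral => z _; rewrite weak_laplacianE mulrDl.
  apply: etrans (congr2 +%R (weak_laplacian_test Lu (L1 i0) tp (dw i0) tc)
    (weak_laplacian_test Lu (L1 i1) tp (dw i1) tc)) _.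
  have E i : \int[mu]_(z in B) ('D_(basis2 R i) (fun z => - phi z) z * 'D_(basis2 R i) chi z) =
      - (\int[mu]_(z in B) ('D_(basis2 R i) phi z * 'D_(basis2 R i) chi z)).
    rewrite -mulN1r -RintegralZl//; last first.
      by apply: L2_mul; exact/test_L2/test_derive.
    by apply: eq_Rintegral => z _; rewrite Nderiv mulN1r mulNr.
  have H4 (a b c d a' b' : R) : a' = - a -> b' = - b ->
    - a - c + (- b - d) = a' + b' - (c + d) by move=> -> ->; ring.
  exact: H4 (E i0) (E i1).
Qed.

End WeakDerivatives.

(** * The Dirichlet integral between two levels *)

Section Bands.
Variable R : realType.
Local Notation mu := (lebesgue2 R).
Local Notation B := (@unit_disc R).
Local Notation iB f := (mu.-integrable B (EFin \o f)).
Local Notation i0 := (ord0 : 'I_2).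
Local Notation i1 := (lift ord0 ord0 : 'I_2).
Local Notation leb_type := (g_sigma_algebraType R.-ocitv.-measurable).
Local Notation pi := (@pi R).
Implicit Types (f g u v w : R * R -> R) (phi psi chi : R * R -> R).

Let mB : measurable (B : set (leb_type * leb_type)).
Proof. exact: measurable_unit_disc. Qed.

Definition distrib psi (t : R) : R := \int[mu]_(z in B) (t < psi z)%R%:R.

Variables (S : R -> R) (kappa : R).
Hypotheses (sS : smooth1 S) (S0 : forall t, t <= 0 -> S t = 0)
  (S1 : forall t, 1 <= t -> kappa <= S t)
  (dS : forall t, 0 <= S^`() t <= 1 /\ (~~ (0 < t < 1) -> S^`() t = 0))
  (S01 : forall t, 0 <= S t <= 1) (kappa0 : 0 <= kappa).

(** A smooth truncation: it rises from 0 to at least [kappa] while [psi] runs from [k h] to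
    [(k + 1) h]. *)
Definition step_fun (h : R) (k : nat) psi (z : R * R) : R := S (h^-1 * psi z + - k%:R).
Definition step_weight (h : R) (k : nat) psi (z : R * R) : R :=
  (S^`() (h^-1 * psi z + - k%:R))%classic.

Lemma test_step_fun h k psi : test_function B psi -> test_function B (step_fun h k psi).
Proof.
move=> tp; have sh := @smooth1_affine _ S h^-1 (- k%:R) sS.
have h0 : (fun t => S (h^-1 * t + - k%:R)) 0 = 0.
  by rewrite mulr0 add0r S0// oppr_le0 ler0n.
exact: test_comp sh h0 tp.
Qed.

Lemma derive_step_fun h k psi z i : test_function B psi ->
  'D_(basis2 R i) (step_fun h k psi) z =
  h^-1 * (step_weight h k psi z * 'D_(basis2 R i) psi z).
Proof.
move=> tp; have d1 := smooth_is_derive z i (test_smooth tp).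
have d2 : is_derive z (basis2 R i) (fun z => h^-1 * psi z + - k%:R)
    (h^-1 * 'D_(basis2 R i) psi z).
  by apply: is_derive_eq; rewrite ?oppr0 ?addr0.
have [_ ->] := is_derive_comp1 d2 (smooth1_is_derive _ sS).
by rewrite /step_weight mulrCA.
Qed.

Lemma measurable_superlevel psi (t : R) : continuous psi ->
  measurable_fun B (fun z => (t < psi z)%R%:R : R).
Proof.
move=> cp; rewrite (_ : (fun _ => _) = \1_([set z | t < psi z])); last first.
  by apply/funext => z; rewrite indicE; congr (nat_of_bool _)%:R; apply/idP/idP; rewrite inE.
apply: measurable_indic; apply: open_measurable_plane.
have -> : [set z | t < psi z] = psi @^-1` [set s | t < s] by [].
by apply: open_comp; [move=> z _; exact: cp|exact: open_gt].
Qed.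

Lemma L2_superlevel psi t : continuous psi -> L2 B (fun z => (t < psi z)%R%:R).
Proof.
move=> cp; apply: (@L2_bounded _ _ 1); first exact: measurable_superlevel.
by move=> z _; case: (t < psi z); rewrite ?normr1 ?normr0.
Qed.

Lemma distrib_nincr psi s t : continuous psi -> s <= t -> distrib psi t <= distrib psi s.
Proof.
move=> cp st; apply: le_Rintegral => //.
- exact/L2_integrable/L2_superlevel.
- exact/L2_integrable/L2_superlevel.
- move=> z _; case: (ltP t (psi z)) => [tz|_]; last by rewrite ler0n.
  by rewrite (le_lt_trans st tz).
Qed.

Lemma continuous_step_weight h k psi : continuous psi -> continuous (step_weight h k psi).
Proof.
move=> cp z; apply: (@continuous_comp _ _ _ (fun z => h^-1 * psi z + - k%:R)); last first.
  exact/smooth1_continuous/smooth1_derive.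
by apply: cvgD; [apply: cvgM; [exact: cvg_cst|exact: cp]|exact: cvg_cst].
Qed.

Definition dirichlet_density psi (z : R * R) : R :=
  'D_(basis2 R i0) psi z ^+ 2 + 'D_(basis2 R i1) psi z ^+ 2.

Lemma continuous_dirichlet_density psi : smooth psi -> continuous (dirichlet_density psi).
Proof.
move=> sp; have cd i := smooth_continuous (smooth_derive i sp).
by apply: continuous_add; apply: continuous_mul; exact: cd.
Qed.

(** The sharp Sobolev inequality is applied to [step_fun], which is at least [kappa] above the upper
    level and whose gradient lives on the band. The weight appears to the first power, as in the
    gradient of the test function to be built from these ramps; since it lies in [[0, 1]], it
    dominates its square. *)
Lemma band_inequality (h : R) (k : nat) psi : 0 < h -> test_function B psi ->
  4 * pi * (h * kappa) ^+ 2 * distrib psi (k.+1%:R * h) <=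
  (distrib psi (k%:R * h) - distrib psi (k.+1%:R * h)) *
  \int[mu]_(z in B) (step_weight h k psi z * dirichlet_density psi z).
Proof.
move=> h0 tp; have sp := test_smooth tp; have cp := test_continuous tp.
have ts : test_function B (step_fun h k psi) by exact: test_step_fun.
have cw := @continuous_step_weight h k _ cp.
have cD := continuous_dirichlet_density sp.
have cg := continuous_grad_norm sp.
have w01 z : 0 <= step_weight h k psi z <= 1 by case: (dS (h^-1 * psi z + - k%:R)).
have gE z : grad_norm psi z ^+ 2 = dirichlet_density psi z.
  by rewrite sqr_sqrtr// addr_ge0 ?sqr_ge0.
have gS z : grad_norm (step_fun h k psi) z = h^-1 * (step_weight h k psi z * grad_norm psi z).
  have /andP[w0 _] := w01 z.
  rewrite /grad_norm (@derive_step_fun h k psi z i0 tp) (@derive_step_fun h k psi z i1 tp).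
  have sqrt_scale (a c p q : R) : 0 <= a -> 0 <= c ->
      Num.sqrt ((a * (c * p)) ^+ 2 + (a * (c * q)) ^+ 2) = a * (c * Num.sqrt (p ^+ 2 + q ^+ 2)).
    move=> a0 c0; rewrite !exprMn -!mulrDr sqrtrM ?sqr_ge0// sqrtr_sqr ger0_norm//.
    by rewrite sqrtrM ?sqr_ge0// sqrtr_sqr ger0_norm.
  by apply: sqrt_scale => //; rewrite invr_ge0 ltW.
have := sharp_sobolev ts (fun z => proj1 (andP (S01 _))).
set a := \int[mu]_(z in B) _; set b := \int[mu]_(z in B) _ => sob.
set I := \int[mu]_(z in B) (_ * _).
(* The indicator of the band; inserted into the integral of the gradient, it makes Cauchy-Schwarz
   produce the area of the band. *)
pose E z : R := (k%:R * h < psi z)%R%:R - (k.+1%:R * h < psi z)%R%:R.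
have kh : k%:R * h <= k.+1%:R * h by rewrite ler_pM2r// ler_nat.
have E01 z : E z ^+ 2 = E z.
  rewrite /E; case: (ltP (k.+1%:R * h) (psi z)) => [Kz|_].
    by rewrite (le_lt_trans kh Kz) subrr expr0n.
  by rewrite subr0; case: (_ < _); rewrite ?expr1n ?expr0n.
have LE : L2 B E by apply: L2B; exact: L2_superlevel.
have wE z : step_weight h k psi z = step_weight h k psi z * E z.
  have [_ H] := dS (h^-1 * psi z + - k%:R).
  have [/andP[t0 t1]|/H/= wz] := boolP (0 < h^-1 * psi z + - k%:R < 1); last first.
    by rewrite /step_weight wz mul0r.
  rewrite /E (_ : k%:R * h < psi z); last first.
    by move: t0; rewrite subr_gt0 mulrC ltr_pdivlMr.
  rewrite ltNge (_ : psi z <= _) ?subr0 ?mulr1//.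
  by move: t1; rewrite ltrBlDr addrC natr1 mulrC ltr_pdivrMr// => /ltW.
have LwG : L2 B (fun z => step_weight h k psi z * grad_norm psi z).
  by apply: L2_continuous; exact: continuous_mul.
have bI : b ^+ 2 <= h^-1 ^+ 2 * ((distrib psi (k%:R * h) - distrib psi (k.+1%:R * h)) * I).
  have -> : b = h^-1 * \int[mu]_(z in B) (E z * (step_weight h k psi z * grad_norm psi z)).
    rewrite -RintegralZl//; last exact: L2_mul.
    by apply: eq_Rintegral => z _; rewrite gS {1}wE; ring.
  rewrite exprMn ler_wpM2l ?sqr_ge0//.
  apply: (le_trans (cauchy_schwarz LE LwG)).
  have -> : \int[mu]_(z in B) E z ^+ 2 = distrib psi (k%:R * h) - distrib psi (k.+1%:R * h).
    rewrite -RintegralB//; [|exact/L2_integrable/L2_superlevel..].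
    by apply: eq_Rintegral => z _; rewrite E01.
  apply: ler_wpM2l; first by rewrite subr_ge0 distrib_nincr.
  apply: le_Rintegral => //.
  - exact: L2_integrable_sqr.
  - by apply/L2_integrable/L2_continuous; exact: continuous_mul.
  - move=> z _; have /andP[w0 w1] := w01 z; rewrite exprMn gE.
    rewrite ler_wpM2r ?addr_ge0 ?sqr_ge0// expr2 -[leRHS]mulr1 ler_wpM2l//.
have aD : kappa ^+ 2 * distrib psi (k.+1%:R * h) <= a.
  rewrite /distrib -RintegralZl//; last exact/L2_integrable/L2_superlevel.
  apply: le_Rintegral => //.
  - exact/R_integrableZ/L2_integrable/L2_superlevel.
  - exact/L2_integrable_sqr/test_L2.
  - move=> z _; case: (ltP (k.+1%:R * h) (psi z)) => [Kz|_]; last by rewrite mulr0 sqr_ge0.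
    rewrite mulr1 lerXn2r ?nnegrE//; first by case/andP: (S01 (h^-1 * psi z + - k%:R)).
    by apply: S1; rewrite lerBrDr addrC natr1 mulrC ler_pdivlMr// ltW.
have h2 : 0 < h ^+ 2 by rewrite exprn_gt0.
have p0 := pi_gt0 R.
have := le_trans sob bI.
set D := distrib psi (k.+1%:R * h) in aD *; set X := (distrib psi (k%:R * h) - D) * I => H.
have : 4 * pi * (kappa ^+ 2 * D) <= h^-1 ^+ 2 * X.
  by apply: le_trans H; rewrite ler_wpM2l// mulr_ge0// ltW.
move=> /(ler_wpM2l (ltW h2)); rewrite [leRHS]mulrA -exprMn mulfV ?gt_eqF// expr1n mul1r.
apply: le_trans.
by rewrite le_eqVlt; apply/orP; left; apply/eqP; ring.
Qed.

End Bands.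

(** * Area of discs and integrals of radial functions *)

Section Radial.
Variable R : realType.
Local Notation mu1 := (@lebesgue_measure R).
Local Notation mu := (lebesgue2 R).
Local Notation B := (@unit_disc R).
Local Notation leb_type := (g_sigma_algebraType R.-ocitv.-measurable).
Local Notation pi := (@pi R).

Let mB : measurable (B : set (leb_type * leb_type)).
Proof. exact: measurable_unit_disc. Qed.

Definition normsq (z : R * R) : R := z.1 ^+ 2 + z.2 ^+ 2.

Lemma continuous_normsq : continuous normsq.
Proof.
have c1 : continuous (fst : R * R -> R) by move=> z; exact: cvg_fst.
have c2 : continuous (snd : R * R -> R) by move=> z; exact: cvg_snd.
by apply: continuous_add; exact: continuous_mul.
Qed.

Lemma smooth_normsq : smooth normsq.
Proof.
by apply: smoothD; apply: smoothM; (exact: smooth_fst || exact: smooth_snd).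
Qed.

(** The substitution [x = sqrt s * sin a] turns the integrand into [pi s] times the derivative of
    [disc_fraction], which rises from 0 to 1. *)
Lemma chord_integral (s : R) : 0 < s ->
  (\int[mu1]_(x in `[(- Num.sqrt s)%R, (Num.sqrt s)%R]) (2 * Num.sqrt (s - x ^+ 2))%:E)%E =
  (pi * s)%:E.
Proof.
move=> s0; set r := Num.sqrt s; have r0 : 0 < r by rewrite sqrtr_gt0.
have r2 : r ^+ 2 = s by rewrite sqr_sqrtr// ltW.
have p0 := pi_gt0 R.
have dF (a : R) : is_derive a (1 : R) (fun a => r * sin a) (r * cos a).
  by apply: is_derive_eq.
have F1 : r * sin (pi / 2) = r by rewrite sin_pihalf mulr1.
have F0 : r * sin (- (pi / 2)) = - r by rewrite sinN sin_pihalf mulrN1.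
have dFE : (fun a => r * sin a)^`()%classic = (fun a => r * cos a).
  by apply/funext => a; rewrite derive1E; case: (dF a).
have cF : continuous (fun a => r * sin a).
  by apply: derivable_continuous => a; case: (dF a).
have cdF : continuous (fun a => r * cos a).
  by apply: continuous_mul; [exact: cst_continuous|exact: continuous_cos].
have cG : continuous (fun x : R => 2 * Num.sqrt (s - x ^+ 2)).
  apply: continuous_mul; first exact: cst_continuous.
  move=> x; apply: (@continuous_comp _ _ _ (fun x : R => s - x ^+ 2)); last exact: sqrt_continuous.
  by apply: cvgB; [exact: cvg_cst|exact: exprn_continuous].
rewrite -[in `[- r, r]]F0 -[X in `[_, X]]F1.
rewrite (@integration_by_substitution_increasing R (fun a => r * sin a)
  (fun x : R => 2 * Num.sqrt (s - x ^+ 2)) (- (pi / 2)) (pi / 2)).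
- transitivity (\int[mu1]_(x in `[(- (pi / 2))%R, (pi / 2)%R]) ((pi * s) * (2 * cos x ^+ 2 / pi))%:E)%E.
    apply: eq_integral => a; rewrite inE /= in_itv/= => /andP[a1 a2].
    congr EFin; rewrite dFE /=.
    have c0 : 0 <= cos a by rewrite cos_ge0_pihalf// a1 a2.
    change (2 * Num.sqrt (s - (r * sin a) ^+ 2) * (r * cos a) = pi * s * (2 * cos a ^+ 2 / pi)).
    have -> : s - (r * sin a) ^+ 2 = (r * cos a) ^+ 2.
      by rewrite !exprMn r2 sin2cos2; ring.
    rewrite sqrtr_sqr ger0_norm; last by rewrite mulr_ge0// ltW.
    by rewrite -r2; move: pi p0 => q q0; field; rewrite gt_eqF.
  have dA a : is_derive a (1 : R) (fun a => pi * s * disc_fraction a) (pi * s * (2 * cos a ^+ 2 / pi)).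
    have := is_derive_disc_fraction a => ?; exact: is_derive_eq.
  have cA : continuous (fun a : R => pi * s * (2 * cos a ^+ 2 / pi)).
    apply: continuous_mul; first exact: cst_continuous.
    apply: continuous_mul; last exact: cst_continuous.
    apply: continuous_mul; first exact: cst_continuous.
    by apply: continuous_mul; exact: continuous_cos.
  rewrite integral_EFin; [|exact: measurable_itv|exact: continuous_integrable_itv].
  rewrite (Rintegral_FTC2 _ cA dA); last by lra.
  by have [-> ->] := disc_fraction_pihalf R; rewrite mulr1 mulr0 subr0.
- lra.
- apply: gtr0_derive1_lt_cc => [a _|a|].
  + by case: (dF a).
  + by rewrite in_itv/= dFE => aI; rewrite mulr_gt0// cos_gt0_pihalf.
  + exact: continuous_subspaceT.
- by move=> a _; rewrite dFE; exact: cdF.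
- apply/cvg_ex; exists (r * cos (- (pi / 2))); rewrite dFE.
  exact/cvg_at_right_filter/cdF.
- apply/cvg_ex; exists (r * cos (pi / 2)); rewrite dFE.
  exact/cvg_at_left_filter/cdF.
- split=> [a _|/=|]; first by case: (dF a).
    exact/cvg_at_right_filter/cF.
  exact/cvg_at_left_filter/cF.
- exact: continuous_subspaceT.
Qed.

Lemma open_disc_measurable (s : R) : measurable ([set z | normsq z < s] : set (leb_type * leb_type)).
Proof.
apply: open_measurable_plane.
have -> : [set z | normsq z < s] = normsq @^-1` [set t | t < s] by [].
by apply: open_comp; [move=> z _; exact: continuous_normsq|exact: open_lt].
Qed.

Lemma disc_area (s : R) : 0 <= s ->
  mu ([set z | normsq z < s] : set (leb_type * leb_type)) = (pi * s)%:E.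
Proof.
rewrite le_eqVlt => /predU1P[<-|s0].
  rewrite (_ : [set _ | _] = set0) ?measure0 ?mulr0//.
  apply/seteqP; split=> // z /=; rewrite ltNge => /negP[].
  by rewrite addr_ge0 ?sqr_ge0.
rewrite -chord_integral// /product_measure1 [RHS]integral_mkcond.
apply: eq_integral => x _; rewrite patchE /=.
have -> : xsection [set z : leb_type * leb_type | normsq z < s] x =
    `]- Num.sqrt (s - x ^+ 2), Num.sqrt (s - x ^+ 2)[%classic.
  apply/seteqP; split=> y; rewrite /xsection /= inE /= in_itv/= -ltr_norml /normsq/= => H.
    have sx : 0 < s - x ^+ 2 by rewrite subr_gt0 (le_lt_trans _ H)// lerDl sqr_ge0.
    by rewrite -sqrtr_sqr ltr_sqrt// ltrBrDl.
  have : Num.sqrt (y ^+ 2) < Num.sqrt (s - x ^+ 2) by rewrite sqrtr_sqr.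
  move=> H2; rewrite -ltrBrDl.
  have [sx|sx] := leP (s - x ^+ 2) 0.
    by move: H2; rewrite (ler0_sqrtr sx) ltNge sqrtr_ge0.
  by rewrite -ltr_sqrt.
have := lebesgue_measure_itv (Interval (BRight (- Num.sqrt (s - x ^+ 2))) (BLeft (Num.sqrt (s - x ^+ 2)))).
rewrite /= lte_fin => E.
set q := Num.sqrt (s - x ^+ 2) in E *; have q0 : 0 <= q by exact: sqrtr_ge0.
have {}E : mu1 `]- q, q[%classic = (2 * q)%:E.
  rewrite [LHS]E; case: ifPn => [_|]; first by rewrite -EFinD; congr EFin; ring.
  by rewrite -leNgt => H; congr EFin; lra.
rewrite [LHS]E; case: ifPn => //; rewrite notin_setE /= in_itv/= -ler_norml => /negP.
rewrite -ltNge => H; change point with (0%:E : \bar R); congr EFin; rewrite /q ler0_sqrtr ?mulr0// subr_le0.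
rewrite -(real_normK (num_real x)) -(sqr_sqrtr (ltW s0)).
by rewrite lerXn2r ?nnegrE ?sqrtr_ge0// ltW.
Qed.

Lemma unit_disc_measure : mu B = pi%:E.
Proof. by rewrite unit_discE (disc_area ler01) mulr1. Qed.

(** Restricted to [[0, 1[], both sides are finite measures, so it is enough to compare them on the
    rays [[x, +oo[], a generating family stable under intersection. In the variable [|z| ^ 2] the
    density is constant, which is why radial functions are integrated in it. *)
Lemma pushforward_normsq (A : set leb_type) : measurable A -> A `<=` `[0, 1[ ->
  mu (normsq @^-1` A) = (pi%:E * mu1 A)%E.
Proof.
move=> mA A01.
have mn : measurable_fun setT (normsq : leb_type * leb_type -> leb_type).
  exact: continuous_measurable_plane continuous_normsq.
have mI : measurable (`[0, 1[%classic : set leb_type) by exact: measurable_itv.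
pose p : {nonneg R} := NngNum (pi_ge0 R).
pose m := measure_function_pushforward__canonical__measure_function_Measure (mu1 \x mu1)%E mn.
pose m1 : {measure set leb_type -> \bar R} := mrestr m mI.
pose m2 : {measure set leb_type -> \bar R} := mscale p (mrestr mu1 mI).
suff : m1 A = m2 A.
  have E1 : m1 A = mu (normsq @^-1` A) by rewrite -[in RHS](setIidl A01).
  have E2 : m2 A = (pi%:E * mu1 A)%E by congr (_ * _)%E; rewrite -[in RHS](setIidl A01).
  by rewrite E1 E2.
have mdisc (s : R) : measurable ([set z | normsq z < s] : set (leb_type * leb_type)) := open_disc_measurable s.
(* [y] is [x] clamped to [[0, 1]]; the preimage is the unit disc without the disc of squared radius
   [y]. *)
have rayE (x : R) : m1 `[x, +oo[%classic = (pi * (1 - Num.max 0 (Num.min x 1)))%:E.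
  set y := Num.max 0 _.
  have y01 : 0 <= y <= 1.
    by rewrite le_max lexx ge_max ler01/= ge_min lexx orbT.
  change (mu (normsq @^-1` (`[x, +oo[ `&` `[0%R, 1%R[)) = (pi * (1 - y))%:E).
  have -> : normsq @^-1` (`[x, +oo[ `&` `[0, 1[) =
      [set z : leb_type * leb_type | normsq z < 1] `\` [set z | normsq z < y].
    apply/seteqP; split=> z /=; rewrite !in_itv/= andbT.
      move=> [xz /andP[z0 z1]]; split=> //; apply/negP; rewrite -leNgt.
      by rewrite /y ge_max z0 ge_min xz.
    move=> [z1 /negP]; rewrite -leNgt /y ge_max ge_min => /andP[z0].
    by rewrite z0 z1 [1 <= _]leNgt z1 orbF.
  have /andP[y0 y1] := y01.
  have D1 := disc_area ler01; have Dy := disc_area y0.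
  have fin1 : (mu [set z | (normsq z < 1)%R] < +oo)%E by rewrite D1 ltry.
  apply: etrans (measureD (mdisc 1) (mdisc y) fin1) _.
  rewrite setIidr; last by move=> z /= zy; exact: lt_le_trans y1.
  apply: etrans (congr2 (fun a b => (a - b)%E) D1 Dy) _.
  by rewrite -EFinB mulrBr.
have ray2E (x : R) : m2 `[x, +oo[%classic = (pi * (1 - Num.max 0 (Num.min x 1)))%:E.
  set y := Num.max 0 _.
  have /andP[y0 y1] : 0 <= y <= 1.
    by rewrite le_max lexx ge_max ler01/= ge_min lexx orbT.
  change ((pi%:E * mu1 (`[x, +oo[ `&` `[0%R, 1%R[))%E = (pi * (1 - y))%:E).
  have -> : `[x, +oo[ `&` `[0, 1[ = [set` Interval (BLeft y) (BLeft 1)].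
    apply/seteqP; split=> z /=; rewrite !in_itv/= ?andbT.
      by move=> [xz /andP[z0 z1]]; rewrite z1 /y ge_max z0 ge_min xz.
    rewrite /y ge_max ge_min => /andP[/andP[z0 xz] z1]; rewrite z0 z1; split=> //.
    by case/orP: xz => //; rewrite leNgt z1.
  have := lebesgue_measure_itv (Interval (BLeft y) (BLeft 1)); rewrite /= lte_fin => E.
  rewrite [X in (_ * X)%E]E; case: ifPn => [_|]; first by rewrite -EFinB -EFinM.
  by rewrite -leNgt => H; rewrite mule0 (_ : y = 1) ?subrr ?mulr0//; apply/eqP; rewrite eq_le y1.
apply: (@measure_unique _ R leb_type (@measurable_realfun.RGenCInfty.G R) (fun n => `[- (n%:R), +oo[%classic)).
- exact: measurable_realfun.RGenCInfty.measurableE.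
- move=> _ _ [x ->] [y ->]; exists (Num.max x y).
  apply/seteqP; split=> z /=; rewrite !in_itv/= !andbT ge_max; first by move=> [-> ->].
  by move=> /andP[].
- by move=> n; exists (- n%:R).
- apply/seteqP; split=> // x _; exists (Num.trunc `|x|).+1 => //=.
  rewrite in_itv/= andbT lerNl (le_trans (ler_norm _))// normrN ltW//.
  exact: truncnS_gt.
- by move=> _ [x ->]; rewrite rayE ray2E.
- by move=> n; rewrite rayE ltry.
- exact: mA.
Qed.

Lemma ge0_radial_integral (h : R -> \bar R) : measurable_fun (`[0, 1[ : set leb_type) h ->
  (forall t : R, 0 <= t < 1 -> (0 <= h t)%E) ->
  (\int[mu]_(z in B) h (normsq z) = pi%:E * \int[mu1]_(t in `[0%R, 1%R[) h t)%E.
Proof.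
move=> mh h0.
have mn : measurable_fun setT (normsq : leb_type * leb_type -> leb_type).
  exact: continuous_measurable_plane continuous_normsq.
have mI : measurable (`[0, 1[%classic : set leb_type) by exact: measurable_itv.
have h0' : {in `[0, 1[%classic, forall t, (0 <= h t)%E}.
  by move=> t; rewrite inE /= in_itv/=; exact: h0.
have := ge0_integral_pushforward mn (mu1 \x mu1)%E mI mh h0'.
have -> : normsq @^-1` `[0, 1[ = B.
  apply/seteqP; split=> z; rewrite unit_discE /= in_itv/=; first by case/andP.
  by rewrite /normsq => ->; rewrite addr_ge0 ?sqr_ge0.
move=> <-; pose p : {nonneg R} := NngNum (pi_ge0 R).
rewrite (eq_measure_integral (mscale p mu1)); last first.
  by move=> A mA A01; exact: pushforward_normsq.
by rewrite ge0_integral_mscale.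
Qed.

End Radial.

(** * Discrete logarithms along a nonincreasing sequence *)

Section LogSums.
Variable R : realType.
Implicit Types (de P : R) (m : nat -> R).

Lemma ln_le_subr1 (x : R) : 0 < x -> ln x <= x - 1.
Proof. by move=> x0; have := expR_ge1Dx (ln x); rewrite lnK ?posrE//; lra. Qed.

Lemma expR_ge_quad (x : R) : 0 <= x -> 1 + x + x ^+ 2 / 2 <= expR x.
Proof.
move=> x0; pose f (t : R) := expR t - (1 + t + 2^-1 * (t * t)).
have df (t : R) : is_derive t (1 : R) f (expR t - (1 + t)).
  rewrite /f; apply: is_derive_eq; rewrite /GRing.scale/=.
  by rewrite add0r !mulr1; field.
suff : f 0 <= f x by rewrite /f expR0 expr2; lra.
rewrite -subr_ge0 -(Rintegral_FTC2 x0 _ df).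
  by apply: Rintegral_ge0 => t _; rewrite subr_ge0 expR_ge1Dx.
apply: derivable_continuous => t; apply: derivableB; first exact: derivable_expR.
by apply: derivableD; [exact: derivable_cst|exact: derivable_id].
Qed.

(* First order increments of [- ln m]; the large ones are discarded. *)
Definition log_incr de m (k : nat) : R :=
  let r := (m k - m k.+1) / m k.+1 in if r <= de then r else 0.

Definition log_sum de m (j : nat) : R := \sum_(k < j) log_incr de m k.

(** The integral over [m] from 0 to [P] of the square of the minimum of [ln (P / m)] and
    [ln (P / a)], in closed form; in the continuous limit it is the integral of theta(psi)^2. *)
Definition log_defect P (a : R) : R := 2 * (P - a - a * ln (P / a)).

Variables (de P : R) (m : nat -> R) (N : nat).
Hypotheses (de0 : 0 < de) (m0 : forall k, (k <= N)%N -> 0 < m k)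
  (m_nincr : forall k, m k.+1 <= m k) (mP : m 0%N <= P).

Local Notation c := (log_incr de m).
Local Notation L := (log_sum de m).

Lemma log_incr_bounds k : (k < N)%N -> 0 <= c k <= de.
Proof.
move=> kN; rewrite /log_incr; case: ifPn => [H|_]; last by rewrite lexx ltW.
by rewrite H andbT divr_ge0 ?subr_ge0// ltW// m0.
Qed.

(** With [x = m k / m k.+1] the increment is [x - 1 = x (1 - 1 / x)]; here [x <= 1 + de] because it
    was not discarded, and [1 - 1 / x <= ln x]. *)
Lemma log_incr_le k : (k < N)%N -> c k <= (1 + de) * (ln (m k) - ln (m k.+1)).
Proof.
move=> kN; have mk := m0 kN; have mk' := m0 (ltnW kN).
rewrite -ln_div ?posrE//; set x := m k / m k.+1.
have x0 : 0 < x by rewrite divr_gt0.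
have x1 : 1 <= x by rewrite ler_pdivlMr// mul1r.
have xln : 1 - x^-1 <= ln x.
  have := ln_le_subr1 (_ : 0 < x^-1); rewrite invr_gt0 => /(_ x0).
  by rewrite lnV ?posrE//; lra.
have ln0 : 0 <= ln x by rewrite ln_ge0.
rewrite /log_incr; case: ifPn => [|_]; last by rewrite mulr_ge0// addr_ge0// ltW.
rewrite mulrBl mulfV ?gt_eqF// -/x => xde.
apply: (@le_trans _ _ ((1 + de) * (1 - x^-1))); last first.
  by rewrite ler_wpM2l// addr_ge0// ltW.
rewrite (_ : (1 + de) * (1 - x^-1) = (x - 1) * ((1 + de) / x)); last first.
  by field; rewrite gt_eqF.
rewrite -[leLHS]mulr1 ler_wpM2l ?subr_ge0// ler_pdivlMr// mul1r; lra.
Qed.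

Lemma log_sum_ge0 j : (j <= N)%N -> 0 <= L j.
Proof.
move=> jN; apply: sumr_ge0 => k _.
by case/andP: (log_incr_bounds (leq_trans (ltn_ord k) jN)).
Qed.

Lemma log_sumS j : L j.+1 = L j + c j.
Proof. by rewrite /log_sum big_ord_recr. Qed.

Lemma P_gt0 : 0 < P. Proof. exact: lt_le_trans (m0 (leq0n N)) mP. Qed.

Lemma m_leP j : m j <= P.
Proof. by elim: j => [//|j IH]; exact: le_trans (m_nincr j) IH. Qed.

Lemma ln_ratio_ge0 j : (j <= N)%N -> 0 <= ln (P / m j).
Proof. by move=> /m0 mj; rewrite ln_ge0// ler_pdivlMr// mul1r m_leP. Qed.

Lemma log_sum_le j : (j <= N)%N -> L j <= (1 + de) * ln (P / m j).
Proof.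
elim: j => [_|j IH jN].
  by rewrite /log_sum big_ord0 mulr_ge0 ?ln_ratio_ge0// addr_ge0// ltW.
rewrite log_sumS; have H := IH (ltnW jN); have K := log_incr_le jN.
have P0 := P_gt0; have mj := m0 jN; have mj' := m0 (ltnW jN).
move: H K; rewrite !ln_div ?posrE//; lra.
Qed.

(** Lower Riemann sums with one interval: [ln (P / m)] and its square decrease in [m], and the
    right-hand sides are their integrals over [[b, a]], written with antiderivatives. Setting
    [a = b exp l] reduces both claims to the second-order bound for the exponential. *)
Lemma log_sum_primitive (a b : R) : 0 < b -> b <= a -> a <= P ->
  (a - b) * ln (P / a) <= (P - b - b * ln (P / b)) - (P - a - a * ln (P / a)) /\
  (a - b) * ln (P / a) ^+ 2 <=
   (2 * P - b * (ln (P / b) ^+ 2 + 2 * ln (P / b) + 2)) -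
   (2 * P - a * (ln (P / a) ^+ 2 + 2 * ln (P / a) + 2)).
Proof.
move=> b0 ba aP; have a0 := lt_le_trans b0 ba; have P0 := lt_le_trans a0 aP.
pose l := ln (a / b); pose q := ln (P / a).
have lE : ln (P / b) = q + l by rewrite /q /l !ln_div ?posrE//; ring.
have l0 : 0 <= l by rewrite ln_ge0// ler_pdivlMr// mul1r.
have q0 : 0 <= q by rewrite ln_ge0// ler_pdivlMr// mul1r.
have aE : a = b * expR l by rewrite lnK ?posrE ?divr_gt0// mulrC divfK// gt_eqF.
rewrite lE -/q; have := expR_ge_quad l0; rewrite aE; move: (expR l) => x xl.
have xl2 : b * (1 + l + l ^+ 2 / 2) <= b * x by rewrite ler_wpM2l// ltW.
have lsq := sqr_ge0 l.
split; first by nra.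
have : q * (b * l) <= q * (b * x - b).
  by apply: ler_wpM2l => //; nra.
nra.
Qed.

(** Summation by parts, carried out within the induction: the boundary term [m j * L j ^ 2] is kept
    on the right, so that one step adds [(m j - m j.+1) * L j.+1 ^ 2]. The bound
    [L j.+1 <= (1 + de) ln (P / m j) + de], squared, gives the three kinds of terms, each compared
    with its integral. *)
Lemma log_sum_sqr j : (j <= N)%N ->
  \sum_(k < j) (L k.+1 ^+ 2 - L k ^+ 2) * m k <=
  (1 + de) ^+ 2 * (2 * P - m j * (ln (P / m j) ^+ 2 + 2 * ln (P / m j) + 2)) +
  2 * (1 + de) * de * (P - m j - m j * ln (P / m j)) + de ^+ 2 * (P - m j)
  + m j * L j ^+ 2.
Proof.
elim: j => [_|j IH jN].
  rewrite big_ord0; have := @log_sum_primitive P (m 0%N) (m0 (leq0n N)) mP (lexx P).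
  rewrite mulfV ?gt_eqF ?P_gt0// ln1 !mulr0 expr0n/= !mulr0 => -[A1 A2].
  have de1 : 0 <= 1 + de by rewrite addr_ge0// ltW.
  rewrite !addr_ge0// mulr_ge0 ?sqr_ge0//.
  - by move: A2; lra.
  - by rewrite !mulr_ge0// ltW.
  - by move: A1; lra.
  - by rewrite subr_ge0.
  - by rewrite ltW// m0.
rewrite big_ord_recr /=; have {}IH := IH (ltnW jN).
have mj := m0 jN; have mj' := m0 (ltnW jN).
have [A1 A2] := log_sum_primitive mj (m_nincr j) (m_leP j).
have Lj := log_sum_le (ltnW jN); have /andP[c0 cde] := log_incr_bounds jN.
have q0 := ln_ratio_ge0 (ltnW jN).
have LS0 := log_sum_ge0 jN.
set q := ln (P / m j) in IH A1 A2 Lj q0 *.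
have LS : L j.+1 <= (1 + de) * q + de by rewrite log_sumS; lra.
have LS2 : L j.+1 ^+ 2 <= ((1 + de) * q + de) ^+ 2 by rewrite lerXn2r// nnegrE// (le_trans LS0).
have dm : 0 <= m j - m j.+1 by rewrite subr_ge0.
have := ler_wpM2l dm LS2.
have B2 := ler_wpM2l (sqr_ge0 (1 + de)) A2.
have de20 : 0 <= 2 * (1 + de) * de by rewrite !mulr_ge0// ?addr_ge0// ltW.
have B1 := ler_wpM2l de20 A1.
move: IH B1 B2; set q' := ln (P / m j.+1).
move: (\sum_(_ < _) _) => S0; move: (L j.+1 ^+ 2) (L j ^+ 2) => l1 l2.
lra.
Qed.

(** Estimating [L N] once more cancels the squared logarithms at the end of the sum; what is left is
    a multiple of the defect, with the factor [(1 + de) ^ 2 + (1 + de) de]. *)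
Lemma log_sum_sqr_le :
  \sum_(k < N) (L k.+1 ^+ 2 - L k ^+ 2) * m k <=
  (1 + de) * (1 + 2 * de) * log_defect P (m N) + de ^+ 2 * P.
Proof.
apply: (le_trans (log_sum_sqr (leqnn N))).
have mN := m0 (leqnn N); have LN := log_sum_le (leqnn N).
have LN2 : L N ^+ 2 <= ((1 + de) * ln (P / m N)) ^+ 2.
  by rewrite lerXn2r// nnegrE ?log_sum_ge0// (le_trans _ LN)// log_sum_ge0.
have := ler_wpM2l (ltW mN) LN2.
have : 0 <= de ^+ 2 * m N by rewrite mulr_ge0 ?sqr_ge0// ltW.
rewrite /log_defect; move: (L N ^+ 2) => l; set q := ln _.
lra.
Qed.

(* A discarded increment shrinks [m] by a factor [1 + de], so there are few of them. *)
Lemma count_log_incr :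
  N%:R - ln (P / m N) / ln (1 + de) <=
  \sum_(k < N) ((m k - m k.+1) / m k.+1 <= de)%R%:R.
Proof.
have ld : 0 < ln (1 + de) by rewrite ln_gt0// ltrDl.
suff H j : (j <= N)%N -> j%:R * ln (1 + de) - ln (P / m j) <=
   (\sum_(k < j) ((m k - m k.+1) / m k.+1 <= de)%R%:R) * ln (1 + de).
  by rewrite -(ler_pM2r ld) mulrBl divfK ?gt_eqF// H.
elim: j => [_|j IH jN].
  by rewrite big_ord0 !mul0r sub0r oppr_le0 ln_ratio_ge0.
rewrite big_ord_recr/= mulrDl; have {}IH := IH (ltnW jN).
have mj := m0 jN; have mj' := m0 (ltnW jN); have P0 := P_gt0.
move: IH; rewrite !ln_div ?posrE// -natr1 mulrDl.
have : ln (m j.+1) <= ln (m j) by rewrite ler_ln ?posrE.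
move: (\sum_(_ < _) _) => S0.
case: (leP ((m j - m j.+1) / m j.+1) de) => [_|H] /=; first by lra.
have : ln (1 + de) <= ln (m j / m j.+1).
  rewrite ler_ln ?posrE ?divr_gt0 ?addr_gt0//.
  by move: H; rewrite mulrBl mulfV ?gt_eqF//; lra.
rewrite ln_div ?posrE//; lra.
Qed.

(** Since [a] holds on an initial segment, the sum is [L] at the end of that segment, and its square
    telescopes. Applied to the levels below [psi z], this makes the square of theta(psi) linear in
    the indicators of superlevel sets, which integrate to [m k]. *)
Lemma sqr_sum_nincr (a : nat -> bool) j : (forall k, a k.+1 -> a k) ->
  (\sum_(k < j) c k * (a k)%:R) ^+ 2 = \sum_(k < j) (L k.+1 ^+ 2 - L k ^+ 2) * (a k)%:R.
Proof.
move=> a_nincr; elim: j => [|j IH]; first by rewrite !big_ord0 expr0n.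
rewrite !big_ord_recr/=; case aj : (a j); last by rewrite !mulr0 !addr0.
have aT k : (k <= j)%N -> a k.
  move=> kj; rewrite -(subKn kj); elim: (j - k)%N => [|n IHn]; first by rewrite subn0.
  have [nj|nj] := ltnP n j; first by apply: a_nincr; rewrite subnSK.
  by move: IHn; rewrite subnS (eqP nj).
rewrite !mulr1.
have -> : \sum_(k < j) c k * (a k)%:R = L j.
  by apply: eq_bigr => k _; rewrite aT ?mulr1// ltnW.
have -> : \sum_(k < j) (L k.+1 ^+ 2 - L k ^+ 2) * (a k)%:R = L j ^+ 2.
  transitivity (\sum_(k < j) (L k.+1 ^+ 2 - L k ^+ 2)).
    by apply: eq_bigr => k _; rewrite aT ?mulr1// ltnW.
  rewrite -(big_mkord xpredT (fun k => L k.+1 ^+ 2 - L k ^+ 2)) telescope_sumr//.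
  by rewrite {2}/log_sum big_ord0 expr0n subr0.
by rewrite log_sumS [RHS]addrC subrK.
Qed.

End LogSums.

Section LogDefect.
Variable R : realType.

Lemma log_defect_le (P a b : R) : 0 < b -> b <= a -> a <= P ->
  log_defect P a <= log_defect P b.
Proof.
move=> b0 ba aP; have a0 := lt_le_trans b0 ba; have P0 := lt_le_trans a0 aP.
have q0 : 0 <= ln (P / a) by rewrite ln_ge0// ler_pdivlMr// mul1r.
have := log_sum_primitive b0 ba aP => -[+ _].
have : 0 <= (a - b) * ln (P / a) by rewrite mulr_ge0// subr_ge0.
rewrite /log_defect; lra.
Qed.

End LogDefect.

(** * The estimate on finitely many levels *)

Section LowerBound.
Variable R : realType.
Local Notation mu := (lebesgue2 R).
Local Notation B := (@unit_disc R).
Local Notation iB f := (mu.-integrable B (EFin \o f)).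
Local Notation i0 := (ord0 : 'I_2).
Local Notation i1 := (lift ord0 ord0 : 'I_2).
Local Notation leb_type := (g_sigma_algebraType R.-ocitv.-measurable).
Local Notation pi := (@pi R).
Implicit Types (f g u v w : R * R -> R) (phi psi chi : R * R -> R).

Let mB : measurable (B : set (leb_type * leb_type)).
Proof. exact: measurable_unit_disc. Qed.

Lemma ler_sqrt_sqr (x y : R) : x ^+ 2 <= y -> x <= Num.sqrt y.
Proof.
move=> xy; apply: le_trans (ler_norm x) _.
by rewrite -sqrtr_sqr ler_wsqrtr.
Qed.

Lemma is_derive_big (V : normedModType R) (n : nat) (F : nat -> V -> R)
    (dF : nat -> R) (x v : V) : (forall k, is_derive x v (F k) (dF k)) ->
  is_derive x v (fun y => \sum_(k < n) F k y) (\sum_(k < n) dF k).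
Proof.
move=> H; elim: n => [|n IH].
  under eq_fun do rewrite big_ord0.
  by rewrite big_ord0; exact: is_derive_cst.
under eq_fun do rewrite big_ord_recr.
by rewrite big_ord_recr; exact: is_deriveD.
Qed.

Lemma distrib_le_pi psi t : continuous psi -> distrib psi t <= pi.
Proof.
move=> cp; have -> : pi = \int[mu]_(z in B) 1.
  have E := unit_disc_measure R.
  by rewrite Rintegral_cst// mul1r [X in fine X]E.
apply: le_Rintegral => //.
- exact/L2_integrable/L2_superlevel.
- by apply/L2_integrable/L2_continuous; exact: cst_continuous.
- by move=> z _; case: (t < psi z); rewrite ?ler01.
Qed.

Section LevelEstimate.
Variables (S : R -> R) (kappa : R).
Hypotheses (sS : smooth1 S) (S0 : forall t, t <= 0 -> S t = 0)
  (S1 : forall t, 1 <= t -> kappa <= S t)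
  (dS : forall t, 0 <= S^`() t <= 1 /\ (~~ (0 < t < 1) -> S^`() t = 0))
  (S01 : forall t, 0 <= S t <= 1) (kappa0 : 0 <= kappa).
Variables (psi f d0 d1 : R * R -> R) (e h de : R) (N : nat).
Hypotheses (tpsi : test_function B psi) (Lf : L2 B f) (Ld0 : L2 B d0) (Ld1 : L2 B d1)
  (de_le : \int[mu]_(z in B) (d0 z ^+ 2) + \int[mu]_(z in B) (d1 z ^+ 2) <= e)
  (pde : forall chi, test_function B chi ->
    \int[mu]_(z in B) (f z * chi z) =
    \int[mu]_(z in B) ('D_(basis2 R i0) psi z * 'D_(basis2 R i0) chi z) +
    \int[mu]_(z in B) ('D_(basis2 R i1) psi z * 'D_(basis2 R i1) chi z) -
    (\int[mu]_(z in B) (d0 z * 'D_(basis2 R i0) chi z) +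
     \int[mu]_(z in B) (d1 z * 'D_(basis2 R i1) chi z)))
  (h0 : 0 < h) (de0 : 0 < de).

Let m (k : nat) : R := distrib psi (k%:R * h).
Hypothesis mN0 : 0 < m N.

Let spsi : smooth psi. Proof. exact: test_smooth. Qed.
Let cpsi : continuous psi. Proof. exact: test_continuous. Qed.

Let m_nincr k : m k.+1 <= m k.
Proof. by apply: distrib_nincr => //; rewrite ler_pM2r// ler_nat. Qed.

Let m_gt0 k : (k <= N)%N -> 0 < m k.
Proof.
move=> kN; apply: lt_le_trans mN0 _; apply: distrib_nincr => //.
by rewrite ler_pM2r// ler_nat.
Qed.

Let m_pi : m 0%N <= pi. Proof. exact: distrib_le_pi. Qed.

Let c := log_incr de m.
Let W (k : nat) := step_weight S h k psi.
Let dens := dirichlet_density psi.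
Let Ik (k : nat) : R := \int[mu]_(z in B) (W k z * dens z).
Let G : R := \int[mu]_(z in B) dens z.
Let F : R := \int[mu]_(z in B) (f z ^+ 2).
Let Z : R := (1 + de) * (1 + 2 * de) * log_defect pi (m N) + de ^+ 2 * pi.
(* The test function is [h * (sum of the normalized steps)]. *)
Let chi z : R := \sum_(k < N) (c k * h) * step_fun S h k psi z.
Let Y z : R := \sum_(k < N) c k * W k z.

Let cW k : continuous (W k). Proof. exact: continuous_step_weight. Qed.
Let cdens : continuous dens. Proof. exact: continuous_dirichlet_density. Qed.
Let W01 k z : 0 <= W k z <= 1. Proof. by case: (dS (h^-1 * psi z + - k%:R)). Qed.

Let IWd k : iB (fun z => W k z * dens z).
Proof. by apply: continuous_integrable_disc; exact: continuous_mul. Qed.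

(** Dividing the band inequality by [m k.+1] makes the relative decrease [c k] appear: every
    increment that is kept contributes at least [4 pi (h kappa) ^ 2], and [count_log_incr] bounds
    their number below. *)
Let band_sum : 4 * pi * (h * kappa) ^+ 2 * (N%:R - ln (pi / m N) / ln (1 + de)) <=
  \sum_(k < N) c k * Ik k.
Proof.
have := count_log_incr de0 m_gt0 m_nincr m_pi.
have A0 : 0 <= 4 * pi * (h * kappa) ^+ 2 by rewrite mulr_ge0 ?sqr_ge0// mulr_ge0 ?pi_ge0.
move=> /(ler_wpM2l A0) /le_trans; apply; rewrite mulr_sumr; apply: ler_sum => -[k kN] _ /=.
have := band_inequality sS S0 S1 dS S01 kappa0 k h0 tpsi.
rewrite -/(m k.+1) -/(m k) -/(Ik k) /c /log_incr.
have mk := m_gt0 kN.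
case: ifPn => [_ H|/negbTE H _] /=; last by rewrite mulr0 mul0r.
by rewrite mulr1 [leRHS]mulrAC ler_pdivlMr.
Qed.

Let sum_Ik : \sum_(k < N) c k * Ik k = \int[mu]_(z in B) (Y z * dens z).
Proof.
transitivity (\sum_(k < N) \int[mu]_(z in B) (c k * (W k z * dens z))).
  by apply: eq_bigr => k _; rewrite RintegralZl.
rewrite -(@Rintegral_sum _ _ _ _ _ mB N (fun k z => c k * (W k z * dens z))); last first.
  by move=> k; exact: R_integrableZ.
apply: eq_Rintegral => z _; rewrite /Y mulr_suml.
by apply: eq_bigr => k _; rewrite mulrA.
Qed.

Let derive_chi z i : 'D_(basis2 R i) chi z = Y z * 'D_(basis2 R i) psi z.
Proof.
have H k : is_derive z (basis2 R i) (fun z => (c k * h) * step_fun S h k psi z)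
    (c k * W k z * 'D_(basis2 R i) psi z).
  have := smooth_is_derive z i (test_smooth (test_step_fun sS S0 h k tpsi)).
  rewrite (derive_step_fun sS _ _ _ _ tpsi) => D.
  apply: is_derive_eq; rewrite /GRing.scale/= -/(W k z).
  rewrite -/(step_weight S h k psi z) -/(W k z); move: (W k z) ('D_ _ psi z) => a b.
  by field; rewrite gt_eqF.
have [_ ->] := is_derive_big N H.
by rewrite /Y mulr_suml.
Qed.

Let tchi : test_function B chi.
Proof.
have [_ cp pB] := tpsi; apply: (test_intro _ cp pB).
  apply: (@smooth_sum _ N (fun k z => c k * h * step_fun S h k psi z)) => k.
  apply: smoothM; first exact: smooth_cst.
  exact/test_smooth/test_step_fun.
move=> z nz; apply: big1 => k _; have := test_eq0 tpsi nz => pz.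
by rewrite /step_fun pz mulr0 add0r S0 ?mulr0// oppr_le0 ler0n.
Qed.

Let Y_bounds z : 0 <= Y z <= N%:R * de.
Proof.
have H (k : 'I_N) : 0 <= c k * W k z <= de.
  have /andP[c0 cd] := log_incr_bounds de0 m_gt0 m_nincr (ltn_ord k).
  have /andP[w0 w1] := W01 k z.
  by rewrite mulr_ge0//= -[leRHS]mulr1 ler_pM.
rewrite sumr_ge0; last by move=> k _; case/andP: (H k).
rewrite /= mulr_natl -[X in _ *+ X]card_ord -sumr_const.
by apply: ler_sum => k _; case/andP: (H k).
Qed.

(** Each ramp is at most the indicator of [psi > k h]. Hence [chi ^ 2] is at most the square of a
    sum over an initial segment of levels, which [sqr_sum_nincr] linearizes and [log_sum_sqr_le]
    estimates after integration. *)
Let main_term : \int[mu]_(z in B) (f z * chi z) <= h * Num.sqrt (F * Z).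
Proof.
have Lchi := test_L2 tchi.
rewrite -[X in X * Num.sqrt _](ger0_norm (ltW h0)) -sqrtr_sqr -sqrtrM ?sqr_ge0//.
apply/ler_sqrt_sqr/(le_trans (cauchy_schwarz Lf Lchi)).
rewrite -/F mulrCA ler_wpM2l//; first by apply: Rintegral_ge0 => z _; exact: sqr_ge0.
pose L := log_sum de m.
apply: (@le_trans _ _ (h ^+ 2 * \sum_(k < N) (L k.+1 ^+ 2 - L k ^+ 2) * m k)); last first.
  rewrite ler_wpM2l ?sqr_ge0//; exact: log_sum_sqr_le m_pi.
have Isup k : iB (fun z => (k%:R * h < psi z)%R%:R) by exact/L2_integrable/L2_superlevel.
rewrite mulr_sumr.
have -> : \sum_(k < N) h ^+ 2 * ((L k.+1 ^+ 2 - L k ^+ 2) * m k) =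
    \int[mu]_(z in B) (\sum_(k < N) (h ^+ 2 * (L k.+1 ^+ 2 - L k ^+ 2)) * (k%:R * h < psi z)%R%:R).
  rewrite (@Rintegral_sum _ _ _ _ _ mB N (fun k z => (h ^+ 2 * (L k.+1 ^+ 2 - L k ^+ 2)) *
    (k%:R * h < psi z)%R%:R)); last by move=> k; exact: R_integrableZ.
  by apply: eq_bigr => k _; rewrite RintegralZl// mulrA.
apply: le_Rintegral => //; first exact: L2_integrable_sqr.
  apply: (@R_integrable_sum _ _ _ _ _ mB N (fun k z => (h ^+ 2 * (L k.+1 ^+ 2 - L k ^+ 2)) *
    (k%:R * h < psi z)%R%:R)) => k.
  exact: R_integrableZ.
move=> z _.
have a_nincr k : (k.+1%:R * h < psi z)%R -> (k%:R * h < psi z)%R.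
  by apply: le_lt_trans; rewrite ler_pM2r// ler_nat.
have := sqr_sum_nincr de m N a_nincr => E.
under eq_bigr do rewrite -mulrA.
rewrite -mulr_sumr -E -exprMn lerXn2r ?nnegrE//.
- apply: sumr_ge0 => k _; rewrite !mulr_ge0// ?(ltW h0)//.
    by case/andP: (log_incr_bounds de0 m_gt0 m_nincr (ltn_ord k)).
  by case/andP: (S01 (h^-1 * psi z + - k%:R)).
- rewrite mulr_ge0 ?(ltW h0)//; apply: sumr_ge0 => k _; rewrite mulr_ge0//.
  by case/andP: (log_incr_bounds de0 m_gt0 m_nincr (ltn_ord k)).
rewrite mulr_sumr; apply: ler_sum => k _.
have /andP[c0 _] := log_incr_bounds de0 m_gt0 m_nincr (ltn_ord k).
rewrite -mulrA mulrCA ler_wpM2l// ?(ltW h0)// ler_wpM2l//.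
have /andP[s0 s1] := S01 (h^-1 * psi z + - k%:R).
case: (ltP (k%:R * h) (psi z)) => [_|H] //=.
by rewrite /step_fun S0// subr_le0 mulrC ler_pdivrMr.
Qed.

(** The gradient of [chi] is [Y] times that of [psi], with [Y] at most [N de]. This crude factor is
    harmless because [e] tends to 0 while [N] is fixed. *)
Let error_term : \int[mu]_(z in B) (d0 z * 'D_(basis2 R i0) chi z) +
  \int[mu]_(z in B) (d1 z * 'D_(basis2 R i1) chi z) <= N%:R * de * Num.sqrt (e * G).
Proof.
have LD i : L2 B (fun z => 'D_(basis2 R i) chi z) by exact/test_L2/test_derive.
have Nde : 0 <= N%:R * de by rewrite mulr_ge0 ?ler0n// ltW.
have sq0 g : 0 <= \int[mu]_(z in B) (g z ^+ 2) by apply: Rintegral_ge0 => z _; exact: sqr_ge0.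
rewrite -[X in X * Num.sqrt _](ger0_norm Nde) -sqrtr_sqr -sqrtrM ?sqr_ge0//.
apply/ler_sqrt_sqr/(le_trans (cauchy_schwarz2 Ld0 Ld1 (LD i0) (LD i1))).
rewrite mulrCA; apply: ler_pM => //; rewrite ?addr_ge0 ?sq0//.
rewrite -RintegralD//; [|exact/L2_integrable_sqr/LD..].
rewrite -RintegralZl//; last exact: continuous_integrable_disc.
apply: le_Rintegral => //.
- by apply: R_integrableD => //; exact/L2_integrable_sqr/LD.
- by apply: R_integrableZ => //; exact: continuous_integrable_disc.
move=> z _; have /andP[Y0 YN] := Y_bounds z.
rewrite (derive_chi z i0) (derive_chi z i1) !exprMn -mulrDr ler_wpM2r//.
  by rewrite addr_ge0 ?sqr_ge0.
by rewrite -exprMn lerXn2r ?nnegrE.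
Qed.

(** The equation tested with [chi]: its Dirichlet term is the weighted sum bounded in [band_sum].
    Every loss is explicit, which prepares the three limits. *)
Lemma level_estimate :
  4 * pi * (h * kappa) ^+ 2 * (N%:R - ln (pi / m N) / ln (1 + de)) <=
  h * Num.sqrt (F * Z) + N%:R * de * Num.sqrt (e * G).
Proof.
apply: (le_trans band_sum); rewrite sum_Ik.
have -> : \int[mu]_(z in B) (Y z * dens z) = \int[mu]_(z in B) (f z * chi z) +
    (\int[mu]_(z in B) (d0 z * 'D_(basis2 R i0) chi z) +
     \int[mu]_(z in B) (d1 z * 'D_(basis2 R i1) chi z)).
  rewrite (pde tchi) subrK.
  have LD i : L2 B (fun z => 'D_(basis2 R i) chi z) by exact/test_L2/test_derive.
  have LP i : L2 B (fun z => 'D_(basis2 R i) psi z) by exact/test_L2/test_derive.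
  have J i := L2_mul (LP i) (LD i).
  rewrite -(RintegralD mB (J i0) (J i1)); apply: eq_Rintegral => z _.
  by rewrite (derive_chi z i0) (derive_chi z i1) /dens /dirichlet_density; ring.
by apply: lerD; [exact: main_term|exact: error_term].
Qed.

(** The equation is tested with [psi] itself; the error is at most [sqrt (e G) <= (e + G) / 2], and
    half of [G] is absorbed on the left. This keeps [G] bounded as [psi] varies with [e]. *)
Lemma gradient_estimate :
  G <= 2 * Num.sqrt (F * \int[mu]_(z in B) (psi z ^+ 2)) + e.
Proof.
have Lp := test_L2 tpsi.
have LP i : L2 B (fun z => 'D_(basis2 R i) psi z) by exact/test_L2/test_derive.
have I2 i := L2_integrable_sqr (LP i).
have GE : G = \int[mu]_(z in B) ('D_(basis2 R i0) psi z ^+ 2) +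
    \int[mu]_(z in B) ('D_(basis2 R i1) psi z ^+ 2).
  by rewrite -(RintegralD mB (I2 i0) (I2 i1)).
pose E := \int[mu]_(z in B) (d0 z * 'D_(basis2 R i0) psi z) +
  \int[mu]_(z in B) (d1 z * 'D_(basis2 R i1) psi z).
have H : \int[mu]_(z in B) (f z * psi z) = G - E.
  rewrite GE; exact: (pde tpsi).
have EG : E ^+ 2 <= e * G.
  apply: le_trans (cauchy_schwarz2 Ld0 Ld1 (LP i0) (LP i1)) _.
  by rewrite -GE ler_wpM2r//; apply: Rintegral_ge0 => z _; rewrite addr_ge0 ?sqr_ge0.
have A := ler_sqrt_sqr (cauchy_schwarz Lf Lp); rewrite -/F H in A.
have e0 : 0 <= e.
  by apply: le_trans de_le; rewrite addr_ge0//; apply: Rintegral_ge0 => z _; exact: sqr_ge0.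
have G0 : 0 <= G by apply: Rintegral_ge0 => z _; rewrite addr_ge0 ?sqr_ge0.
clear H GE; move: A EG; move: (Num.sqrt _) (E) (G) e0 G0 => q E' g e0 g0 A EG.
have : E' <= (e + g) / 2.
  apply: le_trans (ler_norm E') _; rewrite -(@ler_pXn2r _ 2) ?nnegrE//; last by lra.
  rewrite real_normK ?num_real//; have := sqr_ge0 (e - g); nra.
lra.
Qed.

End LevelEstimate.

End LowerBound.

(** * Passage to the limit in the lower bound *)

Section EnergyBound.
Variable R : realType.
Local Notation mu := (lebesgue2 R).
Local Notation B := (@unit_disc R).
Local Notation iB f := (mu.-integrable B (EFin \o f)).
Local Notation i0 := (ord0 : 'I_2).
Local Notation i1 := (lift ord0 ord0 : 'I_2).
Local Notation leb_type := (g_sigma_algebraType R.-ocitv.-measurable).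
Local Notation pi := (@pi R).
Implicit Types (f g u v w : R * R -> R) (phi psi chi : R * R -> R).

Let mB : measurable (B : set (leb_type * leb_type)).
Proof. exact: measurable_unit_disc. Qed.

Lemma le_linear (x y M : R) : (forall t, 0 < t < 1 -> x <= y + t * M) -> x <= y.
Proof.
move=> H; apply/ler_addgt0Pr => e e0.
have M0 : 0 < `|M| + 1 + e by have := normr_ge0 M; lra.
(* The summand [e] in the denominator keeps this value of [t] below 1. *)
have := H (e / (`|M| + 1 + e)); rewrite divr_gt0// ltr_pdivrMr// mul1r.
have e1 : e < `|M| + 1 + e by have := normr_ge0 M; lra.
move=> /(_ e1) /le_trans; apply; rewrite lerD2l mulrAC ler_pdivrMr//.
by rewrite ler_pM2l//; have := ler_norm M; lra.
Qed.

Lemma le_sqrt_error (x y D G e1 : R) : 0 < e1 -> 0 <= D -> 0 <= G ->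
  (forall e, 0 < e -> e <= e1 -> x <= y + D * Num.sqrt (e * G)) -> x <= y.
Proof.
move=> e10 D0 G0 H; apply/ler_addgt0Pr => d d0.
have D1 : 0 < D + 1 by lra.
have G1 : 0 < G + 1 by lra.
pose q := d / (D + 1).
have q0 : 0 < q by rewrite divr_gt0.
pose e := Num.min e1 (q ^+ 2 / (G + 1)).
have e0 : 0 < e by rewrite lt_min e10 divr_gt0// exprn_gt0.
apply: le_trans (H e e0 _) _; first by rewrite ge_min lexx.
rewrite lerD2l; apply: (@le_trans _ _ (D * q)).
  rewrite ler_wpM2l// -(ger0_norm (ltW q0)) -sqrtr_sqr ler_wsqrtr//.
  apply: (@le_trans _ _ (q ^+ 2 / (G + 1) * G)).
    by rewrite ler_wpM2r// ge_min lexx orbT.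
  by rewrite mulrAC ler_pdivrMr// ler_wpM2l ?sqr_ge0//; lra.
by rewrite /q mulrA ler_pdivrMr// mulrC ler_wpM2l// ?ltW//; lra.
Qed.

Lemma nonpos_area u : measurable_fun B u ->
  iB (fun z => (u z <= 0)%R%:R) /\
  mu (B `&` [set x | 0 < u x]) = (pi - \int[mu]_(z in B) (u z <= 0)%R%:R)%:E.
Proof.
move=> mu_; set P := (_ `&` _).
have mP : measurable (P : set (leb_type * leb_type)).
  have -> : P = B `&` u @^-1` `]0, +oo[.
    by congr (_ `&` _); apply/seteqP; split => z /=; rewrite in_itv/= andbT.
  by apply: mu_ => //; exact: measurable_itv.
have I1 : iB (fun=> 1) by apply/L2_integrable/L2_continuous; exact: cst_continuous.
have IP : iB (fun z => \1_P z : R).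
  apply: L2_integrable; apply: (@L2_bounded _ _ 1).
    exact: measurable_indic.
  by move=> z _; rewrite indicE; case: (_ \in _); rewrite ?normr1 ?normr0.
have E z : B z -> (u z <= 0)%R%:R = 1 - \1_P z :> R.
  move=> Bz; rewrite indicE; case: leP => uz.
    by rewrite (memNset _) ?subr0// => -[_ /=]; rewrite ltNge uz.
  by rewrite mem_set ?subrr.
have I2 := R_integrableB mB I1 IP.
split.
  by apply: eq_integrable I2 => // z /set_mem Bz /=; rewrite E.
have -> : \int[mu]_(z in B) (u z <= 0)%R%:R = \int[mu]_(z in B) (1 - \1_P z).
  by apply: eq_Rintegral => z /set_mem; exact: E.
have Epi := unit_disc_measure R.
rewrite (RintegralB mB I1 IP) Rintegral_cst// mul1r [X in fine X]Epi subKr.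
rewrite -(integral_EFin mB IP).
have -> : (\int[mu]_(z in B) (\1_P z)%:E)%E = mu (P `&` B) by exact: integral_indic.
by congr (mu _); rewrite /P setIAC setIid.
Qed.

Lemma sqr_le_double (x y : R) : y ^+ 2 <= 2 * (x + y) ^+ 2 + 2 * x ^+ 2.
Proof. by have := sqr_ge0 (2 * x + y); nra. Qed.

(** The logarithm of [1 - t] is negative and enters with a favourable sign; after dropping it only
    terms linear in [t] remain. *)
Lemma log_defect_scale (P a t : R) : 0 < a -> a <= P -> 0 < t < 1 ->
  log_defect P ((1 - t) * a) <= log_defect P a + t * (2 * a * (1 + ln (P / a))).
Proof.
move=> a0 aP /andP[t0 t1]; have P0 := lt_le_trans a0 aP.
have t1' : 0 < 1 - t by lra.
rewrite /log_defect.
have -> : P / ((1 - t) * a) = P / a * (1 - t)^-1 by rewrite invfM mulrA mulrAC.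
rewrite lnM ?posrE ?divr_gt0 ?invr_gt0// lnV ?posrE//.
have := ln_le_subr1 t1'; move: (ln (1 - t)) (ln (P / a)) => l q lt.
have : a * (1 - t) * l <= 0 by apply: mulr_ge0_le0; [rewrite mulr_ge0 ?ltW|lra].
by nra.
Qed.

Section DistribEstimate.
Variables (C t : R) (u : R * R -> R).
Hypotheses (C0 : 0 < C) (uC : admissible B C u) (t01 : 0 < t < 1).
Let a : R := \int[mu]_(z in B) (u z <= 0)%R%:R.
Hypothesis a0 : 0 < a.
Let F : R := \int[mu]_(z in B) (weak_laplacian B u z ^+ 2).
Let K : R := \int[mu]_(z in B) ((u z - C) ^+ 2).
Let m1 := (1 - t) * a.
Let G1 : R := 2 * Num.sqrt (F * (2 + 2 * K)) + 1.
Let Z1 : R := (1 + t) * (1 + 2 * t) * log_defect pi m1 + t ^+ 2 * pi.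
Let L : R := ln (pi / m1) / ln (1 + t).

Let sq0 f : 0 <= \int[mu]_(z in B) (f z ^+ 2).
Proof. by apply: Rintegral_ge0 => z _; exact: sqr_ge0. Qed.

Let Lu : L2 B u. Proof. exact: uC.1.1. Qed.
Let LuC : L2 B (fun z => u z - C).
Proof. by apply: L2B => //; apply: L2_continuous; exact: cst_continuous. Qed.
Let Ia := (nonpos_area Lu.1).1.

(** Chebyshev's inequality: where [u <= 0] and yet [psi <= (1 - t) C], the function [u - C + psi] is
    at most [- t C], so this set has measure at most [e / (t C) ^ 2 <= t a]. *)
Lemma distrib_approx psi (e : R) : test_function B psi ->
  \int[mu]_(z in B) ((u z - C + psi z) ^+ 2) <= e -> e <= t * a * (t * C) ^+ 2 ->
  m1 <= distrib psi ((1 - t) * C).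
Proof.
move=> tpsi He et; have /andP[t0 t1] := t01.
have tC : 0 < (t * C) ^+ 2 by rewrite exprn_gt0// mulr_gt0.
have Lup : L2 B (fun z => u z - C + psi z) by apply: L2D => //; exact: test_L2.
have cp := test_continuous tpsi.
have I1 := L2_integrable_sqr Lup.
have I2 := L2_integrable (L2_superlevel ((1 - t) * C) cp).
have I3 := R_integrableZ mB ((t * C) ^+ 2)^-1 I1.
have H : a <= distrib psi ((1 - t) * C) +
    ((t * C) ^+ 2)^-1 * \int[mu]_(z in B) ((u z - C + psi z) ^+ 2).
  rewrite -(RintegralZl _ mB I1) /distrib -(RintegralD mB I2 I3).
  apply: le_Rintegral => //; first exact: R_integrableD.
  move=> z _; case: (leP (u z) 0) => uz; last first.
    by rewrite addr_ge0// mulr_ge0 ?sqr_ge0// invr_ge0 ltW.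
  case: (ltP ((1 - t) * C) (psi z)) => pz; last first.
    rewrite add0r mulrC ler_pdivlMr// mul1r -(sqrrN (u z - C + psi z)).
    have tC0 := mulr_gt0 t0 C0.
    by rewrite lerXn2r ?nnegrE//; nra.
  by rewrite lerDl mulr_ge0 ?sqr_ge0// invr_ge0 ltW.
have : ((t * C) ^+ 2)^-1 * \int[mu]_(z in B) ((u z - C + psi z) ^+ 2) <= t * a.
  by rewrite mulrC ler_pdivrMr//; exact: le_trans He et.
by move: H; rewrite /m1; lra.
Qed.

(** The parameter [t] plays four roles: the ramps reach [1 - t], the top level is [(1 - t) C], the
    area there is at least [(1 - t) a], and increments above [t] are discarded. The first two
    produce [(1 - t) ^ 3 C] before squaring, hence the exponent 6. *)
Lemma distrib_estimate :
  16 * pi ^+ 2 * ((1 - t) ^+ 6 * C ^+ 2) <= F * Z1.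
Proof.
have /andP[t0 t1] := t01.
have k1 : 1 - t < 1 by lra.
have k0 : 0 <= 1 - t by lra.
have tt : 0 < (1 + t) * (1 + 2 * t) by rewrite mulr_gt0//; lra.
have [S [sS S0 S1 dS S01]] := smooth_step k1.
have C'0 : 0 < (1 - t) * C by rewrite mulr_gt0//; lra.
have m10 : 0 < m1 by rewrite mulr_gt0//; lra.
have LF := L2_weak_laplacian uC.1.
have F0 : 0 <= F by exact: sq0.
have K0 : 0 <= K by exact: sq0.
have G10 : 0 <= G1 by rewrite addr_ge0// mulr_ge0 ?sqrtr_ge0.
have ln1 : 0 < ln (1 + t) by rewrite ln_gt0// ltrDl.
have main (N : nat) (e : R) : (0 < N)%N -> 0 < e ->
    e <= Num.min 1 (t * a * (t * C) ^+ 2) ->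
    4 * pi * ((1 - t) * C / N%:R * (1 - t)) ^+ 2 * (N%:R - L) <=
    (1 - t) * C / N%:R * Num.sqrt (F * Z1) + N%:R * t * Num.sqrt (e * G1).
  move=> N0 e0; rewrite le_min => /andP[e1 et].
  have [psi [d0 [d1 [tpsi [Ld0 Ld1] He Hu pde]]]] := admissible_approx uC e0.
  have NR : 0 < N%:R :> R by rewrite ltr0n.
  (* With this width the last of the [N] levels is [(1 - t) C], where [distrib_approx] applies. *)
  set h := (1 - t) * C / N%:R.
  have h0 : 0 < h by rewrite divr_gt0.
  have hN : N%:R * h = (1 - t) * C by rewrite /h mulrC divfK ?gt_eqF.
  have mm := distrib_approx tpsi Hu et; rewrite -hN in mm.
  have m0 := lt_le_trans m10 mm.
  have cp := test_continuous tpsi.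
  have mpi := distrib_le_pi (N%:R * h) cp.
  have LE := level_estimate sS S0 S1 dS S01 k0 tpsi LF Ld0 Ld1 He pde h0 t0 m0.
  have GE := gradient_estimate tpsi LF Ld0 Ld1 He pde.
  (* As [e <= 1], the norm of [psi] is controlled by that of [u - C]; so the Dirichlet integral is
     at most [G1], which depends neither on [psi] nor on [N]. *)
  have pK : \int[mu]_(z in B) (psi z ^+ 2) <= 2 + 2 * K.
    have Lp := test_L2 tpsi.
    have Lup : L2 B (fun z => u z - C + psi z) by exact: L2D.
    have I1 := R_integrableZ mB 2 (L2_integrable_sqr Lup).
    have I2 := R_integrableZ mB 2 (L2_integrable_sqr LuC).
    have : \int[mu]_(z in B) (psi z ^+ 2) <=
        2 * \int[mu]_(z in B) ((u z - C + psi z) ^+ 2) + 2 * K.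
      rewrite -(RintegralZl _ mB (L2_integrable_sqr Lup)).
      rewrite -(RintegralZl _ mB (L2_integrable_sqr LuC)) -(RintegralD mB I1 I2).
      apply: le_Rintegral => //; [exact: L2_integrable_sqr|exact: R_integrableD|].
      move=> z _; exact: sqr_le_double.
    move=> /le_trans; apply; rewrite lerD2r -[leRHS]mulr1 ler_pM2l//.
    exact: le_trans Hu e1.
  apply: le_trans (le_trans LE _).
    apply: ler_wpM2l; first by rewrite mulr_ge0 ?sqr_ge0// mulr_ge0 ?pi_ge0.
    rewrite lerD2l lerN2 /L ler_pM2r ?invr_gt0// ler_ln ?posrE ?divr_gt0 ?pi_gt0//.
    by rewrite ler_pM2l ?pi_gt0// lef_pV2.
  apply: lerD.
    rewrite ler_pM2l// ler_wsqrtr// ler_wpM2l// /Z1 lerD2r ler_pM2l//.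
    exact: log_defect_le.
  rewrite ler_wpM2l ?mulr_ge0// ?(ltW t0)// ler_wsqrtr// ler_pM2l//.
  apply: le_trans GE _; rewrite /G1 lerD// ler_pM2l// ler_wsqrtr// ler_wpM2l//.
(* First limit: [e] tends to 0 with [N] fixed, which removes the error term. *)
have bnd (N : nat) : (0 < N)%N ->
    4 * pi * ((1 - t) * C / N%:R * (1 - t)) ^+ 2 * (N%:R - L) <=
    (1 - t) * C / N%:R * Num.sqrt (F * Z1).
  move=> N0; pose e1 := Num.min 1 (t * a * (t * C) ^+ 2).
  have e10 : 0 < e1.
    by rewrite lt_min ltr01 /=; apply: mulr_gt0; [exact: mulr_gt0|rewrite exprn_gt0// mulr_gt0].
  apply: (@le_sqrt_error _ _ (N%:R * t) G1 e1) => //; first by rewrite mulr_ge0// ltW.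
  by move=> e e0 ee; exact: main.
(* Second limit: after division by [(1 - t) C / N] the estimate reads [x - x L / N <= y], where [L],
   the bound for the number of discarded increments, does not depend on [N]. *)
have lim : 4 * pi * ((1 - t) ^+ 3 * C) <= Num.sqrt (F * Z1).
  set x := (4 * pi * _); set y := Num.sqrt _.
  apply/ler_addgt0Pr => d d0.
  have := archi_boundP (normr_ge0 (x * L / d)).
  set N := Num.bound _ => HN.
  have N0 : (0 < N)%N by rewrite -(ltr0n R); exact: le_lt_trans HN.
  have NR : 0 < N%:R :> R by rewrite ltr0n.
  have := bnd N N0; rewrite -/y.
  have -> : 4 * pi * ((1 - t) * C / N%:R * (1 - t)) ^+ 2 * (N%:R - L) =
      (1 - t) * C / N%:R * (x - x * L / N%:R).
    rewrite /x; move: pi => q; move: (L) => L'; field; rewrite gt_eqF//.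
  rewrite ler_pM2l ?divr_gt0// lerBlDr => /le_trans; apply.
  rewrite lerD2l ler_pdivrMr// [leRHS]mulrC -ler_pdivrMr//.
  by apply: ltW; apply: le_lt_trans HN; exact: ler_norm.
have Z0 : 0 <= 4 * pi * ((1 - t) ^+ 3 * C).
  by rewrite mulr_ge0 ?mulr_ge0 ?pi_ge0 ?exprn_ge0// ltW.
have [FZ|FZ] := leP 0 (F * Z1); last first.
  move: lim; rewrite ler0_sqrtr ?(ltW FZ)// => H.
  have : 0 < 4 * pi * ((1 - t) ^+ 3 * C).
    by rewrite mulr_gt0 ?mulr_gt0 ?pi_gt0 ?exprn_gt0//; lra.
  by lra.
have := lim; rewrite -(@ler_pXn2r _ 2) ?nnegrE ?sqrtr_ge0// sqr_sqrtr// => /(le_trans _); apply.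
by rewrite le_eqVlt; apply/orP; left; apply/eqP; move: pi => q; ring.
Qed.

End DistribEstimate.

Theorem laplacian_lower_bound (C : R) u : 0 < C -> admissible B C u ->
  0 < \int[mu]_(z in B) (u z <= 0)%R%:R ->
  16 * pi ^+ 2 * C ^+ 2 <= \int[mu]_(z in B) (weak_laplacian B u z ^+ 2) *
    log_defect pi (\int[mu]_(z in B) (u z <= 0)%R%:R).
Proof.
move=> C0 uC; have H t := @distrib_estimate C t u C0 uC.
have F0 : 0 <= \int[mu]_(z in B) (weak_laplacian B u z ^+ 2).
  by apply: Rintegral_ge0 => z _; exact: sqr_ge0.
have [Ia /esym E] := nonpos_area uC.1.1.1.
set a := \int[mu]_(z in B) (u z <= 0)%R%:R in E H *.
set F := \int[mu]_(z in B) _ in F0 H *.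
have : (0 <= (pi - a)%:E)%E by rewrite E; exact: measure_ge0.
rewrite lee_fin subr_ge0.
clear E Ia; move: (pi_gt0 R) H F0; move: pi (a) (F) => p {}a {}F p0 H F0 ap a0.
have q0 : 0 <= ln (p / a) by rewrite ln_ge0// ler_pdivlMr// mul1r.
have D0 : 0 <= log_defect p a.
  have := log_defect_le a0 ap (lexx p).
  by rewrite {1}/log_defect divff ?gt_eqF// ln1; lra.
pose T := 2 * a * (1 + ln (p / a)).
have T0 : 0 <= T by rewrite mulr_ge0// ?mulr_ge0// ?ltW//; lra.
set D := log_defect p a in D0 *.
(* Third limit: [t] tends to 0. The constant collects [(1 + t) (1 + 2 t) <= 1 + 5 t], the linear
   growth of the defect, and [(1 - t) ^ 6 >= 1 - 6 t], whose 6 multiplied by 16 gives 96. *)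
apply: (@le_linear _ _ (F * (6 * T + 5 * D + p) + 96 * p ^+ 2 * C ^+ 2)) => t t01.
have := H t t01 a0; have := log_defect_scale a0 ap t01; have /andP[t0 t1] := t01.
rewrite -/T -/D; move: (log_defect _ _) => D' DT HF.
have Z : (1 + t) * (1 + 2 * t) * D' + t ^+ 2 * p <= D + t * (6 * T + 5 * D + p).
  apply: (@le_trans _ _ ((1 + 5 * t) * (D + t * T) + t * p)).
    apply: lerD; last by rewrite ler_pM2r//; nra.
    apply: (@le_trans _ _ ((1 + t) * (1 + 2 * t) * (D + t * T))).
      by rewrite ler_wpM2l//; nra.
    by rewrite ler_wpM2r//; nra.
  have : 0 <= t * T * (1 - t) by apply: mulr_ge0; [apply: mulr_ge0 => //; exact: ltW|rewrite subr_ge0 ltW].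
  by lra.
have B6 : 1 - 6 * t <= (1 - t) ^+ 6.
  have t1' : 0 <= 1 - t by lra.
  elim: 6%N => [|n IH]; first by rewrite mul0r subr0.
  rewrite exprS; apply: le_trans (ler_wpM2l t1' IH).
  by rewrite -natr1; have := mulr_ge0 (ler0n R n) (sqr_ge0 t); nra.
have := le_trans HF (ler_wpM2l F0 Z).
have P0 : 0 <= 16 * p ^+ 2 * C ^+ 2.
  by apply: mulr_ge0; [apply: mulr_ge0 => //|]; exact: sqr_ge0.
have := ler_wpM2l P0 B6.
move: (_ ^+ 6) (6 * T + 5 * D + p) => X Y; lra.
Qed.

End EnergyBound.

(** * Uniqueness of weak derivatives and radial competitors *)

Section FundamentalLemma.
Variable R : realType.
Local Notation mu := (lebesgue2 R).
Local Notation B := (@unit_disc R).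
Local Notation iB f := (mu.-integrable B (EFin \o f)).
Local Notation leb_type := (g_sigma_algebraType R.-ocitv.-measurable).
Implicit Types (d f g u v w : R * R -> R) (phi psi chi : R * R -> R).

Let mB : measurable (B : set (leb_type * leb_type)).
Proof. exact: measurable_unit_disc. Qed.

Lemma compact_disc (b : R) : compact [set z : R * R | normsq z <= b].
Proof.
have [b0|b0] := ltP b 0.
  rewrite (_ : [set _ | _] = set0); first exact: compact0.
  apply/seteqP; split=> // z /= zb; have := le_lt_trans zb b0.
  by rewrite /normsq ltNge addr_ge0 ?sqr_ge0.
have [s sE] : exists s, s = Num.sqrt b by exists (Num.sqrt b).
apply: (@subclosed_compact _ _ (`[(- s)%R, s] `*` `[(- s)%R, s])).
- have -> : [set z : R * R | normsq z <= b] = @normsq R @^-1` [set t | t <= b] by [].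
  by apply: closed_comp; [move=> z _; exact: continuous_normsq|exact: closed_le].
- by apply: compact_setX; exact: segment_compact.
- move=> [x y]; rewrite /= /normsq/= => xy.
  have H (r : R) : r ^+ 2 <= b -> r \in `[- s, s]%R.
    by rewrite in_itv/= -ler_norml sE => rb; rewrite -sqrtr_sqr ler_wsqrtr.
  by split=> /=; apply: H; have := sqr_ge0 x; have := sqr_ge0 y; nra.
Qed.

Lemma disc_test f (b : R) : b < 1 -> smooth f ->
  (forall z, b < normsq z -> f z = 0) -> test_function B f.
Proof.
move=> b1 sf f0; apply: (test_intro sf (@compact_disc b)).
  by move=> z zb; rewrite unit_discE /=; exact: le_lt_trans zb b1.
by move=> z /negP; rewrite -ltNge; exact: f0.
Qed.

Section NullSets.
Variable d : R * R -> R.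
Hypothesis Id : iB d.
Let N (E : set (leb_type * leb_type)) := \int[mu]_(z in B) (d z * \1_E z) = 0.

Let md : measurable_fun B d.
Proof. by have := measurable_int _ Id; move/measurable_EFinP. Qed.

Let mdE (E : set (leb_type * leb_type)) : measurable E ->
  measurable_fun B (fun z => d z * \1_E z).
Proof. by move=> mE; apply: measurable_funM => //; exact: measurable_indic. Qed.

Let dE_le (E : set (leb_type * leb_type)) z : `|d z * \1_E z| <= `|d z|.
Proof.
rewrite indicE; case: (_ \in _); rewrite ?mulr1// mulr0 normr0//.
Qed.

Let IdE (E : set (leb_type * leb_type)) : measurable E -> iB (fun z => d z * \1_E z).
Proof.
move=> mE; apply: (le_integrable mB _ _ Id).
  by apply/measurable_EFinP; exact: mdE.
by move=> z _ /=; rewrite lee_fin.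
Qed.

Let N_diff (X E : set (leb_type * leb_type)) : measurable X -> measurable E ->
  N X -> N (X `&` E) -> N (X `&` ~` E).
Proof.
move=> mX mE NX NXE; have mXE := measurableI _ _ mX mE.
rewrite /N; transitivity (\int[mu]_(z in B) (d z * \1_X z - d z * \1_(X `&` E) z)).
  apply: eq_Rintegral => z _; rewrite -mulrBr; congr (_ * _).
  rewrite !indicE !in_setI in_setC.
  by case: (z \in X); case: (z \in E); rewrite /= ?subr0 ?subrr.
by rewrite (RintegralB mB (IdE mX) (IdE mXE)) NX NXE subrr.
Qed.

Let N_bigcup (F : nat -> set (leb_type * leb_type)) : (forall n, measurable (F n)) ->
  trivIset setT F -> (forall n, N (F n)) -> N (\bigcup_n F n).
Proof.
move=> mF tF NF; pose U n := \big[setU/set0]_(i < n) F i.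
have mU n : measurable (U n) by exact: bigsetU_measurable.
have NU n : N (U n).
  elim: n => [|n IH].
    by rewrite /N; apply: Rintegral_eq0 => z _; rewrite /U big_ord0 indic0 mulr0.
  rewrite /N; transitivity (\int[mu]_(z in B) (d z * \1_(U n) z + d z * \1_(F n) z)).
    apply: eq_Rintegral => z _; rewrite -mulrDr; congr (_ * _).
    rewrite /U big_ord_recr /= -/(U n) !indicE in_setU.
    case: (boolP (z \in U n)) => zU; case: (boolP (z \in F n)) => zF //=; rewrite ?addr0 ?add0r//.
    exfalso; move: zU zF; rewrite !inE /U -bigcup_mkord => -[i /= ni Fi] Fn.
    by have := tF i n I I (ex_intro _ z (conj Fi Fn)) => E; move: ni; rewrite E ltnn.
  by rewrite (RintegralD mB (IdE (mU n)) (IdE (mF n))) IH NF addr0.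
have [|||_] := @R_dominated _ _ _ mu _ mB (fun n z => d z * \1_(U n) z)
  (fun z => d z * \1_(\bigcup_n F n) z) (fun z => `|d z|) (fun n => mdE (mU n)); last 1 first.
- move=> H; apply/esym/(cvg_unique _ _ H); first exact: norm_hausdorff.
  by apply: cvg_near_cst; near=> n; exact: NU.
- move=> z _; apply: cvgM; first exact: cvg_cst.
  have [[n _ Fn]|nF] := pselect ((\bigcup_n F n) z).
    apply: cvg_near_cst; near=> m.
    rewrite !indicE !mem_set//; first by exists n.
    by rewrite /U -bigcup_mkord; exists n => //=; near: m; exact: nbhs_infty_gt.
  apply: cvg_near_cst; near=> m.
  rewrite !indicE !memNset//.
  by rewrite /U -bigcup_mkord => -[i _ Fi]; apply: nF; exists i.
- by have := integrable_abse Id.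
- by move=> n z _; exact: dE_le.
Unshelve. all: by end_near. Qed.

(** The pi-lambda argument for preimages under one map, relative to a fixed set [X]; this allows the
    coordinates to be treated one after the other. *)
Let N_dynkin disp (T : measurableType disp) (G : set (set T)) (X : set (leb_type * leb_type))
    (f : leb_type * leb_type -> T) :
  measurable = <<s G>> -> setI_closed G -> measurable_fun setT f -> measurable X ->
  N X -> (forall A, G A -> N (X `&` f @^-1` A)) ->
  forall A, measurable A -> N (X `&` f @^-1` A).
Proof.
move=> GE GI mf mX NX NG A mA.
have mp (E : set T) : measurable E -> measurable (f @^-1` E).
  by move=> mE; rewrite -[X in measurable X]setTI; exact: mf.
apply: (@dynkin_induction _ _ G (fun E => N (X `&` f @^-1` E)) GE GI).
- by rewrite preimage_setT setIT.
- exact: NG.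
- by move=> E mE NE; rewrite preimage_setC; apply: N_diff => //; exact: mp.
- move=> F mF tF NF; rewrite preimage_bigcup setI_bigcupr; apply: N_bigcup => //.
  + by move=> n; apply: measurableI => //; exact: mp.
  + by move=> i j _ _ [z [[_ Fi] [_ Fj]]]; apply: (tF i j) => //; exists (f z).
- by rewrite -GE.
Qed.

(** Quadrants determine the integrals of [d] in three passes: from rays to measurable sets in the
    second coordinate, then in the first, and from rectangles to all measurable sets of the
    plane. *)
Lemma quadrants_null : (forall a c : R, N [set z | a < z.1 /\ c < z.2]) ->
  forall E, measurable E -> N E.
Proof.
move=> NQ.
pose G : set (set leb_type) := [set A | exists x : R, A = `]x, +oo[%classic].
have GE : measurable = <<s G>> by exact: RGenOInfty.measurableE.
have GI : setI_closed G.
  move=> _ _ [x ->] [y ->]; exists (Num.max x y).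
  by apply/seteqP; split=> t /=; rewrite !in_itv/= !andbT gt_max; [move=> [-> ->]|case/andP].
have mG A : G A -> measurable A by rewrite GE; exact: sub_sigma_algebra.
(* Inside the disc a condition [-2 < z.1] or [-2 < z.2] is void, so quadrants with such a corner
   stand for half-planes and for the whole plane. *)
have Bs (z : R * R) : B z -> -2 < z.1 /\ -2 < z.2.
  move=> Bz; rewrite unit_discE /normsq /= in Bz.
  by have := sqr_ge0 z.1; have := sqr_ge0 z.2; split; nra.
have NB (X Y : set (leb_type * leb_type)) : (forall z, B z -> X z <-> Y z) -> N X -> N Y.
  rewrite /N => XY <-; apply: eq_Rintegral => z /set_mem /XY E; rewrite !indicE.
  by congr (_ * (nat_of_bool _)%:R); apply/idP/idP; rewrite !inE => /E.
have mfst : measurable_fun setT (fst : leb_type * leb_type -> leb_type) by exact: measurable_fst.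
have msnd : measurable_fun setT (snd : leb_type * leb_type -> leb_type) by exact: measurable_snd.
have S1 A D : G A -> measurable D -> N (fst @^-1` A `&` snd @^-1` D).
  move=> GA mD; apply: (N_dynkin GE GI msnd) => //.
  - by rewrite -[X in measurable X]setTI; apply: mfst => //; exact: mG.
  - case: GA => x ->; apply: NB (NQ x (-2)) => z /Bs[z1 z2] /=.
    by rewrite in_itv/= andbT; split=> [[]//|].
  - move=> _ [y ->]; case: GA => x ->; apply: NB (NQ x y) => z _ /=.
    by rewrite !in_itv/= !andbT.
have S2 A D : measurable A -> measurable D -> N (A `*` D).
  move=> mA mD; rewrite (_ : A `*` D = snd @^-1` D `&` fst @^-1` A); last first.
    by apply/seteqP; split=> z [].
  apply: (N_dynkin GE GI mfst) => //.
  - by rewrite -[X in measurable X]setTI; exact: msnd.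
  - have := S1 `]-2, +oo[%classic D (ex_intro _ (-2) erefl) mD.
    apply: NB => z /Bs[z1 _] /=; rewrite in_itv/= z1; split=> [[]//|].
    by split.
  - by move=> E GEE; rewrite setIC; exact: S1.
move=> E mE; rewrite -[E]setTI -[E]/(id @^-1` E).
apply: (N_dynkin (measurable_prod_measurableType _ _)) => //.
- move=> _ _ [A1 mA1 [A2 mA2 <-]] [B1 mB1 [B2 mB2 <-]].
  exists (A1 `&` B1); first exact: measurableI.
  by exists (A2 `&` B2); [exact: measurableI|rewrite setXI].
- by rewrite -setXTT; exact: S2.
- by move=> _ [A1 mA1 [A2 mA2 <-]]; rewrite setTI; exact: S2.
Qed.

End NullSets.

Lemma null_sets_eq0 d : L2 B d -> (forall E : set (leb_type * leb_type), measurable E ->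
  \int[mu]_(z in B) (d z * \1_E z) = 0) -> \int[mu]_(z in B) (d z ^+ 2) = 0.
Proof.
move=> Ld H; have Id := L2_integrable Ld.
have ae0 : ae_eq mu B (EFin \o d) (cst 0%E).
  apply: (@integral_ae_eq _ _ _ mu B mB (cst 0%E) (EFin \o d) Id).
    exact: measurable_cst.
  move=> E EB mE'; have IE : mu.-integrable E (EFin \o d) by exact: integrableS Id.
  rewrite (integral_EFin mE' IE) integral0; congr EFin.
  rewrite -[in LHS](setIidr EB) Rintegral_mkcondr -[RHS](H E mE').
  apply: eq_Rintegral => z _; rewrite patchE indicE.
  by case: (z \in E); rewrite ?mulr1 ?mulr0.
rewrite /Rintegral (@ae_eq_integral _ _ _ mu B (cst 0%E) _ mB).
- by rewrite integral0.
- exact: (measurable_int _ (L2_integrable_sqr Ld)).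
- exact: measurable_cst.
- apply: filterS ae0 => z /= dz Bz; have [->] := dz Bz.
  by rewrite expr0n.
Qed.

(** For the cutoff near the unit circle: the shift by [1 / (n + 1)] keeps its support compact in the
    disc and disappears in the limit. *)
Lemma flat_shift_cvg (x : R) : 0 < x ->
  (fun n : nat => flat n.+1%:R^-1 0 (x - n.+1%:R^-1)) @ \oo --> (1 : R).
Proof.
move=> x0; have i0 : (fun n => n.+1%:R^-1 : R) @ \oo --> (0 : R).
  exact: cvg_harmonic.
have H : (fun n : nat => expR (- (n.+1%:R^-1 / (x - n.+1%:R^-1)))) @ \oo --> (1 : R).
  rewrite -[X in _ --> X]expR0 -oppr0 -[X in - X](mul0r x^-1).
  apply: continuous_cvg; first exact: continuous_expR.
  apply: cvgN; apply: cvgM => //; apply: cvgV; first by rewrite gt_eqF.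
  by rewrite -[X in _ --> X]subr0; apply: cvgB => //; exact: cvg_cst.
apply: cvg_trans H; apply: near_eq_cvg; near=> n.
rewrite flat_gt0E ?expr0 ?mul1r// subr_gt0.
by near: n; apply: (cvgr_lt (0 : R)).
Unshelve. all: by end_near. Qed.

(** Products of flat functions approximate the indicator of a quadrant pointwise and boundedly, a
    third factor cutting them off before the unit circle. By dominated convergence [d] integrates to
    0 over every quadrant. *)
Theorem fundamental_lemma d : L2 B d ->
  (forall phi, test_function B phi -> \int[mu]_(z in B) (d z * phi z) = 0) ->
  \int[mu]_(z in B) (d z ^+ 2) = 0.
Proof.
move=> Ld H; have Id := L2_integrable Ld.
apply: null_sets_eq0 => //; apply: (@quadrants_null d Id) => a c.
pose e n : R := n.+1%:R^-1.
have e0 n : 0 < e n by rewrite invr_gt0.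
pose phi n (z : R * R) := flat (e n) 0 (1 * z.1 + (- a)) * flat (e n) 0 (1 * z.2 + (- c)) *
  flat (e n) 0 (-1 * normsq z + (1 - e n)).
have tphi n : test_function B (phi n).
  apply: (@disc_test _ (1 - e n)); first by rewrite ltrBlDr ltrDl.
    have sf := @smooth1_flat _ (e n) (e0 n).
    apply: smoothM; [apply: smoothM|].
    - exact (smooth_comp (@smooth1_affine _ _ 1 (- a) sf) (@smooth_fst R)).
    - exact (smooth_comp (@smooth1_affine _ _ 1 (- c) sf) (@smooth_snd R)).
    - exact (smooth_comp (@smooth1_affine _ _ (-1) (1 - e n) sf) (@smooth_normsq R)).
  by move=> z zb; rewrite /phi [X in _ * X]flat_le0 ?mulr0//; lra.
have phi01 n z : `|phi n z| <= 1.
  have F (t : R) : 0 <= flat (e n) 0 t <= 1 by rewrite flat_ge0 flat0_le1// ltW.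
  rewrite ger0_norm ?mulr_ge0 ?flat_ge0//.
  have /andP[? ?] := F (1 * z.1 + (- a)); have /andP[? ?] := F (1 * z.2 + (- c)).
  have /andP[? ?] := F (-1 * normsq z + (1 - e n)).
  by rewrite -[leRHS](mulr1 1) ler_pM ?mulr_ge0// -[leRHS](mulr1 1) ler_pM.
have [||||_] := @R_dominated _ _ _ mu _ mB (fun n z => d z * phi n z)
  (fun z => d z * \1_[set z | a < z.1 /\ c < z.2] z) (fun z => `|d z|) _; last 1 first.
- move=> K; apply/esym/(cvg_unique _ _ K); first exact: norm_hausdorff.
  by apply: cvg_near_cst; near=> n; exact: H.
- move=> n; apply: measurable_funM; first exact: Ld.1.
  by exact: (L2_continuous (test_continuous (tphi n))).1.
- move=> z Bz; apply: cvgM; first exact: cvg_cst.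
  rewrite (_ : \1__ z = (if 0 < z.1 - a then 1 else 0) * (if 0 < z.2 - c then 1 else 0) * 1);
    last first.
    rewrite indicE mulr1 !subr_gt0; case: ifPn => za; case: ifPn => zc; rewrite ?mulr0 ?mulr1 ?mul0r.
    - by rewrite mem_set.
    - by rewrite memNset// => -[_ /= H']; rewrite H' in zc.
    - by rewrite memNset// => -[/= H' _]; rewrite H' in za.
    - by rewrite memNset// => -[/= H' _]; rewrite H' in za.
  apply: cvgM; first apply: cvgM.
  + by under eq_fun do rewrite mul1r; exact: flat_cvg.
  + by under eq_fun do rewrite mul1r; exact: flat_cvg.
  + under eq_fun do rewrite mulN1r addrC addrAC.
    by apply: flat_shift_cvg; move: Bz; rewrite unit_discE /= subr_gt0.
- by have := integrable_abse Id.
- by move=> n z _; rewrite normrM -[leRHS]mulr1 ler_wpM2l.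
Unshelve. all: by end_near. Qed.

(** [weak_deriv] is an unspecified choice; this is what allows integrals of it to be computed from
    classical derivatives. *)
Lemma weak_deriv_unique s u g h : L2 B u -> is_weak_deriv B s u g -> is_weak_deriv B s u h ->
  \int[mu]_(z in B) ((g z - h z) ^+ 2) = 0.
Proof.
move=> Lu [Lg ug] [Lh uh]; apply: fundamental_lemma; first exact: L2B.
move=> phi tp; have Lp := test_L2 tp.
transitivity (\int[mu]_(z in B) (g z * phi z - h z * phi z)).
  by apply: eq_Rintegral => z _; rewrite mulrBl.
rewrite (RintegralB mB (L2_mul Lg Lp) (L2_mul Lh Lp)).
have := ug _ tp; rewrite (uh _ tp) => /(mulfI _) ->; first by rewrite subrr.
by rewrite signr_eq0.
Qed.

Lemma sqr_integral_eq g h : L2 B g -> L2 B h -> \int[mu]_(z in B) ((g z - h z) ^+ 2) = 0 ->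
  \int[mu]_(z in B) (g z ^+ 2) = \int[mu]_(z in B) (h z ^+ 2).
Proof.
move=> Lg Lh E; have Ld := L2B Lg Lh.
have CS : \int[mu]_(z in B) (h z * (g z - h z)) = 0.
  have := cauchy_schwarz Lh Ld; rewrite E mulr0 => K.
  by apply/eqP; rewrite -sqrf_eq0 eq_le K sqr_ge0.
transitivity (\int[mu]_(z in B) (h z ^+ 2 + (2 * (h z * (g z - h z)) + (g z - h z) ^+ 2))).
  by apply: eq_Rintegral => z _; ring.
have I1 := L2_integrable_sqr Lh; have I2 := L2_mul Lh Ld; have I3 := L2_integrable_sqr Ld.
rewrite (RintegralD mB I1 (R_integrableD mB (R_integrableZ mB 2 I2) I3)).
rewrite (RintegralD mB (R_integrableZ mB 2 I2) I3) (RintegralZl _ mB I2).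
by rewrite CS E mulr0 !addr0.
Qed.

End FundamentalLemma.

(** * Classical derivatives as weak derivatives; smoothed step functions *)

Section ClassicalWeakDerivatives.
Variable R : realType.
Local Notation mu := (lebesgue2 R).
Local Notation B := (@unit_disc R).
Local Notation iB f := (mu.-integrable B (EFin \o f)).
Local Notation i0 := (ord0 : 'I_2).
Local Notation i1 := (lift ord0 ord0 : 'I_2).
Local Notation leb_type := (g_sigma_algebraType R.-ocitv.-measurable).
Local Notation pi := (@pi R).
Implicit Types (f g u v w : R * R -> R) (phi psi chi : R * R -> R).

Let mB : measurable (B : set (leb_type * leb_type)).
Proof. exact: measurable_unit_disc. Qed.

Lemma is_derive_glue (f g : R -> R) (a l : R) : is_derive a 1 f l -> is_derive a 1 g l ->
  f a = g a -> is_derive a 1 (fun s => if s < a then f s else g s) l.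
Proof.
move=> [df fl] [dg gl] fg.
pose q (k : R -> R) (h : R) := h^-1 *: ((k \o shift a) (h *: (1 : R)) - k a).
pose k s := if s < a then f s else g s.
suff H : q k @ 0^' --> l.
  by split; [apply/cvg_ex; exists l|apply/cvg_lim].
have Hf : q f @ 0^' --> l by rewrite -fl; exact: df.
have Hg : q g @ 0^' --> l by rewrite -gl; exact: dg.
apply/cvgrPdist_lt => e e0.
move/cvgrPdist_lt : Hf => /(_ e e0) Hf; move/cvgrPdist_lt : Hg => /(_ e e0) Hg.
near=> h.
(* For every [h] the quotient of the glued function is one of the two given quotients, which have
   the same limit. *)
have : q k h = q f h \/ q k h = q g h.
  by rewrite /q /k /= ltxx; case: ifP => _; [left; rewrite -fg|right].
by case=> ->; near: h.
Unshelve. all: by end_near. Qed.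

Lemma weak_deriv_continuous0 f : continuous f -> is_weak_deriv B [::] f f.
Proof. by move=> cf; split=> [|phi tp]; [exact: L2_continuous|rewrite expr0 mul1r]. Qed.

Lemma weak_deriv_C2 f g h i j : continuous f ->
  (forall z, is_derive z (basis2 R i) f (g z)) -> continuous g ->
  (forall z, is_derive z (basis2 R j) g (h z)) -> continuous h ->
  is_weak_deriv B [:: i; j] f h.
Proof.
move=> cf df cg dg ch; split; first exact: L2_continuous.
move=> phi tp; rewrite /= sqrrN expr1n mul1r.
have gE : 'D_(basis2 R i) f = g by apply/funext => z; case: (df z).
have hE : 'D_(basis2 R j) g = h by apply/funext => z; case: (dg z).
rewrite (Rintegral_by_parts cf _ _ (test_derive j tp)).
- transitivity (- (\int[mu]_(z in B) (g z * 'D_(basis2 R j) phi z))).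
    by congr (- _); apply: eq_Rintegral => z _; case: (df z) => _ ->.
  rewrite (Rintegral_by_parts cg _ _ tp) ?opprK.
  + by apply: eq_Rintegral => z _; case: (dg z) => _ ->.
  + by move=> z; case: (dg z).
  + by rewrite hE.
- by move=> z; case: (df z).
- by rewrite gE.
Qed.

Lemma sqr_weak_deriv s u g : L2 B u -> is_weak_deriv B s u g ->
  \int[mu]_(z in B) (weak_deriv B s u z ^+ 2) = \int[mu]_(z in B) (g z ^+ 2).
Proof.
move=> Lu ug; have ud := weak_derivP ug.
by apply: sqr_integral_eq ud.1 ug.1 _; exact: weak_deriv_unique Lu ud ug.
Qed.

Lemma sqr_weak_laplacian u (g : 'I_2 -> R * R -> R) : L2 B u ->
  (forall i, is_weak_deriv B [:: i; i] u (g i)) ->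
  \int[mu]_(z in B) (weak_laplacian B u z ^+ 2) = \int[mu]_(z in B) ((g i0 z + g i1 z) ^+ 2).
Proof.
move=> Lu ug; have ud i := weak_derivP (ug i).
have E i := weak_deriv_unique Lu (ud i) (ug i).
have LD i := L2B (ud i).1 (ug i).1.
rewrite weak_laplacianE; apply: sqr_integral_eq.
- exact: L2D (ud i0).1 (ud i1).1.
- exact: L2D (ug i0).1 (ug i1).1.
pose d i z := weak_deriv B [:: i; i] u z - g i z.
have I i : iB (fun z => 2 * d i z ^+ 2) by exact: R_integrableZ (L2_integrable_sqr (LD i)).
apply/eqP; rewrite eq_le; apply/andP; split; last first.
  by apply: Rintegral_ge0 => z _; exact: sqr_ge0.
apply: (@le_trans _ _ (\int[mu]_(z in B) (2 * d i0 z ^+ 2 + 2 * d i1 z ^+ 2))).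
  apply: le_Rintegral => //.
  - apply: L2_integrable_sqr; apply: L2B; first exact: L2D (ud i0).1 (ud i1).1.
    exact: L2D (ug i0).1 (ug i1).1.
  - exact: R_integrableD.
  - move=> z _; rewrite /d; move: (weak_deriv _ _ _ _) (weak_deriv _ _ _ _) (g _ _) (g _ _).
    by move=> a b c e; have := sqr_ge0 (a - c - (b - e)); nra.
rewrite (RintegralD mB (I i0) (I i1)) !(RintegralZl _ mB (L2_integrable_sqr (LD _))).
by rewrite !E !mulr0 addr0.
Qed.

Lemma W12_normsqE u (g : 'I_2 -> R * R -> R) : L2 B u ->
  (forall i, is_weak_deriv B [:: i] u (g i)) ->
  W12_normsq B u = (\int[mu]_(z in B) (u z ^+ 2) +
    (\int[mu]_(z in B) (g i0 z ^+ 2) + \int[mu]_(z in B) (g i1 z ^+ 2)))%:E.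
Proof.
move=> Lu ug; have ud i := weak_derivP (ug i).
have I1 := L2_integrable_sqr Lu; have I2 := L2_integrable_sqr (ud i0).1.
have I3 := L2_integrable_sqr (ud i1).1.
have I23 := R_integrableD mB I2 I3; have I123 := R_integrableD mB I1 I23.
rewrite -(sqr_weak_deriv Lu (ug i0)) -(sqr_weak_deriv Lu (ug i1)).
rewrite -(RintegralD mB I2 I3) -(RintegralD mB I1 I23) -(integral_EFin mB I123).
by apply: eq_integral => z _; rewrite big_ord_recl big_ord1.
Qed.

(** The indicators select the [k] with [k / N < s], an initial segment, so the sum telescopes. The
    index [j] rounds [N s] up, or equals [M] if [M] is smaller, which the induction has to allow. *)
Lemma telescope_step (G : R -> R) (N M : nat) (s : R) : (0 < N)%N -> (M <= N)%N -> 0 <= s ->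
  exists j, [/\ \sum_(k < M) (G (k.+1%:R / N%:R) - G (k%:R / N%:R)) *
      (if 0 < s - k%:R / N%:R then 1 else 0) = G (j%:R / N%:R) - G 0,
    j%:R / N%:R <= s + N%:R^-1 & j = M \/ (j <= M)%N /\ s <= j%:R / N%:R].
Proof.
move=> N0 + s0; have NR : 0 < N%:R :> R by rewrite ltr0n.
elim: M => [_|M IH MN].
  by exists 0%N; rewrite big_ord0 mul0r subrr addr_ge0// ?invr_ge0 ?ler0n//; split=> //; left.
have [j [E jl jM]] := IH (ltnW MN).
rewrite big_ord_recr /= E; case: ifPn => [|]; rewrite subr_gt0 => sM; last first.
  exists j; rewrite mulr0 addr0; split=> //; right.
  by case: jM => [->|[jM sj]]; [split=> //; rewrite leNgt|split=> //; exact: leqW].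
exists M.+1; have -> : j = M.
  case: jM => // -[jM sj]; have := lt_le_trans sM sj.
  by rewrite ltr_pM2r ?invr_gt0// ltr_nat ltnNge jM.
split; [by rewrite mulr1; ring| |by left].
by rewrite -natr1 mulrDl mul1r lerD2r ltW.
Qed.

(* A smooth version of [s |-> G (ceil (N s) / N)] on [[0, 1[], cut off near 1. *)
Definition step_approx (G : R -> R) (N n : nat) (s : R) : R :=
  (G 0 + \sum_(k < N) (G (k.+1%:R / N%:R) - G (k%:R / N%:R)) *
    flat n.+1%:R^-1 0 (1 * s + - (k%:R / N%:R))) *
  (flat n.+1%:R^-1 0 (-1 * s + (1 - n.+1%:R^-1)) * flat n.+1%:R^-1 0 (1 * s + 1)).

Lemma smooth1_step_approx G N n : smooth1 (step_approx G N n).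
Proof.
have e0 : 0 < n.+1%:R^-1 :> R by rewrite invr_gt0.
have sf := smooth1_flat e0.
apply: smooth1M.
  apply: smooth1D; first exact: smooth1_cst.
  apply: (@smooth1_sum _ N (fun k s => (G (k.+1%:R / N%:R) - G (k%:R / N%:R)) *
    flat n.+1%:R^-1 0 (1 * s + - (k%:R / N%:R)))) => k.
  by apply: smooth1M; [exact: smooth1_cst|exact: smooth1_affine].
by apply: smooth1M; exact: smooth1_affine.
Qed.

(** On the disc [s = |z| ^ 2] is nonnegative; the cut at -1 serves to make the primitive starting
    from minus infinity finite. *)
Lemma step_approx_support G N n s : s <= -1 \/ 1 - n.+1%:R^-1 <= s ->
  step_approx G N n s = 0.
Proof.
rewrite /step_approx; case=> H; first by rewrite [X in _ * (_ * X)]flat_le0 ?mulr0//; lra.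
rewrite [X in _ * (X * _)]flat_le0 ?mul0r ?mulr0//.
by rewrite mulN1r addrC subr_le0.
Qed.

(** [N] is chosen first: the exact step function differs from [G] by at most [L / N], which costs at
    most half of [e]. Then [n] tends to infinity with [N] fixed, by dominated convergence. *)
Lemma step_approx_L2 (G : R -> R) (L e : R) : 0 <= L -> continuous G ->
  (forall x y, `|G x - G y| <= L * `|x - y|) -> 0 < e ->
  exists N n, \int[mu]_(z in B) ((G (normsq z) - step_approx G N n (normsq z)) ^+ 2) <= e.
Proof.
move=> L0 cG GL e0.
pose N := (Num.bound (2 * pi * L ^+ 2 / e)).+1.
have N0 : (0 < N)%N by [].
have NR : 0 < N%:R :> R by rewrite ltr0n.
have N1 : 1 <= N%:R :> R by rewrite ler1n.
have LN : L ^+ 2 / N%:R ^+ 2 * pi <= e / 2.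
  have A0 : 0 <= 2 * pi * L ^+ 2 / e.
    by rewrite divr_ge0 ?(ltW e0)// mulr_ge0 ?sqr_ge0// mulr_ge0 ?pi_ge0.
  have : 2 * pi * L ^+ 2 / e < N%:R.
    by apply: lt_le_trans (archi_boundP A0) _; rewrite ler_nat.
  rewrite ltr_pdivrMr// => /ltW H.
  rewrite mulrAC ler_pdivrMr ?exprn_gt0//.
  have : N%:R * e <= e * N%:R ^+ 2 by rewrite mulrC ler_pM2l// expr2 ler_peMl// ltW.
  by move: H; move: pi (N%:R) => p x; lra.
pose w n z := (G (normsq z) - step_approx G N n (normsq z)) ^+ 2 : R.
pose GN (s : R) := G 0 + \sum_(k < N) (G (k.+1%:R / N%:R) - G (k%:R / N%:R)) *
      (if 0 < s - k%:R / N%:R then 1 else 0).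
have cS n : continuous (step_approx G N n) by exact/smooth1_continuous/smooth1_step_approx.
have cw n : continuous (w n).
  have c1 : continuous (fun z : R * R => G (normsq z) - step_approx G N n (normsq z)).
    move=> z; apply: cvgB.
      by apply: (@continuous_comp _ _ _ (@normsq R) G); [exact: continuous_normsq|exact: cG].
    by apply: (@continuous_comp _ _ _ (@normsq R) (step_approx G N n));
      [exact: continuous_normsq|exact: cS].
  exact: continuous_mul.
have B01 z : B z -> 0 <= normsq z < 1.
  by rewrite unit_discE /= => ->; rewrite andbT /normsq addr_ge0 ?sqr_ge0.
pose M := `|G 0| + L + (`|G 0| + \sum_(k < N) `|G (k.+1%:R / N%:R) - G (k%:R / N%:R)|).
have F01 n (t : R) : `|flat n.+1%:R^-1 0 t| <= 1 by rewrite ger0_norm ?flat_ge0// flat0_le1.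
have wM n z : B z -> `|w n z| <= M ^+ 2.
  move=> /B01 /andP[s0 s1]; rewrite /w normrX lerXn2r ?nnegrE ?addr_ge0 ?sumr_ge0//.
  apply: le_trans (ler_normB _ _) _; apply: lerD.
    rewrite -[G _](subrK (G 0)) addrC; apply: le_trans (ler_normD _ _) _; rewrite lerD2l.
    apply: le_trans (GL _ _) _; rewrite subr0 ger0_norm// -[leRHS]mulr1 ler_wpM2l// ltW//.
  rewrite /step_approx normrM -[leRHS]mulr1; apply: ler_pM => //.
    apply: le_trans (ler_normD _ _) _; rewrite lerD2l.
    apply: le_trans (ler_norm_sum _ _ _) _; apply: ler_sum => k _.
    by rewrite normrM -[leRHS]mulr1 ler_wpM2l.
  by rewrite normrM -[leRHS]mulr1; apply: ler_pM.
have [||||Ilim cv] := @R_dominated _ _ _ mu _ mB w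
  (fun z => (G (normsq z) - GN (normsq z)) ^+ 2) (fun z => M ^+ 2).
- by move=> n; exact: (L2_continuous (@cw n)).1.
- move=> z /B01 /andP[s0 s1]; rewrite /w; move: (normsq z) s0 s1 => s s0 s1.
  have H : (fun n => step_approx G N n s) @ \oo --> GN s.
    rewrite /step_approx (_ : GN s = GN s * (1 * 1)); last by rewrite !mulr1.
    apply: cvgM; [|apply: cvgM].
    + apply: cvgD; first exact: cvg_cst.
      have K m : (fun n => \sum_(k < m) (G (k.+1%:R / N%:R) - G (k%:R / N%:R)) *
          flat n.+1%:R^-1 0 (1 * s + - (k%:R / N%:R))) @ \oo -->
          \sum_(k < m) (G (k.+1%:R / N%:R) - G (k%:R / N%:R)) *
          (if 0 < s - k%:R / N%:R then 1 else 0).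
        elim: m => [|m IH].
          by under eq_fun do rewrite big_ord0; rewrite big_ord0; exact: cvg_cst.
        under eq_fun do rewrite big_ord_recr; rewrite big_ord_recr /=.
        apply: cvgD; first exact: IH.
        apply: cvgM; first exact: cvg_cst.
        by rewrite -[s in if 0 < s - _ then _ else _]mul1r; exact: flat_cvg.
      exact: K.
    + under eq_fun do rewrite mulN1r addrC addrAC.
      by apply: flat_shift_cvg; rewrite subr_gt0.
    + by have := @flat_cvg R (1 * s + 1); rewrite ifT//; lra.
  under eq_fun do rewrite expr2; rewrite expr2.
  by apply: cvgM; apply: cvgB => //; exact: cvg_cst.
- by apply/L2_integrable/L2_continuous; exact: cst_continuous.
- exact: wM.
have lim : \int[mu]_(z in B) ((G (normsq z) - GN (normsq z)) ^+ 2) <= e / 2.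
  apply: le_trans LN.
  have E := unit_disc_measure R.
  have <- : \int[mu]_(z in B) (L ^+ 2 / N%:R ^+ 2) = L ^+ 2 / N%:R ^+ 2 * pi.
    by rewrite Rintegral_cst// [X in fine X]E.
  apply: le_Rintegral => //.
    by apply/L2_integrable/L2_continuous; exact: cst_continuous.
  move=> z /B01 /andP[s0 s1].
  have [j [Ej jl jN]] := telescope_step G N0 (leqnn N) s0.
  have -> : GN (normsq z) = G (j%:R / N%:R) by rewrite /GN Ej addrC subrK.
  rewrite -expr_div_n -real_normK ?num_real// lerXn2r ?nnegrE ?divr_ge0//.
  apply: le_trans (GL _ _) _; rewrite ler_wpM2l// ler_norml.
  have sj : normsq z <= j%:R / N%:R.
    by case: jN => [->|[]//]; rewrite divff ?gt_eqF// ltW.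
  by apply/andP; split; lra.
have : \forall n \near \oo, \int[mu]_(z in B) w n z < e.
  apply: (cvgr_lt _ cv); apply: le_lt_trans lim _; lra.
by case=> n _ Hn; exists N, n; apply/ltW/Hn => /=.
Qed.

End ClassicalWeakDerivatives.

(** * Radial functions with a twice differentiable profile *)

Section RadialCompetitors.
Variable R : realType.
Local Notation mu1 := (@lebesgue_measure R).
Local Notation mu := (lebesgue2 R).
Local Notation B := (@unit_disc R).
Local Notation iB f := (mu.-integrable B (EFin \o f)).
Local Notation i0 := (ord0 : 'I_2).
Local Notation i1 := (lift ord0 ord0 : 'I_2).
Local Notation leb_type := (g_sigma_algebraType R.-ocitv.-measurable).
Local Notation pi := (@pi R).
Local Notation normsq := (@normsq R).
Implicit Types (f g u v w : R * R -> R) (phi psi chi : R * R -> R).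

Let mB : measurable (B : set (leb_type * leb_type)).
Proof. exact: measurable_unit_disc. Qed.

Lemma Rintegral_radial (g : R -> R) : continuous g -> (forall s, 0 <= s <= 1 -> 0 <= g s) ->
  \int[mu]_(z in B) g (normsq z) = pi * \int[mu1]_(s in `[0, 1]) g s.
Proof.
move=> cg g0.
have Ig := continuous_integrable_itv 0 1 cg.
have Ig' : mu1.-integrable `[0, 1[ (EFin \o g).
  apply: integrableS Ig => //.
  by move=> s; rewrite /= !in_itv/= => /andP[-> /ltW].
rewrite -Rintegral_itv_bndo_bndc//.
rewrite /Rintegral (@ge0_radial_integral R (EFin \o g)).
- by rewrite fineM//; exact: integrable_fin_num.
- exact: (measurable_int _ Ig').
- by move=> s /andP[s0 s1]; rewrite lee_fin g0// s0 ltW.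
Qed.

(** Expand the integral of the square of [|w| - A], where [A] is the mean of [|w|]. *)
Lemma Rintegral_sqr_le (w : R -> R) : continuous w ->
  (\int[mu1]_(s in `[0, 1]) `|w s|) ^+ 2 <= \int[mu1]_(s in `[0, 1]) (w s ^+ 2).
Proof.
move=> cw; have m01 : measurable (`[0, 1]%classic : set leb_type) by exact: measurable_itv.
have ca : continuous (fun s => `|w s|) by move=> s; apply: cvg_norm; exact: cw.
have c2 : continuous (fun s => w s ^+ 2) by move=> s; apply: cvgM; exact: cw.
have Ia := continuous_integrable_itv 0 1 ca; have I2 := continuous_integrable_itv 0 1 c2.
set A := \int[mu1]_(s in _) `|w s|.
have Ic : mu1.-integrable `[0, 1] (EFin \o (fun=> A ^+ 2)).
  by apply: continuous_integrable_itv; exact: cst_continuous.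
have : 0 <= \int[mu1]_(s in `[0, 1]) (w s ^+ 2 - 2 * A * `|w s| + A ^+ 2).
  apply: Rintegral_ge0 => s _; rewrite -(@real_normK _ (w s)) ?num_real//.
  by have := sqr_ge0 (`|w s| - A); rewrite sqrrB; lra.
have IZ := R_integrableZ m01 (2 * A) Ia.
rewrite (RintegralD m01 (R_integrableB m01 I2 IZ) Ic) (RintegralB m01 I2 IZ).
rewrite (RintegralZl _ m01 Ia) -/A Rintegral_cst//.
have -> : fine (mu1 `[0, 1]%classic) = 1 by rewrite lebesgue_measure_itv/= lte_fin ltr01 -EFinB subr0.
by rewrite expr2; move: (\int[mu1]_(s in _) _) => x; lra.
Qed.

Definition coord (i : 'I_2) (z : R * R) : R := if i == i0 then z.1 else z.2.

Lemma ord2P (i : 'I_2) : i = i0 \/ i = i1.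
Proof. by case: i => -[|[|//]] ?; [left|right]; exact/val_inj. Qed.

Lemma is_derive_coord (i j : 'I_2) (z : R * R) :
  is_derive z (basis2 R i) (coord j) (i == j)%:R.
Proof.
by case: z => x y; case: (ord2P i) => ->; case: (ord2P j) => ->; rewrite /coord /= ?basis20 ?basis21;
  (apply/is_derive_fst || apply/is_derive_snd); (exact: is_derive_id || exact: is_derive_cst).
Qed.

Lemma continuous_coord i : continuous (coord i).
Proof.
by rewrite /coord; case: (i == i0) => z; [exact: cvg_fst|exact: cvg_snd].
Qed.

Lemma normsqE z : normsq z = coord i0 z ^+ 2 + coord i1 z ^+ 2.
Proof. by []. Qed.

Lemma is_derive_normsq i z : is_derive z (basis2 R i) normsq (2 * coord i z).
Proof.
have D0 := is_derive_coord i i0 z; have D1 := is_derive_coord i i1 z.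
have -> : normsq = (fun z => coord i0 z * coord i0 z + coord i1 z * coord i1 z).
  by apply/funext => y; rewrite normsqE !expr2.
apply: is_derive_eq; rewrite /GRing.scale/=.
by case: (ord2P i) => ->; rewrite /coord/=; ring.
Qed.

Section Profile.
Variables (F F1 F2 : R -> R) (C L : R).
Hypotheses (dF : forall s : R, is_derive s (1 : R) F (F1 s))
  (dF1 : forall s : R, is_derive s (1 : R) F1 (F2 s))
  (cF2 : continuous F2) (F10 : F 1 = 0) (L0 : 0 <= L)
  (F1L : forall x y, `|F1 x - F1 y| <= L * `|x - y|).

Let cF : continuous F.
Proof. by apply: derivable_continuous => s; case: (dF s). Qed.
Let cF1 : continuous F1.
Proof. by apply: derivable_continuous => s; case: (dF1 s). Qed.

Lemma continuous_radial (g : R -> R) : continuous g -> continuous (fun z => g (normsq z)).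
Proof.
by move=> cg z; apply: (@continuous_comp _ _ _ normsq g); [exact: continuous_normsq|exact: cg].
Qed.

Lemma is_derive_radial (g g1 : R -> R) i z : (forall s : R, is_derive s (1 : R) g (g1 s)) ->
  is_derive z (basis2 R i) (fun z => g (normsq z)) (2 * coord i z * g1 (normsq z)).
Proof.
move=> dg; have := is_derive_comp1 (is_derive_normsq i z) (dg (normsq z)).
by rewrite mulrC.
Qed.

Lemma continuous_radial_grad (g1 : R -> R) i : continuous g1 ->
  continuous (fun z => 2 * coord i z * g1 (normsq z)).
Proof.
move=> cg1; apply: continuous_mul; last exact: continuous_radial.
by apply: continuous_mul; [exact: cst_continuous|exact: continuous_coord].
Qed.

(** The profile depends on [|z| ^ 2], which is smooth at the origin, so that [v] is twice
    continuously differentiable without any condition on [F] at 0. *)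
Let v z := C - F (normsq z).
Let g i z := - (2 * coord i z * F1 (normsq z)).
Let hess i j z := - (2 * (i == j)%:R * F1 (normsq z) + 4 * coord i z * coord j z * F2 (normsq z)).

Let cv : continuous v.
Proof.
by move=> z; apply: cvgB; [exact: cvg_cst|exact: continuous_radial].
Qed.

Let dv i z : is_derive z (basis2 R i) v (g i z).
Proof.
have := is_derive_radial i z dF => D.
by apply: is_derive_eq; rewrite add0r.
Qed.

Let cg i : continuous (g i).
Proof. by move=> z; apply: cvgN; exact: continuous_radial_grad. Qed.

Let dg i j z : is_derive z (basis2 R j) (g i) (hess i j z).
Proof.
have D1 := is_derive_radial j z dF1; have D2 := is_derive_coord j i z.
apply: is_derive_eq; rewrite /GRing.scale/= /hess (eq_sym i).
by move: (coord _ _) (coord _ _) (F1 _) (F2 _) => a b c d; ring.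
Qed.

Let chess i j : continuous (hess i j).
Proof.
move=> z; apply: cvgN; apply: cvgD.
  by apply: cvgM; [exact: cvg_cst|exact: continuous_radial].
apply: cvgM; last exact: continuous_radial.
by apply: cvgM; [apply: cvgM; [exact: cvg_cst|]|]; exact: continuous_coord.
Qed.

Lemma radial_Wk2 : Wk2 B 2 v.
Proof.
split; first exact: L2_continuous.
move=> [|i [|j [|//]]] _.
- by exists v; exact: weak_deriv_continuous0.
- have gE : 'D_(basis2 R i) v = g i by apply/funext => z; case: (dv i z).
  exists ('D_(basis2 R i) v); apply: weak_deriv_C1 => //; last by rewrite gE.
  by move=> z; case: (dv i z).
- by exists (hess i j); exact: (@weak_deriv_C2 _ v (g i) (hess i j) i j cv (dv i) (@cg i) (dg i j) (@chess i j)).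
Qed.

Lemma radial_laplacian : \int[mu]_(z in B) (weak_laplacian B v z ^+ 2) =
  pi * \int[mu1]_(s in `[0, 1]) ((4 * (F1 s + s * F2 s)) ^+ 2).
Proof.
have Lv := L2_continuous cv.
have D i : is_weak_deriv B [:: i; i] v (hess i i).
  exact: (@weak_deriv_C2 _ v (g i) (hess i i) i i cv (dv i) (@cg i) (dg i i) (@chess i i)).
rewrite (sqr_weak_laplacian Lv D) -Rintegral_radial.
- apply: eq_Rintegral => z _; rewrite /hess !eqxx; move: (F1 _) (F2 _) => c d.
  by rewrite normsqE (_ : true%:R = 1)//; move: (coord _ _) (coord _ _) => a b; ring.
- have c1 : continuous (fun s => 4 * (F1 s + s * F2 s)).
    move=> s; apply: cvgM; first exact: cvg_cst.
    by apply: cvgD; [exact: cF1|apply: cvgM; [exact: cvg_id|exact: cF2]].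
  by move=> s; apply: cvgM; exact: c1.
- by move=> s _; exact: sqr_ge0.
Qed.

(** The constant is 1 + 4 + 4. Each partial derivative is [2 x_i w] up to sign, with [|x_i| <= 1];
    and [E s] is minus the integral of [w] over [[s, 1]], so its square is at most the integral of
    [w ^ 2] over [[0, 1]]. *)
Lemma radial_W12_normsq (E w : R -> R) : (forall s : R, is_derive s (1 : R) E (w s)) ->
  continuous w -> E 1 = 0 ->
  (W12_normsq B (fun z => - E (normsq z))%R <= (9 * \int[mu]_(z in B) (w (normsq z) ^+ 2))%R%:E)%E.
Proof.
move=> dE cw E1; have cE : continuous E.
  by apply: derivable_continuous => s; case: (dE s).
have cw2 : continuous (fun s => w s ^+ 2) by move=> s; apply: cvgM; exact: cw.
have IE : L2 B (fun z => - E (normsq z)).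
  by apply: L2_continuous => z; apply: cvgN; exact: continuous_radial.
pose gr i z := - (2 * coord i z * w (normsq z)).
have cgr i : continuous (gr i) by move=> z; apply: cvgN; exact: continuous_radial_grad.
have D i z : is_derive z (basis2 R i) (fun z => - E (normsq z)) (gr i z).
  by have D := is_derive_radial i z dE; exact: is_deriveN.
have W i : is_weak_deriv B [:: i] (fun z => - E (normsq z)) (gr i).
  have gE : 'D_(basis2 R i) (fun z => - E (normsq z)) = gr i.
    by apply/funext => z; case: (D i z).
  rewrite -gE; apply: weak_deriv_C1; last by rewrite gE.
    by move=> z; apply: cvgN; exact: continuous_radial.
  by move=> z; case: (D i z).
rewrite (W12_normsqE IE W) lee_fin.
pose J := \int[mu]_(z in B) (w (normsq z) ^+ 2).
have Iw : iB (fun z => w (normsq z) ^+ 2).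
  by apply: continuous_integrable_disc; exact: (@continuous_radial (fun s => w s ^+ 2)).
have Ig i : \int[mu]_(z in B) (gr i z ^+ 2) <= 4 * J.
  rewrite -(RintegralZl _ mB Iw); apply: le_Rintegral => //.
  - exact/L2_integrable_sqr/L2_continuous.
  - exact: R_integrableZ.
  - move=> z; rewrite unit_discE /= => Bz.
    have c1 : coord i z ^+ 2 <= 1.
      apply: le_trans (ltW Bz); rewrite -[leRHS]/(coord i0 z ^+ 2 + coord i1 z ^+ 2).
      by case: (ord2P i) => ->; rewrite ?lerDl ?lerDr sqr_ge0.
    rewrite /gr sqrrN !exprMn; move: c1 (sqr_ge0 (w (normsq z))).
    by move: (coord i z ^+ 2) (w _ ^+ 2) => a b; nra.
have JE : J = pi * \int[mu1]_(s in `[0, 1]) (w s ^+ 2).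
  by apply: Rintegral_radial => // s _; exact: sqr_ge0.
have p0 := pi_gt0 R.
have Es s : 0 <= s <= 1 -> E s ^+ 2 <= J / pi.
  move=> /andP[s0 s1].
  have m01 : measurable (`[0, 1]%classic : set leb_type) by exact: measurable_itv.
  have ca : continuous (fun s => `|w s|) by move=> t; apply: cvg_norm; exact: cw.
  have Is := continuous_integrable_itv s 1 cw.
  have -> : E s = - \int[mu1]_(t in `[s, 1]) w t.
    by rewrite (Rintegral_FTC2 s1 cw dE) E1 sub0r opprK.
  rewrite JE mulrAC mulfV ?gt_eqF// mul1r sqrrN.
  apply: le_trans (Rintegral_sqr_le cw).
  rewrite -[leLHS]real_normK ?num_real// lerXn2r ?nnegrE//.
    by apply: Rintegral_ge0 => t _.
  apply: (le_trans (le_normr_Rintegral _ Is)) => //.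
  apply: le_Rintegral_subset => //; last exact: continuous_integrable_itv.
  by move=> t /=; rewrite !in_itv/= => /andP[st ->]; rewrite (le_trans s0 st).
have IEJ : \int[mu]_(z in B) ((- E (normsq z)) ^+ 2) <= J.
  have Epi := unit_disc_measure R.
  have -> : J = \int[mu]_(z in B) (J / pi).
    by rewrite Rintegral_cst// [X in fine X]Epi divfK ?gt_eqF.
  apply: le_Rintegral => //.
  - exact: L2_integrable_sqr.
  - by apply: continuous_integrable_disc; exact: cst_continuous.
  - move=> z; rewrite unit_discE /= => Bz; rewrite sqrrN; apply: Es.
    by rewrite (ltW Bz) andbT normsqE addr_ge0 ?sqr_ge0.
have := Ig i0; have := Ig i1; rewrite -/J; move: IEJ.
move: (\int[mu]_(z in B) _) => x; move: (\int[mu]_(z in B) _) => y.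
by move: (\int[mu]_(z in B) _) => t; lra.
Qed.

(** [T] is the primitive of [step_approx] that vanishes at 1. Since [step_approx] is 0 beyond some
    [b < 1], [T] is constant there, hence 0, and its radial extension has compact support in the
    disc. *)
Lemma radial_test (N n : nat) : exists T : R -> R,
  [/\ forall s : R, is_derive s (1 : R) T (step_approx F1 N n s), T 1 = 0 &
  test_function B (fun z => - T (normsq z))].
Proof.
have sh := @smooth1_step_approx R F1 N n; have ch := smooth1_continuous sh.
pose b : R := 1 - n.+1%:R^-1.
have b1 : b < 1 by rewrite ltrBlDr ltrDl invr_gt0.
have h0 t : t \notin `[(-1), b] -> step_approx F1 N n t = 0.
  move=> /negP nt; apply: step_approx_support.
  have [?|t1] := leP t (-1); [by left|right]; rewrite leNgt; apply/negP => tb.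
  by apply: nt; rewrite ?inE/= in_itv/= !ltW.
have dP t := @is_derive_primitive _ _ _ _ t ch h0.
pose T s := primitive (step_approx F1 N n) s - primitive (step_approx F1 N n) 1.
have dT (s : R) : is_derive s (1 : R) T (step_approx F1 N n s).
  by have D := dP s; apply: is_derive_eq; rewrite subr0.
have sT : smooth1 T by exact: smooth1_primitive dT sh.
exists T; split=> //; first by rewrite /T subrr.
apply: (@disc_test _ _ b) => //.
  under eq_fun do rewrite -mulN1r.
  by apply: smoothM; [exact: smooth_cst|exact: (smooth_comp sT (@smooth_normsq R))].
move=> z bz; apply/eqP; rewrite oppr_eq0; apply/eqP.
have T0 t : b <= t -> T t = T b.
  move=> bt; apply/eqP; rewrite -subr_eq0 -(Rintegral_FTC2 bt ch dT); apply/eqP.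
  apply: Rintegral_eq0 => s; rewrite /= in_itv/= => /andP[bs _].
  by apply: step_approx_support; right.
rewrite (T0 _ (ltW bz)) -(T0 _ (ltW b1)); exact: subrr.
Qed.

Lemma radial_admissible : admissible B C v.
Proof.
split; first exact: radial_Wk2.
have -> : (fun z => v z - C) = (fun z => - F (normsq z)).
  by apply/funext => z; rewrite /v addrAC subrr add0r.
have cNF : continuous (fun z => - F (normsq z)).
  by move=> z; apply: cvgN; exact: continuous_radial.
split.
  split; first exact: L2_continuous.
  move=> [|i [|//]] _; first by exists (fun z => - F (normsq z)); exact: weak_deriv_continuous0.
  have D z : is_derive z (basis2 R i) (fun z => - F (normsq z)) (g i z).
    by have D := is_derive_radial i z dF; exact: is_deriveN.
  have gE : 'D_(basis2 R i) (fun z => - F (normsq z)) = g i.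
    by apply/funext => z; case: (D z).
  exists ('D_(basis2 R i) (fun z => - F (normsq z))); apply: weak_deriv_C1 => //; last by rewrite gE.
move=> e e0.
(* Room for the factor 9 of [radial_W12_normsq] and for a strict inequality. *)
have e10 : 0 < e / 10 by rewrite divr_gt0.
have [N [n J]] := step_approx_L2 L0 cF1 F1L e10.
have [T [dT T1 tT]] := radial_test N n.
exists (fun z => - T (normsq z)); split=> //.
have -> : (fun z => - F (normsq z) - - T (normsq z)) = (fun z => - (F (normsq z) - T (normsq z))).
  by apply/funext => z; rewrite opprB opprK addrC.
have dE (s : R) : is_derive s (1 : R) (fun s => F s - T s) (F1 s - step_approx F1 N n s).
  by have D1 := dF s; have D2 := dT s; exact: is_deriveB.
apply: le_lt_trans (radial_W12_normsq dE _ _) _.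
- move=> s; apply: cvgB; first exact: cF1.
  exact/smooth1_continuous/smooth1_step_approx.
- by rewrite F10 T1 subrr.
rewrite lte_fin; move: J; move: (\int[mu]_(z in B) _) => x; lra.
Qed.

End Profile.

End RadialCompetitors.

(** * Optimal competitors and minimization over the radius *)

Section RadialMinimizer.
Variable R : realType.
Local Notation mu1 := (@lebesgue_measure R).
Local Notation mu := (lebesgue2 R).
Local Notation B := (@unit_disc R).
Local Notation leb_type := (g_sigma_algebraType R.-ocitv.-measurable).
Local Notation pi := (@pi R).
Local Notation normsq := (@normsq R).

Let mB : measurable (B : set (leb_type * leb_type)).
Proof. exact: measurable_unit_disc. Qed.

Lemma is_derive_piecewise (f g f' g' : R -> R) (a : R) :
  (forall s, s <= a -> is_derive s (1 : R) f (f' s)) ->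
  (forall s, a <= s -> is_derive s (1 : R) g (g' s)) -> f a = g a -> f' a = g' a ->
  forall s : R, is_derive s (1 : R) (fun s => if s < a then f s else g s)
    (if s < a then f' s else g' s).
Proof.
move=> df dg fga fga' s; case: (ltgtP s a) => sa.
- apply: near_eq_is_derive (df s (ltW sa)).
  by near=> t; rewrite ifT//; near: t; exact: lt_nbhsl.
- apply: near_eq_is_derive (dg s (ltW sa)).
  near=> t; rewrite ifF//; apply/negbTE; rewrite -leNgt ltW//.
  by near: t; exact: lt_nbhsr.
- rewrite sa; apply: is_derive_glue => //; last exact: dg.
  by rewrite -fga'; exact: df.
Unshelve. all: by end_near. Qed.

(* [pi * rate r] is half of [log_defect pi (pi * r)]. *)
Definition rate (r : R) : R := 1 - r + r * ln r.

Lemma rate_gt0 r : 0 < r < 1 -> 0 < rate r.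
Proof.
move=> /andP[r0 r1]; have nz : - ln r != 0.
  by rewrite oppr_eq0 ln_eq0// lt_eqF.
have := expR_gt1Dx nz; rewrite expRN lnK ?posrE// => H.
have : r * (1 - ln r) < r * r^-1 by rewrite ltr_pM2l.
rewrite mulfV ?gt_eqF//.
rewrite /rate; lra.
Qed.

Lemma rate_le r : 0 < r < 1 -> rate r <= 1 - r.
Proof.
move=> /andP[r0 r1]; rewrite /rate gerDl; apply: mulr_ge0_le0; first exact: ltW.
by have := ln_le_subr1 r0; lra.
Qed.

Lemma log_defect_rate (a : R) : 0 < a -> log_defect pi a = 2 * pi * rate (a / pi).
Proof.
move=> a0; rewrite /log_defect /rate; have p0 := pi_gt0 R.
rewrite !ln_div ?posrE//; move: (ln a) (ln pi) => x y.
by move: pi p0 => p p0; field; rewrite gt_eqF.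
Qed.

Lemma measurable_positive_part (v : R * R -> R) : continuous v ->
  measurable (B `&` [set x | 0 < v x] : set (leb_type * leb_type)).
Proof.
move=> cv; apply: measurableI => //; apply: open_measurable_plane.
have -> : [set x | 0 < v x] = v @^-1` [set t | 0 < t] by [].
by apply: open_comp; [move=> z _; exact: cv|exact: open_gt].
Qed.

Section Competitor.
Variables (C r : R).
Hypotheses (C0 : 0 < C) (r01 : 0 < r < 1).
(** The outer branch of [F] below takes the value [2 k rate r] at [r]; this choice makes it [C]. *)
Let k : R := C / (2 * rate r).
Let r0 : 0 < r. Proof. by case/andP: r01. Qed.
Let r1 : r < 1. Proof. by case/andP: r01. Qed.
Let k0 : 0 < k. Proof. by rewrite divr_gt0// mulr_gt0// rate_gt0. Qed.
Let kE : k * (2 * rate r) = C.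
Proof. by rewrite divfK// gt_eqF// mulr_gt0// rate_gt0. Qed.

(* [F] is the solution of [4 (s F')' = 4 k ln (max s r)] with [F 1 = 0] and
   [F r = C]; if [z = F (|x| ^ 2)] then [4 (s F')'] is the Laplacian of [z]. *)
Let F s := if s < r then C + k * ln r * (s - r)
  else k * (2 - 2 * s + (s * ln s + r * ln s)).
Let F1 s := if s < r then k * ln r else k * (-1 + ln s + r * s^-1).
Let F2 s := if s < r then 0 else k * (s^-1 + r * - (s ^- 2)).
(** An antiderivative of the squared Laplacian [16 k ^ 2 (ln (max s r)) ^ 2]; the constants of the
    inner branch make it continuous at [r]. Its increment over [[0, 1]] is [32 k ^ 2 rate r]. *)
Let Phi s := if s < r then 16 * k ^+ 2 * (ln r * ln r * (s - r) +
    (r * (ln r * ln r) - 2 * (r * ln r) + 2 * r))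
  else 16 * k ^+ 2 * (s * (ln s * ln s) - 2 * (s * ln s) + 2 * s).

Let s_gt0 s : r <= s -> 0 < s. Proof. exact: lt_le_trans. Qed.

Let dV (s : R) : 0 < s -> is_derive s (1 : R) (fun s => s^-1) (- (s ^- 2)).
Proof.
move=> s0; have := @is_deriveV R id s 1 1 (lt0r_neq0 s0) (is_derive_id _ _).
by rewrite /GRing.scale/= mulr1.
Qed.

Let dF (s : R) : is_derive s (1 : R) F (F1 s).
Proof.
apply: (is_derive_piecewise (f' := fun=> k * ln r) (g' := fun s => k * (-1 + ln s + r * s^-1))).
- by move=> t _; apply: is_derive_eq; rewrite /GRing.scale/=; ring.
- move=> t /s_gt0 t0; have D := is_derive1_ln t0.
  by apply: is_derive_eq; rewrite /GRing.scale/=; field; rewrite gt_eqF.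
- by rewrite -kE /rate; ring.
- by field; rewrite gt_eqF.
Qed.

Let dF1 (s : R) : is_derive s (1 : R) F1 (F2 s).
Proof.
apply: (is_derive_piecewise (f' := fun=> 0) (g' := fun s => k * (s^-1 + r * - (s ^- 2)))).
- move=> t /s_gt0 t0; have D := is_derive1_ln t0; have D' := dV t0.
  by apply: is_derive_eq; rewrite /GRing.scale/=; ring.
- by field; rewrite gt_eqF.
- by field; rewrite gt_eqF.
Qed.

Let cF2 : continuous F2.
Proof.
(* The maximum of [s] and [r]. Both branches of [F2] are [k (1 / m - r / m ^ 2)], which vanishes for
   [m = r]; this form is visibly continuous. *)
pose m (s : R) := 2^-1 * (s + r + `|s - r|).
have mE s : m s = if s < r then r else s.
  rewrite /m; case: ltP => sr; first by rewrite ltr0_norm ?subr_lt0//; lra.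
  by rewrite ger0_norm ?subr_ge0//; lra.
have m0 s : m s != 0 by rewrite mE; case: ltP => [_|/s_gt0 ?]; rewrite gt_eqF.
have -> : F2 = fun s => k * ((m s)^-1 + r * - ((m s)^-1 * (m s)^-1)).
  apply/funext => s; rewrite /F2 mE; case: ltP => sr.
    by field; rewrite gt_eqF.
  by rewrite -exprVn expr2.
have cm : continuous m.
  move=> s; apply: cvgM; first exact: cvg_cst.
  apply: cvgD; first by apply: cvgD; [exact: cvg_id|exact: cvg_cst].
  by apply: cvg_norm; apply: cvgB; [exact: cvg_id|exact: cvg_cst].
have cV : continuous (fun s => (m s)^-1) by move=> s; apply: cvgV; [exact: m0|exact: cm].
move=> s; apply: cvgM; first exact: cvg_cst.
apply: cvgD; first exact: cV.
by apply: cvgM; [exact: cvg_cst|apply: cvgN; apply: cvgM; exact: cV].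
Qed.

Let cF1 : continuous F1.
Proof. by apply: derivable_continuous => s; case: (dF1 s). Qed.

Let F2_bound s : `|F2 s| <= k / r.
Proof.
rewrite /F2; case: ltP => sr; first by rewrite normr0 divr_ge0// ltW.
have s0 := s_gt0 sr.
have sV : 0 < s^-1 by rewrite invr_gt0.
have rs : 0 <= r * s^-1 <= 1.
  by rewrite mulr_ge0 ?(ltW r0) ?(ltW sV)//= ler_pdivrMr// mul1r.
have vr : s^-1 <= r^-1 by rewrite lef_pV2.
rewrite -exprVn normrM (ger0_norm (ltW k0)) ler_wpM2l ?(ltW k0)//.
rewrite ler_norml; move: rs; move: (s^-1) (r^-1) sV vr => x y x0 xy /andP[a b].
by apply/andP; split; nra.
Qed.

Let F1_lipschitz x y : `|F1 x - F1 y| <= k / r * `|x - y|.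
Proof.
have H a b : a <= b -> `|F1 b - F1 a| <= k / r * `|b - a|.
  move=> ab; have [c _ ->] := @MVT_segment R F1 F2 a b ab (fun z _ => dF1 z)
    (continuous_subspaceT cF1).
  by rewrite normrM ler_wpM2r.
by case: (leP y x) => [|/ltW] /H//; rewrite distrC (distrC y).
Qed.

Let F_at1 : F 1 = 0.
Proof. by rewrite /F ltNge (ltW r1) /= ln1; ring. Qed.

Let lap_sqr s : (4 * (F1 s + s * F2 s)) ^+ 2 =
  if s < r then 16 * k ^+ 2 * (ln r * ln r) else 16 * k ^+ 2 * (ln s * ln s).
Proof.
rewrite /F1 /F2; case: ltP => sr; first by ring.
by have s0 := s_gt0 sr; move: (ln s) => q; field; rewrite gt_eqF.
Qed.

Let lap_integral : \int[mu1]_(s in `[0, 1]) ((4 * (F1 s + s * F2 s)) ^+ 2) =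
  8 * C ^+ 2 / rate r.
Proof.
have cL : continuous (fun s => 4 * (F1 s + s * F2 s)).
  move=> s; apply: cvgM; first exact: cvg_cst.
  by apply: cvgD; [exact: cF1|apply: cvgM; [exact: cvg_id|exact: cF2]].
have cL2 : continuous (fun s => (4 * (F1 s + s * F2 s)) ^+ 2).
  by move=> s; apply: cvgM; exact: cL.
have dPhi (s : R) : is_derive s (1 : R) Phi ((4 * (F1 s + s * F2 s)) ^+ 2).
  rewrite lap_sqr.
  apply: (@is_derive_piecewise
    (fun s => 16 * k ^+ 2 * (ln r * ln r * (s - r) + (r * (ln r * ln r) - 2 * (r * ln r) + 2 * r)))
    (fun s => 16 * k ^+ 2 * (s * (ln s * ln s) - 2 * (s * ln s) + 2 * s))
    (fun=> 16 * k ^+ 2 * (ln r * ln r)) (fun s => 16 * k ^+ 2 * (ln s * ln s))).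
  - by move=> t _; apply: is_derive_eq; rewrite /GRing.scale/=; ring.
  - move=> t /s_gt0 t0; have D := is_derive1_ln t0.
    by apply: is_derive_eq; rewrite /GRing.scale/=; field; rewrite gt_eqF.
  - by rewrite subrr mulr0 add0r.
  - exact: erefl.
rewrite (Rintegral_FTC2 ler01 cL2 dPhi) /Phi r0 ltNge (ltW r1) /= ln1.
have d0 := rate_gt0 r01; have dE : rate r = 1 - r + r * ln r by [].
rewrite -kE; move: dE; move: (rate r) d0 (ln r) => d d0 q dE.
have -> : r * q = d - 1 + r by rewrite dE; ring.
by field; rewrite gt_eqF.
Qed.

Let v z := C - F (normsq z).

(** Inside, [F] exceeds [C] by [k ln r (s - r)], a product with two nonpositive factors; so the
    competitor is nonpositive on a disc of area [pi r]. *)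
Let v_le0 z : normsq z <= r -> v z <= 0.
Proof.
rewrite /v /F le_eqVlt => /predU1P[->|zr].
  rewrite ltxx subr_le0 -[leLHS]kE /rate le_eqVlt; apply/orP; left; apply/eqP; ring.
rewrite zr; have := ln_le_subr1 r0 => lr.
suff : 0 <= k * ln r * (normsq z - r) by lra.
by apply: mulr_le0; [apply: mulr_ge0_le0; [exact: ltW|have := r1; lra]|rewrite subr_le0 ltW].
Qed.

Let pos_area : (mu (B `&` [set x | (0 < v x)%R]) <= (pi * (1 - r))%:E)%E.
Proof.
pose D : set (leb_type * leb_type) := [set z | normsq z < r].
have mD : measurable D by exact: open_disc_measurable.
have cv : continuous v.
  move=> z; apply: cvgB; first exact: cvg_cst.
  by apply: continuous_radial; apply: derivable_continuous => s; case: (dF s).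
have mP := measurable_positive_part cv.
have Epi := unit_disc_measure R; have Er := disc_area (ltW r0).
have DB : B `&` D = D.
  apply/setIidPr => z /= zr; rewrite unit_discE /=; exact: lt_trans zr r1.
have E : mu (B `\` D) = (pi * (1 - r))%:E.
  rewrite measureD// ?[X in (X < _)%E]Epi ?ltry//.
  by rewrite [X in (X - _)%E]Epi [X in (_ - X)%E](_ : _ = (pi * r)%:E) ?DB// -EFinB mulrBr mulr1.
rewrite -E; apply: le_measure; rewrite ?inE//; first exact: measurableD.
move=> z [Bz /= vz]; split=> // zr.
by have := v_le0 (ltW zr); rewrite leNgt vz.
Qed.

(** An upper bound for the energy is enough, because [energy_lower_bound] supplies the opposite
    inequality at the optimal radius. *)
Lemma radial_competitor : exists u, [/\ admissible B C u, radial B u &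
  (energy B u <= (pi * (8 * C ^+ 2 / rate r + (1 - r)))%:E)%E].
Proof.
have L0 : 0 <= k / r by rewrite divr_ge0// ltW.
exists v; split.
- exact: radial_admissible dF dF1 cF2 F_at1 L0 F1_lipschitz.
- exists (fun t => C - F (t ^+ 2)) => x _; rewrite /v /eucl_norm sqr_sqrtr//.
  by rewrite addr_ge0 ?sqr_ge0.
have Lap := radial_laplacian C dF dF1 cF2.
have Wv := radial_Wk2 C dF dF1 cF2.
rewrite /energy (integral_EFin mB (L2_integrable_sqr (L2_weak_laplacian Wv))) Lap lap_integral.
by rewrite mulrDr EFinD leeD2l.
Qed.

End Competitor.

Lemma constant_competitor (C : R) : admissible B C (fun=> C) /\ (energy B (fun=> C) <= pi%:E)%E.
Proof.
have D (f : R -> R) (c : R) : f = (fun=> c) -> forall s : R, is_derive s (1 : R) f 0.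
  by move=> -> s; exact: is_derive_cst.
have D0 := D _ 0 erefl.
have c0 : continuous (fun=> 0 : R) := @cst_continuous R R 0.
have Adm := @radial_admissible R _ _ _ C 0 D0 D0 c0 erefl (lexx 0).
have Lap := radial_laplacian C D0 D0 c0.
have E : (fun z => C - 0) = (fun=> C) :> (R * R -> R) by apply/funext => z; rewrite subr0.
rewrite E in Adm; rewrite E in Lap.
have A : admissible B C (fun=> C).
  by apply: Adm => x y; rewrite subrr normr0 mul0r.
split=> //; rewrite /energy (integral_EFin mB (L2_integrable_sqr (L2_weak_laplacian A.1))) Lap.
rewrite Rintegral_eq0 ?mulr0 ?add0e; last by move=> s _; rewrite mulr0 addr0 mulr0 expr0n.
have Epi := unit_disc_measure R; rewrite -Epi; apply: le_measure; rewrite ?inE//.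
by apply: measurable_positive_part; exact: cst_continuous.
Qed.

(** If [u <= 0] only on a null set, the area term alone is [pi]. Otherwise [r] is the fraction of
    the disc where [u <= 0], and [laplacian_lower_bound] becomes a bound in terms of [rate r]. *)
Lemma energy_lower_bound (C : R) u : 0 < C -> admissible B C u ->
  (pi%:E <= energy B u)%E \/ exists2 r, 0 < r < 1 &
  ((pi * (8 * C ^+ 2 / rate r + (1 - r)))%:E <= energy B u)%E.
Proof.
move=> C0 uC; have Lf := L2_weak_laplacian uC.1.
have [Ia mE] := nonpos_area uC.1.1.1; have LB := laplacian_lower_bound C0 uC.
rewrite /energy (integral_EFin mB (L2_integrable_sqr Lf)) [X in (_ + X)%E]mE -EFinD !lee_fin.
have a0 : 0 <= \int[mu]_(z in B) (u z <= 0)%R%:R by apply: Rintegral_ge0.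
have ap : \int[mu]_(z in B) (u z <= 0)%R%:R <= pi.
  by rewrite -subr_ge0 -lee_fin -mE; exact: measure_ge0.
have F0 : 0 <= \int[mu]_(z in B) (weak_laplacian B u z ^+ 2).
  by apply: Rintegral_ge0 => z _; exact: sqr_ge0.
move: LB a0 ap F0 {Ia mE}; move: (\int[mu]_(z in B) (u z <= 0)%R%:R) => a.
move: (\int[mu]_(z in B) _) => f LB a0 ap f0; have p0 := pi_gt0 R.
move: a0; rewrite le_eqVlt => /predU1P[<-|a0]; first by left; rewrite subr0 lerDr.
right; have C2 : 0 < 16 * pi ^+ 2 * C ^+ 2 by rewrite !mulr_gt0 ?exprn_gt0.
have ar0 : 0 < a / pi by rewrite divr_gt0.
(* For [a = pi] the defect would be 0, and [laplacian_lower_bound] would force [C] to vanish. *)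
have ar1 : a / pi < 1.
  rewrite ltr_pdivrMr// mul1r lt_neqAle ap andbT; apply/eqP => E.
  have := lt_le_trans C2 (LB a0); rewrite E /log_defect divff ?gt_eqF// ln1 mulr0 subr0 subrr.
  by rewrite !mulr0 ltxx.
exists (a / pi); first by rewrite ar0.
have d0 : 0 < rate (a / pi) by rewrite rate_gt0// ar0.
have := LB a0; rewrite (log_defect_rate a0); move: (rate _) d0 => d d0 H.
rewrite mulrDr; apply: lerD; last first.
  by rewrite mulrBr mulr1 mulrCA mulfV ?gt_eqF// mulr1.
rewrite mulrA ler_pdivrMr// -(ler_pM2l (_ : 0 < 2 * pi)) ?mulr_gt0//.
move: H; move: pi => p; lra.
Qed.

End RadialMinimizer.

Theorem corollary10p4 (R : realType) (C : R) (hC : 0 < C) :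
  exists v : R * R -> R,
    minimizer (@unit_disc R) C v /\ radial (@unit_disc R) v.
Proof.
pose E (r : R) := 8 * C ^+ 2 / rate r + (1 - r).
have p0 := pi_gt0 R.
have C2 : 0 < 8 * C ^+ 2 by rewrite mulr_gt0 ?exprn_gt0.
(* A value [X] that is above the energy of [v] and below all energies identifies the infimum, so no
   energy has to be known exactly. *)
have minI v X : admissible (@unit_disc R) C v -> (energy (@unit_disc R) v <= X)%E ->
    (forall u, admissible (@unit_disc R) C u -> (X <= energy (@unit_disc R) u)%E) ->
    minimizer (@unit_disc R) C v.
  move=> Av vX XA; split=> //; apply/eqP; rewrite eq_le; apply/andP; split.
    by apply: le_ereal_inf_tmp => _ [u Au <-]; exact: le_trans vX (XA u Au).
  by apply: ereal_inf_lbound; exists v.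
(* The constant [C] wins exactly when no radius brings the reduced energy below 1, the value of [pi]
   after division by [pi]. *)
have [H|] := pselect (forall r, 0 < r < 1 -> 1 <= E r).
  have [Ac Ec] := constant_competitor C; exists (fun=> C); split; last by exists (fun=> C).
  apply: (minI _ _ Ac Ec) => u Au.
  have [//|[r r01]] := energy_lower_bound hC Au; apply: le_trans.
  by rewrite lee_fin -[leLHS]mulr1 ler_pM2l// H.
move=> /existsNP[q /not_implyP[q01 /negP]]; rewrite -ltNge => Eq1.
have Eq0 : 1 - q < E q by rewrite ltrDr divr_gt0// rate_gt0.
(* Radii outside [[a, b]] do not compete with [q]: for [t < a] already [1 - t] exceeds [E q], and
   for [t > b] one has [rate t <= 1 - t < 8 C ^ 2], so that the first summand of [E t] is at least
   1. *)
pose a := 1 - E q; pose b := 1 - Num.min (8 * C ^+ 2) (1 / 2).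
have /andP[q0 q1] := q01.
have a0 : 0 < a by rewrite subr_gt0.
have b1 : b < 1 by rewrite ltrBlDr ltrDl lt_min C2 divr_gt0.
have aq : a <= q by rewrite lerBlDr -lerBlDl ltW.
have Elarge r : 0 < r < 1 -> b < r -> 1 <= E r.
  move=> r01 br; have /andP[r0 r1] := r01; have d0 := rate_gt0 r01.
  rewrite -[leLHS]addr0 lerD ?subr_ge0 ?(ltW r1)// ler_pdivlMr// mul1r.
  apply: le_trans (rate_le r01) _.
  have : Num.min (8 * C ^+ 2) (1 / 2) <= 8 * C ^+ 2 by rewrite ge_min lexx.
  by move: br; rewrite /b; lra.
have qb : q <= b by rewrite leNgt; apply/negP => /(Elarge _ q01); rewrite leNgt Eq1.
have cE : {within `[a, b], continuous E}.
  apply: continuous_in_subspaceT => r; rewrite inE /= in_itv/= => /andP[ar rb].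
  have r0 := lt_le_trans a0 ar; have r1 := le_lt_trans rb b1.
  apply: cvgD; last by apply: cvgB; [exact: cvg_cst|exact: cvg_id].
  apply: cvgM; first exact: cvg_cst.
  apply: cvgV; first by rewrite gt_eqF// rate_gt0// r0.
  apply: cvgD; first by apply: cvgB; [exact: cvg_cst|exact: cvg_id].
  by apply: cvgM; [exact: cvg_id|exact: continuous_ln].
(* On the compact interval [[a, b]], inside []0, 1[], the continuous function [E] attains its
   minimum; since [q] lies there, that minimum also beats all radii outside. *)
have [r] := EVT_min (le_trans aq qb) cE.
rewrite in_itv/= => /andP[ar rb] Emin.
have Eqr : E r <= E q by apply: Emin; rewrite in_itv/= aq qb.
have r01 : 0 < r < 1 by rewrite (lt_le_trans a0 ar) (le_lt_trans rb b1).
have [v [Av rv vE]] := radial_competitor hC r01.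
exists v; split=> //; apply: (minI _ _ Av vE) => u Au.
have [pE|[t t01]] := energy_lower_bound hC Au; [apply: le_trans pE|apply: le_trans].
  by rewrite lee_fin -[leRHS]mulr1 ler_pM2l//; apply/ltW/(le_lt_trans Eqr).
rewrite lee_fin ler_pM2l//; change (E r <= E t).
have [ta|ta] := ltP t a.
  apply: (le_trans Eqr); have d0 := rate_gt0 t01.
  have : 0 < 8 * C ^+ 2 / rate t by rewrite divr_gt0.
  by move: ta; rewrite /a [E t]/E; move: (E q) => Q; lra.
have [bt|tb] := ltP b t; last by apply: Emin; rewrite in_itv/= ta.
exact: le_trans (le_trans Eqr (ltW Eq1)) (Elarge _ t01 bt).
Qed.
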